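(* Let $m,n\geq 2$ be integers, and let $f$ and $g$ be meromorphic functions on $\mathbf{C}$ satisfying $f^m(z)+g^n(z)=1$ on $\mathbf{C}$. Then: (i) if $m=n=2$, then $f$ and $g$ are constant if and only if $\mathcal{Z}(f')=\mathcal{Z}(g')$ counting multiplicity; (ii) if $(m,n)\neq(2,2)$, then $f$ and $g$ are constant if and only if $\mathcal{Z}(f')\subseteq\mathcal{Z}(g')$ or $\mathcal{Z}(f')\supseteq\mathcal{Z}(g')$ ignoring multiplicity.
   Context: For a meromorphic function $h$ on $\mathbf{C}$, $\mathcal{Z}(h)$ denotes the zero set of $h$. ''$\mathcal{Z}(h_1)=\mathcal{Z}(h_2)$ counting multiplicity'' means that $h_1$ and $h_2$ have the same zeros with the same multiplicities (two identically zero functions are regarded as having the same zeros counting multiplicity). ''Ignoring multiplicity'' means that the zero sets are compared simply as sets of points. *)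

(* Defs.v *)
From Stdlib Require Import Reals.
From Coquelicot Require Import Coquelicot.

Open Scope C_scope.

Definition holomorphic_at (h : C -> C) (z0 : C) : Prop :=
  locally z0 (fun z : C => @ex_derive C_AbsRing C_NormedModule h z).

(* A function [f : C -> option C] takes values in the Riemann sphere, [None]
   being the point at infinity.  With this encoding the values determine the
   meromorphic function: removable singularities are filled in, the poles are
   exactly the points where [f] is [None], and two meromorphic functions are
   equal iff they agree pointwise. *)

Definition regular_at (f : C -> option C) (z0 : C) : Prop :=
  exists h : C -> C,
    holomorphic_at h z0 /\
    locally z0 (fun z : C => f z = Some (h z)).

Definition pole_at (f : C -> option C) (z0 : C) : Prop :=
  f z0 = None /\
  exists (k : nat) (h : C -> C),
    (1 <= k)%nat /\ holomorphic_at h z0 /\ h z0 <> 0 /\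
    locally' z0 (fun z : C => f z = Some (h z / (z - z0) ^ k)).

Definition meromorphic (f : C -> option C) : Prop :=
  forall z0 : C, regular_at f z0 \/ pole_at f z0.

Definition is_constant (f : C -> option C) : Prop :=
  exists c : C, forall z : C, f z = Some c.

Definition finite_part (f : C -> option C) (z : C) : C :=
  match f z with Some a => a | None => 0 end.

(* The derivative of a meromorphic function has the same poles.  At any other
   point [finite_part f] agrees with [f] in a neighbourhood, so that [C_derive]
   is the complex derivative of [f] there. *)
Definition mderive (f : C -> option C) (z : C) : option C :=
  match f z with
  | Some _ => Some (C_derive (finite_part f) z)
  | None => None
  end.

(* The equation f^m + g^n = 1 between meromorphic functions: the two sides agree
   off the poles of [f] and [g], which form a discrete set. *)
Definition fermat_eq (m n : nat) (f g : C -> option C) : Prop :=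
  forall z a b : C, f z = Some a -> g z = Some b -> a ^ m + b ^ n = 1.

Definition zero_set (h : C -> option C) (z : C) : Prop := h z = Some (RtoC 0).

Definition zero_of_order (h : C -> option C) (z0 : C) (k : nat) : Prop :=
  (1 <= k)%nat /\
  exists u : C -> C,
    holomorphic_at u z0 /\ u z0 <> 0 /\
    locally z0 (fun z : C => h z = Some ((z - z0) ^ k * u z)).

Definition zeros_subset (h1 h2 : C -> option C) : Prop :=
  forall z : C, zero_set h1 z -> zero_set h2 z.

(* An identically zero function vanishes everywhere and has no zero of finite
   order, so two identically zero functions have the same zeros counting
   multiplicity, while an identically zero function and one that is not do not,
   as their zero sets differ. *)
Definition same_zeros_mult (h1 h2 : C -> option C) : Prop :=
  (forall z : C, zero_set h1 z <-> zero_set h2 z) /\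
  (forall (z : C) (k : nat), zero_of_order h1 z k <-> zero_of_order h2 z k).

(* Main.v *)
(* For a solution (f, g) consider u = |f'| W(|f|^2, |g|^2), where W is a product
   of negative powers of |f| and |g| and of small positive powers of
   1 + |f|^(2 alpha) and 1 + |g|^(2 alpha').  The exponents are chosen so that u
   extends continuously by 0 to the poles and to the zeros of g, and so that
   Delta log u >= c u^2 wherever u > 0.  Comparison with the hyperbolic metric of
   a disc of radius R (Ahlfors' lemma) gives u = O(1/R), hence u = 0 and f' = 0;
   this replaces both Picard's theorem and the ramification bound of Nevanlinna
   theory.

   Continuity at the zeros of g is where the hypotheses enter.  In (ii), f'
   vanishes at every zero of g, so Z(f') in Z(g') makes all zeros of g multiple.
   In (i), f f' = - g g' shows that f' and g' have different orders at a zero of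
   f or g, so f and g have no zeros at all. *)

Require Import Defs.
From Stdlib Require Import Reals Lra Lia Classical ClassicalEpsilon Wf_nat.
From Corelib Require Import ssreflect.
From Coquelicot Require Import Coquelicot.
Open Scope C_scope.
Open Scope R_scope.
Open Scope general_if_scope.

(** * Neighbourhoods and continuity in the complex plane *)

(** On the affine curve a^m + b^n = 1, W |da| is a conformal metric, and u is its pull-back. Powers
    of |a| and |b| have harmonic logarithms, so they set the growth of W without touching the
    curvature. All negative curvature comes from factors such as 1 + |a|^(2 alpha), which also
    enlarge W at infinity; small exponents leave room for both.

    For small m, n some singularity of W is unavoidable: x^3 + y^3 = 1 has nonconstant elliptic
    solutions, and x^2 + y^2 = 1 has cosine and sine. In (ii) W blows up like |b|^-(n - 1 + 1/4) at
    b = 0. A zero of g of order at least 2 absorbs this, a simple one would not, and the same power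
    makes W decay at infinity. For m = n = 2 that decay is too slow at a simple pole; there zeros of
    finite order are excluded for both functions, so W may be singular along a = 0 as well.

    Little function theory is required: f' must be holomorphic again, so that log |f'| is harmonic
    off its zeros, and a zero must have finite order unless the function vanishes nearby. Both come
    from Cauchy integrals over squares. *)

Definition near (z0 : C) (P : C -> Prop) : Prop :=
  exists d : R, 0 < d /\ forall z : C, Cmod (z - z0) < d -> P z.

Lemma Cmod_Re_Im (z : C) : Cmod z <= Rabs (Re z) + Rabs (Im z).
Proof.
  unfold Cmod, Re, Im. apply Rsqr_incr_0_var.
  - rewrite -> Rsqr_sqrt by nra. pose proof (Rabs_pos (fst z)). pose proof (Rabs_pos (snd z)).
    unfold Rsqr. rewrite -(pow2_abs (fst z)) -(pow2_abs (snd z)). nra.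
  - pose proof (Rabs_pos (fst z)). pose proof (Rabs_pos (snd z)). lra.
Qed.

Lemma Re_le_Cmod (z : C) : Rabs (Re z) <= Cmod z.
Proof. eapply Rle_trans; [apply Rmax_l | apply Rmax_Cmod]. Qed.

Lemma Im_le_Cmod (z : C) : Rabs (Im z) <= Cmod z.
Proof. eapply Rle_trans; [apply Rmax_r | apply Rmax_Cmod]. Qed.

Lemma Cmod_sqr (z : C) : Cmod z ^ 2 = Re z ^ 2 + Im z ^ 2.
Proof. unfold Cmod, Re, Im. rewrite pow2_sqrt; [reflexivity | nra]. Qed.

Lemma Cmod_minus_sym (a b : C) : Cmod (a - b) = Cmod (b - a).
Proof. rewrite <- Cmod_opp. f_equal. ring. Qed.

Lemma Cmod_minus_le (a b : C) : Cmod a - Cmod b <= Cmod (a - b).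
Proof.
  pose proof (Cmod_triangle (a - b) b) as H.
  replace (a - b + b)%C with a in H by ring. lra.
Qed.

Lemma Cmod_dist (a b : C) : Rabs (Cmod a - Cmod b) <= Cmod (a - b).
Proof.
  pose proof (Cmod_minus_le a b). pose proof (Cmod_minus_le b a) as H0.
  rewrite Cmod_minus_sym in H0. apply Rabs_le. lra.
Qed.

Lemma Cmod_minus_self (a : C) : Cmod (a - a) = 0.
Proof. replace (a - a)%C with (RtoC 0) by ring. apply Cmod_0. Qed.

Lemma near_locally (z0 : C) (P : C -> Prop) : locally z0 P <-> near z0 P.
Proof.
  split.
  - intros [e He]. exists e. split. apply cond_pos.
    intros z Hz. apply He. split; unfold ball; simpl; unfold AbsRing_ball, abs, minus, plus, opp; simpl.
    + eapply Rle_lt_trans; [|exact Hz]. apply (Re_le_Cmod (z - z0)%C).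
    + eapply Rle_lt_trans; [|exact Hz]. apply (Im_le_Cmod (z - z0)%C).
  - intros [d [Hd H]]. assert (0 < d / 2) by lra. exists (mkposreal _ H0).
    intros z [H1 H2]. apply H. unfold ball in H1, H2; simpl in H1, H2.
    unfold AbsRing_ball, abs, minus, plus, opp in H1, H2; simpl in H1, H2.
    eapply Rle_lt_trans; [apply Cmod_Re_Im|]. unfold Re, Im. simpl. lra.
Qed.

Lemma near_and (z0 : C) (P Q : C -> Prop) :
  near z0 P -> near z0 Q -> near z0 (fun z => P z /\ Q z).
Proof.
  rewrite <- !near_locally. apply filter_and.
Qed.

Lemma near_imp (z0 : C) (P Q : C -> Prop) :
  (forall z, P z -> Q z) -> near z0 P -> near z0 Q.
Proof. intros H [d [Hd HP]]. exists d; split; auto. Qed.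

Lemma near_self (z0 : C) (P : C -> Prop) : near z0 P -> P z0.
Proof. intros [d [Hd H]]. apply H. rewrite Cmod_minus_self. exact Hd. Qed.

Lemma near_near (z0 : C) (P : C -> Prop) : near z0 P -> near z0 (fun z => near z P).
Proof.
  intros [d [Hd H]]. exists d. split; [exact Hd|].
  intros z Hz. exists (d - Cmod (z - z0)). split; [lra|].
  intros w Hw. apply H. replace (w - z0)%C with ((w - z) + (z - z0))%C by ring.
  eapply Rle_lt_trans; [apply Cmod_triangle|lra].
Qed.

Lemma continuous_C_eps (f : C -> C) (z : C) :
  continuous f z <->
  forall e, 0 < e -> near z (fun w => Cmod (f w - f z) < e).
Proof.
  split.
  - intros H e He. apply near_locally. apply (H (fun y => Cmod (y - f z) < e)).
    apply near_locally. exists e. auto.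
  - intros H P HP. apply near_locally in HP. destruct HP as [e [He HP]].
    apply near_locally. eapply near_imp; [|apply (H e He)]. simpl. auto.
Qed.

Lemma continuous_R_eps (f : C -> R) (z : C) :
  continuous f z <->
  forall e, 0 < e -> near z (fun w => Rabs (f w - f z) < e).
Proof.
  split.
  - intros H e He. apply near_locally. apply (H (fun y => Rabs (y - f z) < e)).
    exists (mkposreal e He). auto.
  - intros H P [e HP].
    apply near_locally. eapply near_imp; [|apply (H e (cond_pos e))]. simpl. intros w Hw. apply HP, Hw.
Qed.

Lemma continuous_Cmod (z : C) : continuous Cmod z.
Proof.
  apply continuous_R_eps. intros e He. exists e. split; [exact He|].
  intros w Hw. eapply Rle_lt_trans; [apply Cmod_dist|exact Hw].
Qed.

Lemma continuous_Re (z : C) : continuous Re z.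
Proof. apply continuous_fst. Qed.

Lemma continuous_Im (z : C) : continuous Im z.
Proof. apply continuous_snd. Qed.

Lemma continuous_pairC (T : UniformSpace) (a b : T -> R) (z : T) :
  continuous a z -> continuous b z -> continuous (fun w => (a w, b w) : C) z.
Proof.
  intros Ha Hb P HP. apply near_locally in HP. destruct HP as [e [He HP]].
  assert (He2 : 0 < e / 2) by lra.
  assert (Ha' : locally z (fun w => ball (a z) (mkposreal _ He2) (a w))) by apply Ha, locally_ball.
  assert (Hb' : locally z (fun w => ball (b z) (mkposreal _ He2) (b w))) by apply Hb, locally_ball.
  change (locally z (fun w => P (a w, b w))).
  generalize (filter_and _ _ Ha' Hb'). apply filter_imp. intros w [H1 H2]. apply HP.
  eapply Rle_lt_trans; [apply Cmod_Re_Im|].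
  unfold ball in H1, H2; simpl in H1, H2. unfold AbsRing_ball, abs, minus, plus, opp in H1, H2; simpl in H1, H2.
  unfold Re, Im; simpl. lra.
Qed.

Lemma continuous_ReIm (T : UniformSpace) (f : T -> C) (z : T) :
  continuous f z <-> continuous (fun w => Re (f w)) z /\ continuous (fun w => Im (f w)) z.
Proof.
  split.
  - intros H. split; apply (continuous_comp f); auto using continuous_Re, continuous_Im.
  - intros [H1 H2].
    apply (continuous_ext (fun w => (Re (f w), Im (f w)) : C)).
    + intros w. unfold Re, Im. destruct (f w); reflexivity.
    + apply continuous_pairC; assumption.
Qed.

Lemma continuous_Cplus (T : UniformSpace) (f g : T -> C) (z : T) :
  continuous f z -> continuous g z -> continuous (fun w => f w + g w)%C z.
Proof.
  intros Hf Hg. apply continuous_ReIm in Hf; apply continuous_ReIm in Hg.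
  destruct Hf, Hg. apply continuous_pairC; apply: continuous_plus; assumption.
Qed.

Lemma continuous_Copp (T : UniformSpace) (f : T -> C) (z : T) :
  continuous f z -> continuous (fun w => - f w)%C z.
Proof.
  intros Hf. apply continuous_ReIm in Hf.
  destruct Hf. apply continuous_pairC; apply: continuous_opp; assumption.
Qed.

Lemma continuous_Cminus (T : UniformSpace) (f g : T -> C) (z : T) :
  continuous f z -> continuous g z -> continuous (fun w => f w - g w)%C z.
Proof.
  intros Hf Hg. apply continuous_Cplus; [assumption | apply continuous_Copp; assumption].
Qed.

Lemma continuous_Cmult (T : UniformSpace) (f g : T -> C) (z : T) :
  continuous f z -> continuous g z -> continuous (fun w => f w * g w)%C z.
Proof.
  intros Hf Hg. apply continuous_ReIm in Hf; apply continuous_ReIm in Hg.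
  destruct Hf, Hg. apply continuous_pairC.
  - apply: continuous_minus; apply: continuous_mult; assumption.
  - apply: continuous_plus; apply: continuous_mult; assumption.
Qed.

Lemma continuous_Cinv (T : UniformSpace) (f : T -> C) (z : T) :
  continuous f z -> f z <> RtoC 0 -> continuous (fun w => / f w)%C z.
Proof.
  intros Hf H0. apply continuous_ReIm in Hf. destruct Hf.
  assert (Hn : Re (f z) ^ 2 + Im (f z) ^ 2 <> 0).
  { rewrite <- Cmod_sqr. apply pow_nonzero. intros E. apply H0, Cmod_eq_0, E. }
  assert (Hd : continuous (fun w => / (Re (f w) ^ 2 + Im (f w) ^ 2)) z).
  { apply (continuous_comp (fun w => Re (f w) ^ 2 + Im (f w) ^ 2) Rinv).
    - apply: continuous_plus.
      + apply (continuous_comp (fun w => Re (f w)) (fun x => x ^ 2)); [assumption|].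
        apply: ex_derive_continuous. auto_derive. exact I.
      + apply (continuous_comp (fun w => Im (f w)) (fun x => x ^ 2)); [assumption|].
        apply: ex_derive_continuous. auto_derive. exact I.
    - apply continuous_Rinv. exact Hn. }
  apply continuous_pairC.
  - apply: continuous_mult; assumption.
  - apply: continuous_mult; [apply: continuous_opp|]; assumption.
Qed.

Lemma continuous_Cpow (T : UniformSpace) (f : T -> C) (k : nat) (z : T) :
  continuous f z -> continuous (fun w => f w ^ k)%C z.
Proof.
  intros Hf. induction k as [|k IH]; simpl.
  - apply continuous_const.
  - apply continuous_Cmult; assumption.
Qed.

(** Caratheodory's form of differentiability: the difference quotient extends to a function
    continuous at z. The product and quotient rules then reduce to continuity lemmas and ring
    identities. *)
Definition cdiff (f : C -> C) (z l : C) : Prop :=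
  exists q : C -> C,
    continuous q z /\ q z = l /\ near z (fun w => f w = f z + q w * (w - z))%C.

Lemma cdiff_eps (f : C -> C) (z l : C) :
  cdiff f z l <->
  forall e, 0 < e ->
    near z (fun w => Cmod (f w - f z - l * (w - z)) <= e * Cmod (w - z)).
Proof.
  split.
  - intros [q [Hq [Hl Hn]]] e He. rewrite -> continuous_C_eps in Hq.
    eapply near_imp; [|apply (near_and _ _ _ Hn (Hq e He))].
    intros w [H1 H2]. rewrite -> H1, <- Hl.
    replace (f z + q w * (w - z) - f z - q z * (w - z))%C with ((q w - q z) * (w - z))%C by ring.
    rewrite Cmod_mult. apply Rmult_le_compat_r; [apply Cmod_ge_0|lra].
  - intros H. exists (fun w => if Ceq_dec w z then l else (f w - f z) / (w - z))%C.
    split; [|split].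
    + apply continuous_C_eps. intros e He. destruct (H (e / 2) ltac:(lra)) as [d [Hd Hn]].
      exists d. split; [exact Hd|]. intros w Hw.
      destruct (Ceq_dec z z) as [_|C]; [|congruence].
      destruct (Ceq_dec w z) as [->|Hwz].
      * rewrite Cmod_minus_self. exact He.
      * assert (Hm : 0 < Cmod (w - z)) by (apply Cmod_gt_0, Cminus_eq_contra, Hwz).
        specialize (Hn w Hw).
        replace ((f w - f z) / (w - z) - l)%C with ((f w - f z - l * (w - z)) / (w - z))%C
          by (field; apply Cminus_eq_contra, Hwz).
        rewrite Cmod_div; [|apply Cminus_eq_contra, Hwz].
        apply Rmult_lt_reg_r with (Cmod (w - z)); [exact Hm|].
        unfold Rdiv. rewrite -> Rmult_assoc, Rinv_l, Rmult_1_r by lra. nra.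
    + destruct (Ceq_dec z z) as [_|C]; [reflexivity|congruence].
    + exists 1. split; [lra|]. intros w _. destruct (Ceq_dec w z) as [->|Hwz].
      * ring.
      * field. apply Cminus_eq_contra, Hwz.
Qed.

Lemma is_derive_C_cdiff (f : C -> C) (z l : C) :
  @is_derive C_AbsRing C_NormedModule f z l <-> cdiff f z l.
Proof.
  rewrite cdiff_eps. split.
  - intros [_ H] e He.
    assert (Hz : is_filter_lim (@locally (AbsRing_UniformSpace C_AbsRing) z) z) by (intros P HP; exact HP).
    specialize (H z Hz (mkposreal e He)).
    (* Neighbourhoods in C come both from the absolute value and from the product structure;
       [locally_C] identifies the two. *)
    apply locally_C, near_locally in H.
    eapply near_imp; [|exact H]. simpl. intros w Hw.
    rewrite (Cmult_comm l). exact Hw.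
  - intros H. split; [apply is_linear_scal_l|].
    intros z' Hz'. assert (E : z = z') by exact (is_filter_lim_locally_unique _ _ Hz').
    subst z'. intros e. apply locally_C, near_locally.
    eapply near_imp; [|apply (H e (cond_pos e))]. simpl. intros w Hw.
    rewrite (Cmult_comm l) in Hw. exact Hw.
Qed.

(** * Complex differentiability *)

Lemma continuous_near_ext (T : UniformSpace) (f g : C -> T) (z : C) :
  near z (fun w => f w = g w) -> continuous f z -> continuous g z.
Proof. intros H. apply continuous_ext_loc, near_locally, H. Qed.

Lemma cdiff_continuous (f : C -> C) (z l : C) : cdiff f z l -> continuous f z.
Proof.
  intros [q [Hq [_ Hn]]].
  apply (continuous_near_ext _ (fun w => f z + q w * (w - z))%C).
  - eapply near_imp; [|exact Hn]. simpl. auto.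
  - apply continuous_Cplus; [apply continuous_const|].
    apply continuous_Cmult; [exact Hq|].
    apply continuous_Cminus; [apply continuous_id|apply continuous_const].
Qed.

Lemma cdiff_near_ext (f g : C -> C) (z l : C) :
  near z (fun w => f w = g w) -> cdiff f z l -> cdiff g z l.
Proof.
  intros H [q [Hq [Hl Hn]]]. exists q. split; [exact Hq|]. split; [exact Hl|].
  pose proof (near_self _ _ H) as Hz. simpl in Hz.
  eapply near_imp; [|apply (near_and _ _ _ H Hn)]. simpl. intros w [H1 H2]. congruence.
Qed.

Lemma cdiff_const (a z : C) : cdiff (fun _ => a) z 0.
Proof.
  exists (fun _ => RtoC 0). split; [apply continuous_const|]. split; [reflexivity|].
  exists 1. split; [lra|]. intros w _. ring.
Qed.

Lemma cdiff_id (z : C) : cdiff (fun w => w) z 1.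
Proof.
  exists (fun _ => RtoC 1). split; [apply continuous_const|]. split; [reflexivity|].
  exists 1. split; [lra|]. intros w _. ring.
Qed.

Lemma cdiff_plus (f g : C -> C) (z l m : C) :
  cdiff f z l -> cdiff g z m -> cdiff (fun w => f w + g w)%C z (l + m)%C.
Proof.
  intros [q [Hq [Hl Hn]]] [r [Hr [Hm Hk]]]. exists (fun w => q w + r w)%C.
  split; [apply continuous_Cplus; assumption|]. split; [congruence|].
  eapply near_imp; [|apply (near_and _ _ _ Hn Hk)]. simpl. intros w [-> ->]. ring.
Qed.

Lemma cdiff_mult (f g : C -> C) (z l m : C) :
  cdiff f z l -> cdiff g z m -> cdiff (fun w => f w * g w)%C z (l * g z + f z * m)%C.
Proof.
  intros Hf Hg. pose proof (cdiff_continuous _ _ _ Hg) as Hc.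
  destruct Hf as [q [Hq [Hl Hn]]]. destruct Hg as [r [Hr [Hm Hk]]].
  exists (fun w => q w * g w + f z * r w)%C.
  split; [|split].
  - apply continuous_Cplus; apply continuous_Cmult; try assumption. apply continuous_const.
  - congruence.
  - eapply near_imp; [|apply (near_and _ _ _ Hn Hk)]. simpl. intros w [-> H].
    rewrite H. ring.
Qed.

Lemma cdiff_scal (a : C) (f : C -> C) (z l : C) :
  cdiff f z l -> cdiff (fun w => a * f w)%C z (a * l)%C.
Proof.
  intros H. replace (a * l)%C with (0 * f z + a * l)%C by ring.
  apply (cdiff_mult (fun _ => a)); [apply cdiff_const|exact H].
Qed.

Lemma cdiff_minus (f g : C -> C) (z l m : C) :
  cdiff f z l -> cdiff g z m -> cdiff (fun w => f w - g w)%C z (l - m)%C.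
Proof.
  intros Hf Hg. apply cdiff_plus; [exact Hf|].
  replace (- m)%C with (- (1) * m)%C by ring.
  apply (cdiff_near_ext (fun w => - (1) * g w)%C).
  - exists 1. split; [lra|]. intros w _. ring.
  - apply cdiff_scal, Hg.
Qed.

Lemma near_neq0 (f : C -> C) (z : C) :
  continuous f z -> f z <> RtoC 0 -> near z (fun w => f w <> RtoC 0).
Proof.
  intros Hf H0. apply Cmod_gt_0 in H0.
  generalize (proj1 (continuous_C_eps f z) Hf _ H0). apply near_imp.
  intros w Hw E. rewrite E in Hw.
  replace (0 - f z)%C with (- f z)%C in Hw by ring. rewrite Cmod_opp in Hw. lra.
Qed.

Lemma cdiff_inv (f : C -> C) (z l : C) :
  cdiff f z l -> f z <> RtoC 0 -> cdiff (fun w => / f w)%C z (- l / (f z * f z))%C.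
Proof.
  intros Hf H0. pose proof (cdiff_continuous _ _ _ Hf) as Hc.
  destruct Hf as [q [Hq [Hl Hn]]].
  exists (fun w => - q w * / (f w * f z))%C. split; [|split].
  - apply continuous_Cmult; [apply continuous_Copp, Hq|].
    apply continuous_Cinv; [|apply Cmult_neq_0; exact H0].
    apply continuous_Cmult; [exact Hc|apply continuous_const].
  - rewrite Hl. reflexivity.
  - eapply near_imp; [|apply (near_and _ _ _ Hn (near_neq0 _ _ Hc H0))].
    simpl. intros w [H1 H2].
    replace (- q w * / (f w * f z) * (w - z))%C with (- (f z + q w * (w - z) - f z) * / (f w * f z))%C by ring.
    rewrite <- H1. field. split; assumption.
Qed.

Lemma cdiff_div (f g : C -> C) (z l m : C) :
  cdiff f z l -> cdiff g z m -> g z <> RtoC 0 ->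
  cdiff (fun w => f w / g w)%C z ((l * g z - f z * m) / (g z * g z))%C.
Proof.
  intros Hf Hg H0.
  replace ((l * g z - f z * m) / (g z * g z))%C
    with (l * / g z + f z * (- m / (g z * g z)))%C by (field; exact H0).
  apply (cdiff_mult f (fun w => / g w)%C); [exact Hf|]. apply cdiff_inv; assumption.
Qed.

Lemma cdiff_pow (f : C -> C) (k : nat) (z l : C) :
  cdiff f z l -> cdiff (fun w => f w ^ k)%C z (INR k * f z ^ (k - 1) * l)%C.
Proof.
  intros Hf. induction k as [|k IH].
  - simpl. replace (0 * 1 * l)%C with (RtoC 0) by ring. apply cdiff_const.
  - replace (INR (S k) * f z ^ (S k - 1) * l)%C
      with (l * f z ^ k + f z * (INR k * f z ^ (k - 1) * l))%C.
    + apply (cdiff_mult f (fun w => f w ^ k)%C); assumption.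
    + rewrite -> S_INR, RtoC_plus. replace (S k - 1)%nat with k by lia.
      destruct k as [|k]; simpl; [ring|].
      replace (k - 0)%nat with k by lia. ring.
Qed.

Lemma cdiff_unique (f : C -> C) (z l m : C) : cdiff f z l -> cdiff f z m -> l = m.
Proof.
  intros Hl Hm. apply is_derive_C_cdiff in Hl. apply is_derive_C_cdiff in Hm.
  apply is_C_derive_unique in Hl. apply is_C_derive_unique in Hm. congruence.
Qed.

Lemma cdiff_C_derive (f : C -> C) (z l : C) : cdiff f z l -> C_derive f z = l.
Proof. intros Hl. apply is_C_derive_unique, is_derive_C_cdiff, Hl. Qed.

(** The derivative is named by [C_derive], so that [hol (C_derive f)] can express a second
    differentiation. *)
Definition hol (f : C -> C) (z0 : C) : Prop := near z0 (fun z => cdiff f z (C_derive f z)).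

Lemma hol_intro (f : C -> C) (z0 : C) :
  near z0 (fun z => exists l, cdiff f z l) -> hol f z0.
Proof.
  apply near_imp. intros z [l Hl]. rewrite (cdiff_C_derive _ _ _ Hl). exact Hl.
Qed.

Lemma holomorphic_at_hol (f : C -> C) (z0 : C) : holomorphic_at f z0 <-> hol f z0.
Proof.
  unfold holomorphic_at. rewrite near_locally. split.
  - intros H. apply hol_intro. revert H. apply near_imp.
    intros z [l Hl]. exists l. apply is_derive_C_cdiff, Hl.
  - apply near_imp. intros z Hz. exists (C_derive f z). apply is_derive_C_cdiff, Hz.
Qed.

Lemma hol_cdiff (f : C -> C) (z0 : C) : hol f z0 -> cdiff f z0 (C_derive f z0).
Proof. apply (near_self z0 (fun z => cdiff f z (C_derive f z))). Qed.

Lemma hol_continuous (f : C -> C) (z0 : C) : hol f z0 -> continuous f z0.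
Proof. intros H. eapply cdiff_continuous, hol_cdiff, H. Qed.

Lemma hol_near_ext (f g : C -> C) (z0 : C) :
  near z0 (fun z => f z = g z) -> hol f z0 -> hol g z0.
Proof.
  intros H Hf. apply hol_intro.
  eapply near_imp; [|apply (near_and _ _ _ (near_near _ _ H) Hf)].
  simpl. intros z [H1 H2]. exists (C_derive f z). eapply cdiff_near_ext; eauto.
Qed.

Lemma hol_const (a z : C) : hol (fun _ => a) z.
Proof.
  apply hol_intro. exists 1. split; [lra|]. intros w _. exists (RtoC 0). apply cdiff_const.
Qed.

Lemma hol_id (z : C) : hol (fun w => w) z.
Proof.
  apply hol_intro. exists 1. split; [lra|]. intros w _. exists (RtoC 1). apply cdiff_id.
Qed.

Lemma hol_plus (f g : C -> C) (z : C) : hol f z -> hol g z -> hol (fun w => f w + g w)%C z.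
Proof.
  intros Hf Hg. apply hol_intro. eapply near_imp; [|apply (near_and _ _ _ Hf Hg)].
  simpl. intros w [H1 H2]. eexists. apply cdiff_plus; eassumption.
Qed.

Lemma hol_minus (f g : C -> C) (z : C) : hol f z -> hol g z -> hol (fun w => f w - g w)%C z.
Proof.
  intros Hf Hg. apply hol_intro. eapply near_imp; [|apply (near_and _ _ _ Hf Hg)].
  simpl. intros w [H1 H2]. eexists. apply cdiff_minus; eassumption.
Qed.

Lemma hol_mult (f g : C -> C) (z : C) : hol f z -> hol g z -> hol (fun w => f w * g w)%C z.
Proof.
  intros Hf Hg. apply hol_intro. eapply near_imp; [|apply (near_and _ _ _ Hf Hg)].
  simpl. intros w [H1 H2]. eexists. apply cdiff_mult; eassumption.
Qed.

Lemma hol_div (f g : C -> C) (z : C) :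
  hol f z -> hol g z -> g z <> RtoC 0 -> hol (fun w => f w / g w)%C z.
Proof.
  intros Hf Hg H0. apply hol_intro.
  eapply near_imp; [|apply (near_and _ _ _ Hf (near_and _ _ _ Hg (near_neq0 _ _ (hol_continuous _ _ Hg) H0)))].
  simpl. intros w [H1 [H2 H3]]. eexists. apply cdiff_div; eassumption.
Qed.

(** * Bisection of rectangles *)

Definition in_rect (a b c d : R) (z : C) : Prop := a <= Re z <= b /\ c <= Im z <= d.

(** Compactness in the form shared by the boundedness of continuous functions and Goursat's
    argument: a rectangle violating P has a quarter violating P, and the nested rectangles so
    obtained shrink to a point near which P holds. *)
Lemma rect_bisection (P : R -> R -> R -> R -> Prop) (a0 b0 c0 d0 : R) :
  a0 <= b0 -> c0 <= d0 ->
  (forall a b c d, a0 <= a -> a <= b -> b <= b0 -> c0 <= c -> c <= d -> d <= d0 ->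
     P a ((a + b) / 2) c ((c + d) / 2) -> P ((a + b) / 2) b c ((c + d) / 2) ->
     P a ((a + b) / 2) ((c + d) / 2) d -> P ((a + b) / 2) b ((c + d) / 2) d ->
     P a b c d) ->
  (forall z, in_rect a0 b0 c0 d0 z ->
     exists e, 0 < e /\ forall a b c d, a0 <= a -> b <= b0 -> c0 <= c -> d <= d0 ->
       in_rect a b c d z -> b - a < e -> d - c < e -> P a b c d) ->
  P a0 b0 c0 d0.
Proof.
  intros Hab Hcd Hsplit Hloc. apply NNPP. intros HnP.
  pose (Q := fun r : R * R * R * R => let '(a, b, c, d) := r in P a b c d).
  (* Passes to a quarter where P fails. The last quarter is taken without a test: by [Hsplit] it
     fails whenever the other three satisfy P. *)
  pose (step := fun r : R * R * R * R => let '(a, b, c, d) := r in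
    if excluded_middle_informative (P a ((a + b) / 2) c ((c + d) / 2)) then
    if excluded_middle_informative (P ((a + b) / 2) b c ((c + d) / 2)) then
    if excluded_middle_informative (P a ((a + b) / 2) ((c + d) / 2) d) then
      ((a + b) / 2, b, (c + d) / 2, d)
    else (a, (a + b) / 2, (c + d) / 2, d)
    else ((a + b) / 2, b, c, (c + d) / 2)
    else (a, (a + b) / 2, c, (c + d) / 2)).
  pose (s := fun k => Nat.iter k step (a0, b0, c0, d0)).
  pose (ga := fun r : R * R * R * R => fst (fst (fst r))).
  pose (gb := fun r : R * R * R * R => snd (fst (fst r))).
  pose (gc := fun r : R * R * R * R => snd (fst r)).
  pose (gd := fun r : R * R * R * R => snd r).
  assert (Hstep : forall r, a0 <= ga r -> ga r <= gb r -> gb r <= b0 ->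
                   c0 <= gc r -> gc r <= gd r -> gd r <= d0 -> ~ Q r ->
            ~ Q (step r) /\ ga r <= ga (step r) /\ gb (step r) <= gb r /\
            gb (step r) - ga (step r) = (gb r - ga r) / 2 /\
            gc r <= gc (step r) /\ gd (step r) <= gd r /\
            gd (step r) - gc (step r) = (gd r - gc r) / 2).
  { intros [[[a b] c] d]. unfold Q, ga, gb, gc, gd, step. simpl. intros H1 H2 H3 H4 H5 H6 HQ.
    destruct excluded_middle_informative as [p1|p1]; simpl; [|repeat split; try lra; assumption].
    destruct excluded_middle_informative as [p2|p2]; simpl; [|repeat split; try lra; assumption].
    destruct excluded_middle_informative as [p3|p3]; simpl; [|repeat split; try lra; assumption].
    repeat split; try lra. intros p4. apply HQ. apply Hsplit; assumption. }
  assert (Hinv : forall k, a0 <= ga (s k) /\ ga (s k) <= gb (s k) /\ gb (s k) <= b0 /\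
                   c0 <= gc (s k) /\ gc (s k) <= gd (s k) /\ gd (s k) <= d0 /\ ~ Q (s k) /\
                   gb (s k) - ga (s k) = (b0 - a0) / 2 ^ k /\
                   gd (s k) - gc (s k) = (d0 - c0) / 2 ^ k).
  { induction k as [|k (H1 & H2 & H3 & H4 & H5 & H6 & H7 & H8 & H9)].
    - unfold ga, gb, gc, gd; simpl. repeat split; try lra. exact HnP.
    - destruct (Hstep (s k) H1 H2 H3 H4 H5 H6 H7) as (K1 & K2 & K3 & K4 & K5 & K6 & K7).
      change (s (S k)) with (step (s k)).
      rewrite -> H8 in K4. rewrite -> H9 in K7.
      assert (0 < 2 ^ k) by (apply pow_lt; lra).
      assert (E1 : gb (step (s k)) - ga (step (s k)) = (b0 - a0) / 2 ^ S k) by (rewrite K4; simpl; field; lra).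
      assert (E2 : gd (step (s k)) - gc (step (s k)) = (d0 - c0) / 2 ^ S k) by (rewrite K7; simpl; field; lra).
      assert (0 <= (b0 - a0) / 2 ^ k / 2) by (apply Rmult_le_pos; [apply Rdiv_le_0_compat|]; lra).
      assert (0 <= (d0 - c0) / 2 ^ k / 2) by (apply Rmult_le_pos; [apply Rdiv_le_0_compat|]; lra).
      repeat split; try lra; assumption. }
  assert (Hmon : forall j k, ga (s j) <= ga (s (j + k)%nat) /\ gb (s (j + k)%nat) <= gb (s j) /\
                   gc (s j) <= gc (s (j + k)%nat) /\ gd (s (j + k)%nat) <= gd (s j)).
  { intros j. induction k as [|k IH].
    - rewrite Nat.add_0_r. lra.
    - rewrite Nat.add_succ_r. change (s (S (j + k))) with (step (s (j + k)%nat)).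
      destruct (Hinv (j + k)%nat) as (H1 & H2 & H3 & H4 & H5 & H6 & H7 & H8 & H9).
      destruct (Hstep _ H1 H2 H3 H4 H5 H6 H7) as (K1 & K2 & K3 & K4 & K5 & K6 & K7). lra. }
  assert (Hcross : forall j k, ga (s j) <= gb (s k) /\ gc (s j) <= gd (s k)).
  { intros j k. pose proof (Hmon j k) as H1. pose proof (Hmon k j) as H2.
    rewrite Nat.add_comm in H2. pose proof (Hinv (j + k)%nat). lra. }
  assert (Hx : exists x, forall k, ga (s k) <= x <= gb (s k)).
  { destruct (completeness (fun t => exists k, t = ga (s k))) as [x [Hx1 Hx2]].
    - exists b0. intros t [k ->]. pose proof (Hinv k). lra.
    - exists (ga (s 0%nat)). exists 0%nat. reflexivity.
    - exists x. intros k. split.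
      + apply Hx1. exists k. reflexivity.
      + apply Hx2. intros t [j ->]. apply Hcross. }
  assert (Hy : exists y, forall k, gc (s k) <= y <= gd (s k)).
  { destruct (completeness (fun t => exists k, t = gc (s k))) as [x [Hx1 Hx2]].
    - exists d0. intros t [k ->]. pose proof (Hinv k). lra.
    - exists (gc (s 0%nat)). exists 0%nat. reflexivity.
    - exists x. intros k. split.
      + apply Hx1. exists k. reflexivity.
      + apply Hx2. intros t [j ->]. apply Hcross. }
  destruct Hx as [x Hx]. destruct Hy as [y Hy].
  destruct (Hloc (x, y)) as [e [He Hloc']].
  { split; simpl; [apply (Hx 0%nat)|apply (Hy 0%nat)]. }
  assert (Hk : exists k, (b0 - a0) / 2 ^ k < e /\ (d0 - c0) / 2 ^ k < e).
  { pose (w := (b0 - a0) + (d0 - c0)).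
    destruct (Pow_x_infinity 2) with (b := w / e + 1) as [k Hk].
    - rewrite Rabs_right; lra.
    - exists k. specialize (Hk k (le_n k)).
      assert (H2 : 0 < 2 ^ k) by (apply pow_lt; lra).
      rewrite -> Rabs_right in Hk by lra.
      assert (H3 : w < e * 2 ^ k).
      { apply (Rmult_ge_compat_l e) in Hk; [|lra].
        replace (e * (w / e + 1)) with (w + e) in Hk by (field; lra). lra. }
      split; apply (Rmult_lt_reg_r (2 ^ k)); try assumption; unfold Rdiv;
        rewrite -> Rmult_assoc, Rinv_l, Rmult_1_r by lra; unfold w in H3; lra. }
  destruct Hk as [k [Hk1 Hk2]].
  destruct (Hinv k) as (H1 & H2 & H3 & H4 & H5 & H6 & H7 & H8 & H9).
  apply H7. destruct (s k) as [[[a b] c] d] eqn:E.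
  pose proof (Hx k) as Hxk. pose proof (Hy k) as Hyk. rewrite E in Hxk. rewrite E in Hyk.
  unfold Q, ga, gb, gc, gd in *. simpl in *.
  apply Hloc'; try lra. split; simpl; lra.
Qed.

(** Boundedness follows by bisection. If the supremum S were not attained, 1 / (S - v) would be
    continuous, hence bounded by some K, and S - 1 / K would be a smaller upper bound. *)
Lemma continuous_rect_max (v : C -> R) (a b c d : R) :
  a <= b -> c <= d -> (forall z, in_rect a b c d z -> continuous v z) ->
  exists z0, in_rect a b c d z0 /\ forall z, in_rect a b c d z -> v z <= v z0.
Proof.
  intros Hab Hcd Hv.
  assert (Hbd : forall w : C -> R, (forall z, in_rect a b c d z -> continuous w z) ->
            exists M, forall z, in_rect a b c d z -> w z <= M).
  { intros w Hw.
    apply (rect_bisection (fun a b c d => exists M, forall z, in_rect a b c d z -> w z <= M));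
      [exact Hab|exact Hcd| |].
    - intros a' b' c' d' _ _ _ _ _ _ [M1 H1] [M2 H2] [M3 H3] [M4 H4].
      exists (Rmax (Rmax M1 M2) (Rmax M3 M4)). intros z [Hz1 Hz2].
      destruct (Rle_dec (Re z) ((a' + b') / 2)); destruct (Rle_dec (Im z) ((c' + d') / 2)).
      + eapply Rle_trans; [apply H1; split; lra|]. eapply Rle_trans; [|apply Rmax_l]. apply Rmax_l.
      + eapply Rle_trans; [apply H3; split; lra|]. eapply Rle_trans; [|apply Rmax_r]. apply Rmax_l.
      + eapply Rle_trans; [apply H2; split; lra|]. eapply Rle_trans; [|apply Rmax_l]. apply Rmax_r.
      + eapply Rle_trans; [apply H4; split; lra|]. eapply Rle_trans; [|apply Rmax_r]. apply Rmax_r.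
    - intros z Hz. destruct (proj1 (continuous_R_eps w z) (Hw z Hz) 1 ltac:(lra)) as [e [He Hn]].
      exists (e / 2). split; [lra|]. intros a' b' c' d' _ _ _ _ [Hz1 Hz2] Hw1 Hw2.
      exists (w z + 1). intros t [Ht1 Ht2].
      assert (Hd : Cmod (t - z) < e).
      { eapply Rle_lt_trans; [apply Cmod_Re_Im|].
        assert (Rabs (Re (t - z)) <= b' - a') by (apply Rabs_le; unfold Re in *; simpl; lra).
        assert (Rabs (Im (t - z)) <= d' - c') by (apply Rabs_le; unfold Im in *; simpl; lra).
        lra. }
      specialize (Hn t Hd). apply Rabs_def2 in Hn. lra. }
  destruct (Hbd v Hv) as [M HM].
  destruct (completeness (fun t => exists z, in_rect a b c d z /\ t = v z)) as [S [HS1 HS2]].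
  - exists M. intros t [z [Hz ->]]. apply HM, Hz.
  - exists (v (a, c)). exists (a, c). split; [split; simpl; lra|reflexivity].
  - apply NNPP. intros Hno.
    assert (Hlt : forall z, in_rect a b c d z -> v z < S).
    { intros z Hz. destruct (Rle_lt_or_eq_dec (v z) S) as [H|H]; [apply HS1; eauto|exact H|].
      exfalso. apply Hno. exists z. split; [exact Hz|]. intros w Hw. rewrite H. apply HS1. eauto. }
    destruct (Hbd (fun z => / (S - v z))) as [K HK].
    { intros z Hz. apply (continuous_comp (fun z => S - v z) Rinv).
      - apply: continuous_minus; [apply continuous_const|apply Hv, Hz].
      - apply continuous_Rinv. specialize (Hlt z Hz). lra. }
    assert (Hac : in_rect a b c d (a, c)) by (split; simpl; lra).
    assert (HK0 : 0 < K).
    { eapply Rlt_le_trans; [|apply (HK _ Hac)]. apply Rinv_0_lt_compat.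
      specialize (Hlt _ Hac). lra. }
    assert (HKi : 0 < / K) by (apply Rinv_0_lt_compat, HK0).
    assert (S <= S - / K); [|lra].
    apply HS2. intros t [z [Hz ->]]. specialize (HK z Hz). specialize (Hlt z Hz).
    assert (/ K <= S - v z); [|lra].
    rewrite <- (Rinv_inv (S - v z)). apply Rinv_le_contravar; [|exact HK].
    apply Rinv_0_lt_compat. lra.
Qed.

(** * Goursat's theorem *)

Definition CI (F : R -> C) (a b : R) : C :=
  (RInt (fun x => Re (F x)) a b, RInt (fun x => Im (F x)) a b).

Definition cont_on (F : R -> C) (a b : R) : Prop :=
  forall x, a <= x <= b -> continuous F x.

Lemma cont_on_ex_RInt (F : R -> C) (a b : R) :
  a <= b -> cont_on F a b ->
  ex_RInt (fun x => Re (F x)) a b /\ ex_RInt (fun x => Im (F x)) a b.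
Proof.
  intros Hab HF. split; apply: ex_RInt_continuous; intros x Hx;
    rewrite -> Rmin_left, Rmax_right in Hx by exact Hab;
    specialize (HF x Hx); apply continuous_ReIm in HF; apply HF.
Qed.

Lemma CI_plus (F G : R -> C) (a b : R) :
  a <= b -> cont_on F a b -> cont_on G a b ->
  CI (fun x => F x + G x)%C a b = (CI F a b + CI G a b)%C.
Proof.
  intros Hab HF HG. destruct (cont_on_ex_RInt _ _ _ Hab HF) as [H H0]. destruct (cont_on_ex_RInt _ _ _ Hab HG) as [H1 H2].
  unfold CI. apply injective_projections.
  - exact (RInt_plus (fun x => Re (F x)) (fun x => Re (G x)) a b H H1).
  - exact (RInt_plus (fun x => Im (F x)) (fun x => Im (G x)) a b H0 H2).
Qed.

Lemma CI_scal (u : C) (F : R -> C) (a b : R) :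
  a <= b -> cont_on F a b -> CI (fun x => u * F x)%C a b = (u * CI F a b)%C.
Proof.
  intros Hab HF. destruct (cont_on_ex_RInt _ _ _ Hab HF) as [H1 H2].
  unfold CI. apply injective_projections; simpl.
  - etransitivity.
    + exact (RInt_minus (fun x => scal (fst u) (Re (F x))) (fun x => scal (snd u) (Im (F x))) a b
               (ex_RInt_scal _ _ _ _ H1) (ex_RInt_scal _ _ _ _ H2)).
    + rewrite -> (RInt_scal _ _ _ _ H1), (RInt_scal _ _ _ _ H2). reflexivity.
  - etransitivity.
    + exact (RInt_plus (fun x => scal (fst u) (Im (F x))) (fun x => scal (snd u) (Re (F x))) a b
               (ex_RInt_scal _ _ _ _ H2) (ex_RInt_scal _ _ _ _ H1)).
    + rewrite -> (RInt_scal _ _ _ _ H1), (RInt_scal _ _ _ _ H2). reflexivity.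
Qed.

Lemma CI_Chasles (F : R -> C) (a b c : R) :
  a <= b -> b <= c -> cont_on F a c -> CI F a c = (CI F a b + CI F b c)%C.
Proof.
  intros Hab Hbc HF.
  assert (H1 : cont_on F a b) by (intros x Hx; apply HF; lra).
  assert (H2 : cont_on F b c) by (intros x Hx; apply HF; lra).
  destruct (cont_on_ex_RInt _ _ _ Hab H1) as [H H0]. destruct (cont_on_ex_RInt _ _ _ Hbc H2) as [H3 H4].
  unfold CI. apply injective_projections; symmetry.
  - exact (RInt_Chasles (fun x => Re (F x)) a b c H H3).
  - exact (RInt_Chasles (fun x => Im (F x)) a b c H0 H4).
Qed.

Lemma CI_ext (F G : R -> C) (a b : R) :
  a <= b -> (forall x, a <= x <= b -> F x = G x) -> CI F a b = CI G a b.
Proof.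
  intros Hab H. unfold CI. apply injective_projections; simpl; apply RInt_ext;
    intros x; rewrite -> Rmin_left, Rmax_right by exact Hab; intros Hx; rewrite H; [reflexivity|lra|reflexivity|lra].
Qed.

(** Real and imaginary parts are bounded separately, at the price of a factor 2; the applications
    depend only on how the bound scales. *)
Lemma CI_bound (F : R -> C) (a b M : R) :
  a <= b -> cont_on F a b -> (forall x, a <= x <= b -> Cmod (F x) <= M) ->
  Cmod (CI F a b) <= 2 * M * (b - a).
Proof.
  intros Hab HF HM. destruct (cont_on_ex_RInt _ _ _ Hab HF) as [H1 H2].
  eapply Rle_trans; [apply Cmod_Re_Im|]. simpl.
  assert (Rabs (RInt (fun x => Re (F x)) a b) <= (b - a) * M).
  { apply abs_RInt_le_const; [exact Hab|exact H1|].
    intros t Ht. eapply Rle_trans; [apply Re_le_Cmod|apply HM, Ht]. }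
  assert (Rabs (RInt (fun x => Im (F x)) a b) <= (b - a) * M).
  { apply abs_RInt_le_const; [exact Hab|exact H2|].
    intros t Ht. eapply Rle_trans; [apply Im_le_Cmod|apply HM, Ht]. }
  lra.
Qed.

Lemma CI_const (u : C) (a b : R) : CI (fun _ => u) a b = ((b - a) * u)%C.
Proof.
  unfold CI. rewrite !RInt_const. apply injective_projections; simpl; unfold scal; simpl; unfold mult; simpl;
  unfold Re, Im; ring.
Qed.

Lemma RInt_id (a b : R) : RInt (fun x => x) a b = (b ^ 2 - a ^ 2) / 2.
Proof.
  apply is_RInt_unique.
  replace ((b ^ 2 - a ^ 2) / 2) with (minus (b ^ 2 / 2) (a ^ 2 / 2)) by (unfold minus, plus, opp; simpl; field).
  apply (is_RInt_derive (fun x => x ^ 2 / 2) (fun x => x)).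
  - intros x _. auto_derive; [exact I|]. field.
  - intros x _. apply continuous_id.
Qed.

(** The counterclockwise contour integral along the boundary of the rectangle with horizontal side
    [a, b] and vertical side [c, d]. *)
Definition RI (F : C -> C) (a b c d : R) : C :=
  (CI (fun x => F (x, c)) a b - CI (fun x => F (x, d)) a b
   + Ci * CI (fun y => F (b, y)) c d - Ci * CI (fun y => F (a, y)) c d)%C.

Definition bd (a b c d : R) (z : C) : Prop :=
  in_rect a b c d z /\ (Re z = a \/ Re z = b \/ Im z = c \/ Im z = d).

Definition cont_bd (F : C -> C) (a b c d : R) : Prop :=
  forall z, bd a b c d z -> continuous F z.

Lemma continuous_horizontal (F : C -> C) (x c : R) :
  continuous F (x, c) -> continuous (fun t => F (t, c)) x.
Proof.
  intros H. apply (continuous_comp (fun t => (t, c) : C) F); [|exact H].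
  apply continuous_pairC; [apply continuous_id|apply continuous_const].
Qed.

Lemma continuous_vertical (F : C -> C) (a y : R) :
  continuous F (a, y) -> continuous (fun t => F (a, t)) y.
Proof.
  intros H. apply (continuous_comp (fun t => (a, t) : C) F); [|exact H].
  apply continuous_pairC; [apply continuous_const|apply continuous_id].
Qed.

Ltac rect_arith := unfold bd, in_rect, Re, Im in *; simpl in *; intuition (try lra).

Lemma cont_bd_sides (F : C -> C) (a b c d : R) :
  a <= b -> c <= d -> cont_bd F a b c d ->
  cont_on (fun x => F (x, c)) a b /\ cont_on (fun x => F (x, d)) a b /\
  cont_on (fun y => F (b, y)) c d /\ cont_on (fun y => F (a, y)) c d.
Proof.
  intros Hab Hcd HF.
  split; [|split; [|split]]; intros t Ht.
  - apply (continuous_horizontal F), HF. rect_arith.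
  - apply (continuous_horizontal F), HF. rect_arith.
  - apply (continuous_vertical F), HF. rect_arith.
  - apply (continuous_vertical F), HF. rect_arith.
Qed.

Lemma RI_plus (F G : C -> C) (a b c d : R) :
  a <= b -> c <= d -> cont_bd F a b c d -> cont_bd G a b c d ->
  RI (fun z => F z + G z)%C a b c d = (RI F a b c d + RI G a b c d)%C.
Proof.
  intros Hab Hcd HF HG.
  apply cont_bd_sides in HF; try assumption. apply cont_bd_sides in HG; try assumption.
  destruct HF as (F1 & F2 & F3 & F4). destruct HG as (G1 & G2 & G3 & G4).
  unfold RI. rewrite (CI_plus _ _ _ _ Hab F1 G1) (CI_plus _ _ _ _ Hab F2 G2)
    (CI_plus _ _ _ _ Hcd F3 G3) (CI_plus _ _ _ _ Hcd F4 G4). ring.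
Qed.

Lemma RI_scal (u : C) (F : C -> C) (a b c d : R) :
  a <= b -> c <= d -> cont_bd F a b c d ->
  RI (fun z => u * F z)%C a b c d = (u * RI F a b c d)%C.
Proof.
  intros Hab Hcd HF.
  apply cont_bd_sides in HF; try assumption.
  destruct HF as (F1 & F2 & F3 & F4).
  unfold RI. rewrite (CI_scal u _ _ _ Hab F1) (CI_scal u _ _ _ Hab F2)
    (CI_scal u _ _ _ Hcd F3) (CI_scal u _ _ _ Hcd F4). ring.
Qed.

Lemma RI_ext (F G : C -> C) (a b c d : R) :
  a <= b -> c <= d -> (forall z, bd a b c d z -> F z = G z) -> RI F a b c d = RI G a b c d.
Proof.
  intros Hab Hcd H. unfold RI.
  rewrite (CI_ext (fun x => F (x, c)) (fun x => G (x, c)) a b Hab).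
  2:{ intros x Hx. apply H. rect_arith. }
  rewrite (CI_ext (fun x => F (x, d)) (fun x => G (x, d)) a b Hab).
  2:{ intros x Hx. apply H. rect_arith. }
  rewrite (CI_ext (fun y => F (b, y)) (fun y => G (b, y)) c d Hcd).
  2:{ intros x Hx. apply H. rect_arith. }
  rewrite (CI_ext (fun y => F (a, y)) (fun y => G (a, y)) c d Hcd).
  2:{ intros x Hx. apply H. rect_arith. }
  reflexivity.
Qed.

Lemma RI_bound (F : C -> C) (a b c d M : R) :
  a <= b -> c <= d -> cont_bd F a b c d -> (forall z, bd a b c d z -> Cmod (F z) <= M) ->
  Cmod (RI F a b c d) <= 4 * M * ((b - a) + (d - c)).
Proof.
  intros Hab Hcd HF HM. unfold RI.
  apply cont_bd_sides in HF; try assumption. destruct HF as (F1 & F2 & F3 & F4).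
  assert (K1 : Cmod (CI (fun x => F (x, c)) a b) <= 2 * M * (b - a)).
  { apply CI_bound; try assumption. intros x Hx. apply HM. rect_arith. }
  assert (K2 : Cmod (CI (fun x => F (x, d)) a b) <= 2 * M * (b - a)).
  { apply CI_bound; try assumption. intros x Hx. apply HM. rect_arith. }
  assert (K3 : Cmod (CI (fun y => F (b, y)) c d) <= 2 * M * (d - c)).
  { apply CI_bound; try assumption. intros x Hx. apply HM. rect_arith. }
  assert (K4 : Cmod (CI (fun y => F (a, y)) c d) <= 2 * M * (d - c)).
  { apply CI_bound; try assumption. intros x Hx. apply HM. rect_arith. }
  eapply Rle_trans; [apply Cmod_triangle|].
  rewrite -> Cmod_opp, Cmod_mult, Cmod_Ci.
  eapply Rle_trans; [apply Rplus_le_compat_r, Cmod_triangle|].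
  rewrite -> Cmod_mult, Cmod_Ci.
  eapply Rle_trans; [apply Rplus_le_compat_r, Rplus_le_compat_r, Cmod_triangle|].
  rewrite -> Cmod_opp. lra.
Qed.

Lemma RI_split_x (F : C -> C) (a e b c d : R) :
  a <= e -> e <= b -> c <= d -> cont_bd F a b c d ->
  RI F a b c d = (RI F a e c d + RI F e b c d)%C.
Proof.
  intros Hae Heb Hcd HF.
  apply cont_bd_sides in HF; try lra. destruct HF as (F1 & F2 & _ & _).
  unfold RI. rewrite (CI_Chasles _ a e b Hae Heb F1) (CI_Chasles _ a e b Hae Heb F2). ring.
Qed.

Lemma RI_split_y (F : C -> C) (a b c e d : R) :
  a <= b -> c <= e -> e <= d -> cont_bd F a b c d ->
  RI F a b c d = (RI F a b c e + RI F a b e d)%C.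
Proof.
  intros Hab Hce Hed HF.
  apply cont_bd_sides in HF; try lra. destruct HF as (_ & _ & F3 & F4).
  unfold RI. rewrite (CI_Chasles _ c e d Hce Hed F3) (CI_Chasles _ c e d Hce Hed F4). ring.
Qed.

Lemma RI_affine (u v : C) (a b c d : R) :
  a <= b -> c <= d -> RI (fun z => u + v * z)%C a b c d = 0%C.
Proof.
  intros Hab Hcd.
  assert (Hi : forall z : C, continuous (fun z : C => z) z) by (intros z; apply continuous_id).
  rewrite RI_plus; try assumption.
  2:{ intros z _. apply continuous_const. }
  2:{ intros z _. apply continuous_Cmult; [apply continuous_const|apply continuous_id]. }
  rewrite RI_scal; try assumption. 2:{ intros z _. apply Hi. }
  replace (RI (fun _ => u) a b c d) with (RtoC 0).
  2:{ unfold RI. rewrite !CI_const. ring. }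
  replace (RI (fun z => z) a b c d) with (RtoC 0); [ring|].
  unfold RI, CI. cbn [Re Im fst snd]. rewrite !RInt_const !RInt_id.
  unfold Ci, scal; simpl; unfold mult; simpl.
  apply injective_projections; simpl; field.
Qed.

Lemma in_rect_dist (a b c d : R) (z w : C) :
  in_rect a b c d z -> in_rect a b c d w -> Cmod (w - z) <= (b - a) + (d - c).
Proof.
  intros Hz Hw. eapply Rle_trans; [apply Cmod_Re_Im|].
  apply Rplus_le_compat; apply Rabs_le; rect_arith.
Qed.

(** The bound e w^2, with w the half perimeter, is compatible with bisection because 4 (w / 2)^2 =
    w^2. Near each point it follows from the first-order expansion, whose affine part integrates to
    0. So bisection proves it for every e > 0. *)
Lemma Goursat (F : C -> C) (a b c d : R) :
  a <= b -> c <= d -> (forall z, in_rect a b c d z -> exists l, cdiff F z l) ->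
  RI F a b c d = 0%C.
Proof.
  intros Hab Hcd HF.
  assert (HC : forall z, in_rect a b c d z -> continuous F z).
  { intros z Hz. destruct (HF z Hz) as [l Hl]. eapply cdiff_continuous, Hl. }
  assert (Hmain : forall e, 0 < e -> Cmod (RI F a b c d) <= e * ((b - a) + (d - c)) ^ 2).
  { intros e He.
    apply (rect_bisection (fun a b c d => Cmod (RI F a b c d) <= e * ((b - a) + (d - c)) ^ 2));
      [exact Hab|exact Hcd| |].
    - intros a' b' c' d' H1 H2 H3 H4 H5 H6 K1 K2 K3 K4.
      assert (HC' : forall a1 b1 c1 d1, a' <= a1 -> b1 <= b' -> c' <= c1 -> d1 <= d' -> cont_bd F a1 b1 c1 d1).
      { intros a1 b1 c1 d1 L1 L2 L3 L4 z Hz. apply HC. rect_arith. }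
      rewrite (RI_split_y F a' b' c' ((c' + d') / 2) d'); try lra; [|apply HC'; lra].
      rewrite (RI_split_x F a' ((a' + b') / 2) b' c'); try lra; [|apply HC'; lra].
      rewrite (RI_split_x F a' ((a' + b') / 2) b' _ d'); try lra; [|apply HC'; lra].
      eapply Rle_trans; [apply Cmod_triangle|].
      eapply Rle_trans; [apply Rplus_le_compat; apply Cmod_triangle|].
      set (w := b' - a' + (d' - c')).
      replace ((a' + b') / 2 - a' + ((c' + d') / 2 - c')) with (w / 2) in K1 by (unfold w; field).
      replace (b' - (a' + b') / 2 + ((c' + d') / 2 - c')) with (w / 2) in K2 by (unfold w; field).
      replace ((a' + b') / 2 - a' + (d' - (c' + d') / 2)) with (w / 2) in K3 by (unfold w; field).
      replace (b' - (a' + b') / 2 + (d' - (c' + d') / 2)) with (w / 2) in K4 by (unfold w; field).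
      lra.
    - intros z Hz. destruct (HF z Hz) as [l Hl].
      (* The factor 4 of [RI_bound] turns e / 4 into e. *)
      destruct (proj1 (cdiff_eps F z l) Hl (e / 4) ltac:(lra)) as [r [Hr Hn]].
      exists (r / 2). split; [lra|].
      intros a' b' c' d' H1 H2 H3 H4 Hz' H5 H6.
      assert (HC' : cont_bd F a' b' c' d') by (intros w Hw; apply HC; rect_arith).
      assert (Ha' : a' <= b') by rect_arith. assert (Hc' : c' <= d') by rect_arith.
      rewrite (RI_ext F (fun w => ((F z - l * z) + l * w) + (F w - F z - l * (w - z)))%C); try assumption.
      2:{ intros w _. ring. }
      assert (HA : cont_bd (fun w => (F z - l * z) + l * w)%C a' b' c' d').
      { intros w _. apply continuous_Cplus; [apply continuous_const|].
        apply continuous_Cmult; [apply continuous_const|apply continuous_id]. }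
      assert (HR : cont_bd (fun w => F w - F z - l * (w - z))%C a' b' c' d').
      { intros w Hw. apply continuous_Cminus.
        - apply continuous_Cminus; [apply HC', Hw|apply continuous_const].
        - apply continuous_Cmult; [apply continuous_const|].
          apply continuous_Cminus; [apply continuous_id|apply continuous_const]. }
      rewrite RI_plus; try assumption. rewrite RI_affine; try assumption. rewrite Cplus_0_l.
      eapply Rle_trans; [apply (RI_bound _ _ _ _ _ (e / 4 * ((b' - a') + (d' - c')))); try assumption|].
      + intros w Hw.
        assert (Hd : Cmod (w - z) <= (b' - a') + (d' - c')) by (apply in_rect_dist; [exact Hz'|apply Hw]).
        eapply Rle_trans; [apply Hn; lra|]. apply Rmult_le_compat_l; lra.
      + apply Req_le. field. }
  apply Cmod_eq_0. apply Rle_antisym; [|apply Cmod_ge_0].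
  apply le_epsilon. intros e He. rewrite Rplus_0_l.
  set (w := (b - a) + (d - c)) in *. assert (0 <= w) by (unfold w; lra).
  eapply Rle_trans; [apply (Hmain (e / (w + 1) ^ 2))|].
  - apply Rdiv_lt_0_compat; [exact He|]. apply pow_lt. lra.
  - apply (Rmult_le_reg_r ((w + 1) ^ 2)); [apply pow_lt; lra|].
    replace (e / (w + 1) ^ 2 * w ^ 2 * (w + 1) ^ 2) with (e * w ^ 2) by (field; lra). nra.
Qed.

(** Cut the rectangle around a square of half-side s centred at p: Goursat kills the four outer
    pieces, and the square contributes at most 16 M s for every small s. *)
Lemma Goursat_punctured (F : C -> C) (a b c d M : R) (p : C) :
  a < Re p < b -> c < Im p < d ->
  (forall z, in_rect a b c d z -> z <> p -> exists l, cdiff F z l) ->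
  near p (fun z => z <> p -> Cmod (F z) <= M) ->
  RI F a b c d = 0%C.
Proof.
  destruct p as [px py]. cbn [Re Im fst snd]. intros Hx Hy HF [r [Hr HM]].
  assert (HC : forall z, in_rect a b c d z -> z <> (px, py) -> continuous F z).
  { intros z Hz Hp. destruct (HF z Hz Hp) as [l Hl]. eapply cdiff_continuous, Hl. }
  assert (Hne : forall z : C, Re z <> px \/ Im z <> py -> z <> (px, py)).
  { intros z H E. rewrite E in H. simpl in H. tauto. }
  set (m := Rmin (Rmin (px - a) (b - px)) (Rmin (py - c) (d - py))).
  assert (Hm0 : 0 < m) by (unfold m; repeat apply Rmin_glb_lt; lra).
  assert (Hma : m <= px - a) by (unfold m; eapply Rle_trans; [apply Rmin_l|apply Rmin_l]).
  assert (Hmb : m <= b - px) by (unfold m; eapply Rle_trans; [apply Rmin_l|apply Rmin_r]).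
  assert (Hmc : m <= py - c) by (unfold m; eapply Rle_trans; [apply Rmin_r|apply Rmin_l]).
  assert (Hmd : m <= d - py) by (unfold m; eapply Rle_trans; [apply Rmin_r|apply Rmin_r]).
  assert (Hsmall : forall s, 0 < s -> s < m -> 2 * s < r -> Cmod (RI F a b c d) <= 16 * M * s).
  { intros s Hs Hsm Hsr.
    rewrite (RI_split_x F a (px - s) b); try lra.
    2:{ intros z Hz. apply HC; [apply Hz|]. apply Hne. rect_arith. }
    rewrite (RI_split_x F (px - s) (px + s) b); try lra.
    2:{ intros z Hz. apply HC; [rect_arith|]. apply Hne. rect_arith. }
    rewrite (RI_split_y F (px - s) (px + s) c (py - s) d); try lra.
    2:{ intros z Hz. apply HC; [rect_arith|]. apply Hne. rect_arith. }
    rewrite (RI_split_y F (px - s) (px + s) (py - s) (py + s) d); try lra.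
    2:{ intros z Hz. apply HC; [rect_arith|]. apply Hne. rect_arith. }
    assert (HG : forall a1 b1 c1 d1, a <= a1 -> a1 <= b1 -> b1 <= b -> c <= c1 -> c1 <= d1 -> d1 <= d ->
              b1 < px \/ px < a1 \/ d1 < py \/ py < c1 -> RI F a1 b1 c1 d1 = 0%C).
    { intros a1 b1 c1 d1 L1 L2 L3 L4 L5 L6 L7. apply Goursat; try assumption.
      intros z Hz. apply HF; [rect_arith|]. apply Hne.
      unfold in_rect in Hz. destruct L7 as [L|[L|[L|L]]]; [left|left|right|right]; lra. }
    rewrite (HG a (px - s) c d) ?(HG (px + s) b c d) ?(HG (px - s) (px + s) c (py - s))
      ?(HG (px - s) (px + s) (py + s) d); try lra.
    rewrite !Cplus_0_l !Cplus_0_r.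
    eapply Rle_trans; [apply (RI_bound _ _ _ _ _ M); try lra|].
    - intros z Hz. apply HC; [rect_arith|]. apply Hne. rect_arith.
    - intros z Hz. apply HM.
      + eapply Rle_lt_trans; [apply Cmod_Re_Im|].
        assert (Rabs (Re (z - (px, py))) <= s) by (apply Rabs_le; rect_arith).
        assert (Rabs (Im (z - (px, py))) <= s) by (apply Rabs_le; rect_arith). lra.
      + apply Hne. rect_arith.
    - apply Req_le. ring. }
  apply Cmod_eq_0. apply Rle_antisym; [|apply Cmod_ge_0].
  apply le_epsilon. intros e He. rewrite Rplus_0_l.
  pose (s := Rmin (Rmin (m / 2) (r / 4)) (e / (16 * (Rabs M + 1)))).
  pose proof (Rabs_pos M) as HMp.
  assert (Hs0 : 0 < s).
  { unfold s. repeat apply Rmin_glb_lt; try lra. apply Rdiv_lt_0_compat; lra. }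
  assert (s <= m / 2) by (unfold s; eapply Rle_trans; [apply Rmin_l|apply Rmin_l]).
  assert (s <= r / 4) by (unfold s; eapply Rle_trans; [apply Rmin_l|apply Rmin_r]).
  assert (Hs3 : s <= e / (16 * (Rabs M + 1))) by (unfold s; apply Rmin_r).
  eapply Rle_trans; [apply (Hsmall s); lra|].
  apply (Rmult_le_compat_l (16 * (Rabs M + 1))) in Hs3; [|lra].
  replace (16 * (Rabs M + 1) * (e / (16 * (Rabs M + 1)))) with e in Hs3 by (field; lra).
  pose proof (Rle_abs M). nra.
Qed.

(** * Cauchy integrals over squares *)

Definition SI (F : C -> C) (z0 : C) (r : R) : C :=
  RI F (Re z0 - r) (Re z0 + r) (Im z0 - r) (Im z0 + r).

Definition sq (z0 : C) (r : R) (z : C) : Prop :=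
  in_rect (Re z0 - r) (Re z0 + r) (Im z0 - r) (Im z0 + r) z.

Definition bdsq (z0 : C) (r : R) (z : C) : Prop :=
  bd (Re z0 - r) (Re z0 + r) (Im z0 - r) (Im z0 + r) z.

Lemma bdsq_sq (z0 : C) (r : R) (z : C) : bdsq z0 r z -> sq z0 r z.
Proof. intros H. apply H. Qed.

Lemma bdsq_dist (z0 : C) (r : R) (z : C) : 0 < r -> bdsq z0 r z -> r <= Cmod (z - z0).
Proof.
  intros Hr [_ H].
  pose proof (Re_le_Cmod (z - z0)) as H1. pose proof (Im_le_Cmod (z - z0)) as H2.
  unfold Rabs in *. destruct (Rcase_abs (Re (z - z0))); destruct (Rcase_abs (Im (z - z0)));
  unfold Re, Im in *; simpl in *; lra.
Qed.

Lemma sq_dist (z0 : C) (r : R) (z : C) : sq z0 r z -> Cmod (z - z0) <= 2 * r.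
Proof.
  intros [H1 H2]. eapply Rle_trans; [apply Cmod_Re_Im|].
  assert (Rabs (Re (z - z0)) <= r) by (apply Rabs_le; unfold Re in *; simpl; lra).
  assert (Rabs (Im (z - z0)) <= r) by (apply Rabs_le; unfold Im in *; simpl; lra).
  lra.
Qed.

Lemma bdsq_dist_w (z0 : C) (r : R) (w z : C) :
  0 < r -> bdsq z0 r z -> r - Cmod (w - z0) <= Cmod (z - w).
Proof.
  intros Hr Hz. pose proof (bdsq_dist _ _ _ Hr Hz) as H.
  pose proof (Cmod_triangle (z - w) (w - z0)) as H0.
  replace (z - w + (w - z0))%C with (z - z0)%C in H0 by ring. lra.
Qed.

Lemma SI_plus (F G : C -> C) (z0 : C) (r : R) : 0 < r ->
  (forall z, bdsq z0 r z -> continuous F z) -> (forall z, bdsq z0 r z -> continuous G z) ->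
  SI (fun z => F z + G z)%C z0 r = (SI F z0 r + SI G z0 r)%C.
Proof. intros Hr HF HG. unfold SI. apply (RI_plus F G); [lra|lra|exact HF|exact HG]. Qed.

Lemma SI_scal (u : C) (F : C -> C) (z0 : C) (r : R) : 0 < r ->
  (forall z, bdsq z0 r z -> continuous F z) ->
  SI (fun z => u * F z)%C z0 r = (u * SI F z0 r)%C.
Proof. intros Hr HF. unfold SI. apply (RI_scal u F); [lra|lra|exact HF]. Qed.

Lemma SI_ext (F G : C -> C) (z0 : C) (r : R) : 0 < r ->
  (forall z, bdsq z0 r z -> F z = G z) -> SI F z0 r = SI G z0 r.
Proof. intros Hr H. unfold SI. apply (RI_ext F G); [lra|lra|exact H]. Qed.

Lemma SI_bound (F : C -> C) (z0 : C) (r M : R) : 0 < r ->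
  (forall z, bdsq z0 r z -> continuous F z) ->
  (forall z, bdsq z0 r z -> Cmod (F z) <= M) -> Cmod (SI F z0 r) <= 16 * M * r.
Proof.
  intros Hr HF HM. unfold SI. eapply Rle_trans; [apply (RI_bound F _ _ _ _ M); [lra|lra|exact HF|exact HM]|].
  apply Req_le. ring.
Qed.

(** Differentiation under the integral sign: the second-order remainder is uniform on the contour,
    so it can be integrated directly. *)
Lemma SI_cdiff_param (K K1 : C -> C -> C) (z0 w : C) (r d B : R) :
  0 < r -> 0 < d -> 0 <= B ->
  (forall h z, Cmod h < d -> bdsq z0 r z -> continuous (K (w + h)%C) z) ->
  (forall z, bdsq z0 r z -> continuous (K1 w) z) ->
  (forall h z, Cmod h < d -> bdsq z0 r z ->
     Cmod (K (w + h)%C z - K w z - h * K1 w z) <= B * Cmod h ^ 2) ->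
  cdiff (fun w => SI (K w) z0 r) w (SI (K1 w) z0 r).
Proof.
  intros Hr Hd HB HK HK1 Hest. apply cdiff_eps. intros e He.
  exists (Rmin d (e / (16 * B * r + 1))). split.
  (* Below this radius 16 B r |h| is at most e; the + 1 keeps the denominator positive when B =
     0. *)
  { apply Rmin_glb_lt; [exact Hd|]. apply Rdiv_lt_0_compat; [exact He|]. nra. }
  intros w' Hw'. set (h := (w' - w)%C) in *.
  assert (Hh1 : Cmod h < d) by (eapply Rlt_le_trans; [exact Hw'|apply Rmin_l]).
  assert (Hh2 : Cmod h < e / (16 * B * r + 1)) by (eapply Rlt_le_trans; [exact Hw'|apply Rmin_r]).
  replace w' with (w + h)%C by (unfold h; ring).
  assert (HK0 : forall z, bdsq z0 r z -> continuous (K w) z).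
  { intros z Hz. replace w with (w + 0)%C by ring. apply HK; [|exact Hz]. rewrite Cmod_0. exact Hd. }
  replace (SI (K (w + h)%C) z0 r - SI (K w) z0 r - SI (K1 w) z0 r * h)%C
    with (SI (fun z => K (w + h)%C z + ((- (1)) * K w z + (- h) * K1 w z))%C z0 r).
  - eapply Rle_trans; [apply (SI_bound _ _ _ (B * Cmod h ^ 2)); [exact Hr| |]|].
    + intros z Hz. apply continuous_Cplus; [apply HK; assumption|].
      apply continuous_Cplus; apply continuous_Cmult; auto using continuous_const.
    + intros z Hz.
      replace (K (w + h) z + (- (1) * K w z + - h * K1 w z))%C
        with (K (w + h) z - K w z - h * K1 w z)%C by ring.
      apply Hest; assumption.
    + pose proof (Cmod_ge_0 h).
      apply (Rmult_lt_compat_r (16 * B * r + 1)) in Hh2; [|nra].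
      replace (e / (16 * B * r + 1) * (16 * B * r + 1)) with e in Hh2 by (field; nra).
      nra.
  - rewrite SI_plus; try assumption.
    + rewrite SI_plus; try assumption.
      * rewrite -> SI_scal, SI_scal by assumption. ring.
      * intros z Hz. apply continuous_Cmult; auto using continuous_const.
      * intros z Hz. apply continuous_Cmult; auto using continuous_const.
    + intros z Hz. apply HK; assumption.
    + intros z Hz. apply continuous_Cplus; apply continuous_Cmult; auto using continuous_const.
Qed.

(** The usual factor 1 / (2 pi i) is absent; dividing by the same integral with phi = 1 takes its
    place. *)
Definition cauchy_int (phi : C -> C) (k : nat) (z0 : C) (r : R) (w : C) : C :=
  SI (fun z => phi z / (z - w) ^ k)%C z0 r.

Lemma bdsq_neq (z0 : C) (r : R) (w z : C) :
  0 < r -> Cmod (w - z0) < r -> bdsq z0 r z -> (z - w)%C <> 0%C.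
Proof.
  intros Hr Hw Hz E. pose proof (bdsq_dist_w _ _ w _ Hr Hz) as H. rewrite -> E, Cmod_0 in H. lra.
Qed.

Lemma continuous_kernel (phi : C -> C) (k : nat) (w z : C) :
  continuous phi z -> (z - w)%C <> 0%C -> continuous (fun z => phi z / (z - w) ^ k)%C z.
Proof.
  intros H Hz. apply continuous_Cmult; [exact H|]. apply continuous_Cinv.
  - apply continuous_Cpow, continuous_Cminus; [apply continuous_id|apply continuous_const].
  - apply Cpow_nz, Hz.
Qed.

Lemma cdiff_cauchy_int (phi : C -> C) (k : nat) (z0 w : C) (r M : R) :
  (k = 1 \/ k = 2)%nat -> 0 < r -> Cmod (w - z0) < r ->
  (forall z, bdsq z0 r z -> continuous phi z) -> (forall z, bdsq z0 r z -> Cmod (phi z) <= M) ->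
  cdiff (cauchy_int phi k z0 r) w (SI (fun z => INR k * (phi z / (z - w) ^ S k))%C z0 r).
Proof.
  intros Hk Hr Hw Hc HM. set (p := r - Cmod (w - z0)). assert (Hp : 0 < p) by (unfold p; lra).
  assert (HM0 : 0 <= M).
  { assert (Hz : bdsq z0 r (Re z0 - r, Im z0)) by (unfold bdsq; destruct z0; rect_arith).
    eapply Rle_trans; [apply Cmod_ge_0|apply (HM _ Hz)]. }
  assert (Hnear : forall h z, Cmod h < p / 2 -> bdsq z0 r z ->
            p <= Cmod (z - w) /\ p / 2 <= Cmod (z - w - h) /\ 3 * Cmod (z - w) + 2 * Cmod h <= 4 * Cmod (z - w)).
  { intros h z Hh Hz. pose proof (bdsq_dist_w _ _ w _ Hr Hz) as H. fold p in H.
    pose proof (Cmod_minus_le (z - w) h). lra. }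
  assert (Hneq : forall z : C, 0 < Cmod z -> z <> 0%C) by (intros z Hz; apply Cmod_gt_0, Hz).
  (* With b = z - w, the remainder is phi h^2 / (b^2 (b - h)) for k = 1 and phi h^2 (3 b - 2 h) /
     (b^3 (b - h)^2) for k = 2. From |b| >= p and |b - h| >= p / 2 these are at most 2 / p^3 and 16
     / p^4 times M |h|^2; the sum serves both cases. *)
  apply (SI_cdiff_param (fun w z => phi z / (z - w) ^ k)%C
           (fun w z => INR k * (phi z / (z - w) ^ S k))%C z0 w r (p / 2) (M * (2 / p ^ 3 + 16 / p ^ 4))); try lra.
  - apply Rmult_le_pos; [exact HM0|].
    assert (0 < 2 / p ^ 3) by (apply Rdiv_lt_0_compat; [lra|apply pow_lt; lra]).
    assert (0 < 16 / p ^ 4) by (apply Rdiv_lt_0_compat; [lra|apply pow_lt; lra]). lra.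
  - intros h z Hh Hz. apply continuous_kernel; [apply Hc, Hz|].
    destruct (Hnear h z Hh Hz) as (_ & H & _). apply Hneq.
    replace (z - (w + h))%C with (z - w - h)%C by ring. lra.
  - intros z Hz. apply continuous_Cmult; [apply continuous_const|].
    apply continuous_kernel; [apply Hc, Hz|]. exact (bdsq_neq z0 r w z Hr Hw Hz).
  - intros h z Hh Hz. destruct (Hnear h z Hh Hz) as (H1 & H2 & H3).
    set (b := (z - w)%C) in *.
    assert (Hb : b <> 0%C) by (apply Hneq; lra).
    assert (Hbh : (b - h)%C <> 0%C) by (apply Hneq; lra).
    replace (z - (w + h))%C with (b - h)%C by (unfold b; ring).
    specialize (HM z Hz). pose proof (Cmod_ge_0 h) as Hh0. pose proof (Cmod_ge_0 (phi z)).
    assert (Hi1 : / Cmod b <= / p) by (apply Rinv_le_contravar; lra).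
    assert (Hi2 : / Cmod (b - h) <= 2 / p).
    { replace (2 / p) with (/ (p / 2)) by (field; lra). apply Rinv_le_contravar; lra. }
    assert (Hi1' : 0 < / Cmod b) by (apply Rinv_0_lt_compat; lra).
    assert (Hi2' : 0 < / Cmod (b - h)) by (apply Rinv_0_lt_compat; lra).
    assert (Hip : 0 < / p) by (apply Rinv_0_lt_compat; lra).
    assert (Hfin : forall X, 0 <= X -> X <= 2 / p ^ 3 + 16 / p ^ 4 ->
              Cmod (phi z) * (Cmod h ^ 2 * X) <= M * (2 / p ^ 3 + 16 / p ^ 4) * Cmod h ^ 2).
    { intros X HX1 HX2. replace (M * (2 / p ^ 3 + 16 / p ^ 4) * Cmod h ^ 2) with (M * (Cmod h ^ 2 * (2 / p ^ 3 + 16 / p ^ 4))) by ring.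
      apply Rmult_le_compat; try assumption; [nra|]. apply Rmult_le_compat_l; [nra|exact HX2]. }
    destruct Hk as [-> | ->].
    + replace (phi z / (b - h) ^ 1 - phi z / b ^ 1 - h * (INR 1 * (phi z / b ^ 2)))%C
        with (phi z * (h * h * (/ b * / b * / (b - h))))%C by (simpl; field; split; assumption).
      rewrite -> !Cmod_mult, !Cmod_inv by assumption.
      replace (Cmod h * Cmod h) with (Cmod h ^ 2) by ring.
      apply Hfin; [repeat apply Rmult_le_pos; lra|].
      assert (0 < 16 / p ^ 4) by (apply Rdiv_lt_0_compat; [lra|apply pow_lt; lra]).
      apply Rle_trans with (/ p * / p * (2 / p)).
      * apply Rmult_le_compat; try lra; [nra|]. apply Rmult_le_compat; lra.
      * replace (2 / p ^ 3) with (/ p * / p * (2 / p)) by (field; lra). lra.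
    + replace (phi z / (b - h) ^ 2 - phi z / b ^ 2 - h * (INR 2 * (phi z / b ^ 3)))%C
        with (phi z * (h * h * ((3 * b - 2 * h) * (/ b * (/ b * (/ b * (/ (b - h) * / (b - h))))))))%C
        by (simpl; rewrite RtoC_plus; field; split; assumption).
      rewrite -> (Cmod_mult (phi z)), (Cmod_mult (h * h)), (Cmod_mult h h).
      replace (Cmod h * Cmod h) with (Cmod h ^ 2) by ring.
      apply Hfin; [apply Cmod_ge_0|].
      rewrite -> !Cmod_mult, !Cmod_inv by assumption.
      assert (Hn : Cmod (3 * b - 2 * h) <= 4 * Cmod b).
      { eapply Rle_trans; [apply Cmod_triangle|]. rewrite -> Cmod_opp, !Cmod_mult, !Cmod_R.
        rewrite -> !Rabs_right by lra. lra. }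
      assert (0 < 2 / p ^ 3) by (apply Rdiv_lt_0_compat; [lra|apply pow_lt; lra]).
      apply Rle_trans with (4 * Cmod b * (/ Cmod b * (/ Cmod b * (/ Cmod b * (/ Cmod (b - h) * / Cmod (b - h)))))).
      * apply Rmult_le_compat_r; [|exact Hn]. repeat apply Rmult_le_pos; lra.
      * replace (4 * Cmod b * (/ Cmod b * (/ Cmod b * (/ Cmod b * (/ Cmod (b - h) * / Cmod (b - h))))))
          with (4 * (/ Cmod b * / Cmod b) * (/ Cmod (b - h) * / Cmod (b - h))).
        2:{ set (y := / Cmod (b - h)). field. lra. }
        apply Rle_trans with (4 * (/ p * / p) * ((2 / p) * (2 / p))).
        -- apply Rmult_le_compat; try nra.
        -- replace (16 / p ^ 4) with (4 * (/ p * / p) * ((2 / p) * (2 / p))) by (field; lra). lra.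
Qed.

(* The integral of 1 / (z - z0) is 2 pi i, but only its nonvanishing is needed:
   each side of the square contributes a positive imaginary part. *)
Lemma SI_inv_neq0 (F : C -> C) (z0 : C) (r : R) :
  0 < r ->
  (forall z, bdsq z0 r z -> continuous (fun z => Im (F z)) z /\ continuous (fun z => Re (F z)) z) ->
  (forall z, bdsq z0 r z -> 0 < Cmod (z - z0) ^ 2) ->
  (forall z, bdsq z0 r z -> Re (F z) = (Re z - Re z0) / Cmod (z - z0) ^ 2) ->
  (forall z, bdsq z0 r z -> Im (F z) = (Im z0 - Im z) / Cmod (z - z0) ^ 2) ->
  SI F z0 r <> 0%C.
Proof.
  intros Hr HC Hpos HRe HIm.
  assert (Hside : forall (G : R -> R) (a : R),
            (forall x, a - r <= x <= a + r -> continuous G x) ->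
            (forall x, a - r <= x <= a + r -> 0 < G x) -> 0 < RInt G (a - r) (a + r)).
  { intros G a HG HG0. apply RInt_gt_0; [lra| |]; intros x Hx; [apply HG0|apply HG]; lra. }
  destruct z0 as [x0 y0] eqn:Ez0. rewrite <- Ez0 in *.
  assert (B1 : forall x, x0 - r <= x <= x0 + r -> bdsq z0 r (x, y0 - r)) by (subst z0; unfold bdsq; intros; rect_arith).
  assert (B2 : forall x, x0 - r <= x <= x0 + r -> bdsq z0 r (x, y0 + r)) by (subst z0; unfold bdsq; intros; rect_arith).
  assert (B3 : forall y, y0 - r <= y <= y0 + r -> bdsq z0 r (x0 + r, y)) by (subst z0; unfold bdsq; intros; rect_arith).
  assert (B4 : forall y, y0 - r <= y <= y0 + r -> bdsq z0 r (x0 - r, y)) by (subst z0; unfold bdsq; intros; rect_arith).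
  assert (I1 : 0 < RInt (fun x => Im (F (x, y0 - r))) (x0 - r) (x0 + r)).
  { apply Hside; intros x Hx; specialize (B1 x Hx).
    - apply (continuous_comp (fun t => (t, y0 - r) : C) (fun z => Im (F z))); [|apply HC, B1].
      apply continuous_pairC; [apply continuous_id|apply continuous_const].
    - rewrite -> HIm by exact B1. apply Rdiv_lt_0_compat; [|apply Hpos, B1]. subst z0; simpl; lra. }
  assert (I2 : 0 < RInt (fun x => - Im (F (x, y0 + r))) (x0 - r) (x0 + r)).
  { apply Hside; intros x Hx; specialize (B2 x Hx).
    - apply: continuous_opp. apply (continuous_comp (fun t => (t, y0 + r) : C) (fun z => Im (F z))); [|apply HC, B2].
      apply continuous_pairC; [apply continuous_id|apply continuous_const].
    - rewrite -> HIm by exact B2. rewrite <- Rdiv_opp_l. apply Rdiv_lt_0_compat; [|apply Hpos, B2]. subst z0; simpl; lra. }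
  assert (I3 : 0 < RInt (fun y => Re (F (x0 + r, y))) (y0 - r) (y0 + r)).
  { apply Hside; intros x Hx; specialize (B3 x Hx).
    - apply (continuous_comp (fun t => (x0 + r, t) : C) (fun z => Re (F z))); [|apply HC, B3].
      apply continuous_pairC; [apply continuous_const|apply continuous_id].
    - rewrite -> HRe by exact B3. apply Rdiv_lt_0_compat; [|apply Hpos, B3]. subst z0; simpl; lra. }
  assert (I4 : 0 < RInt (fun y => - Re (F (x0 - r, y))) (y0 - r) (y0 + r)).
  { apply Hside; intros x Hx; specialize (B4 x Hx).
    - apply: continuous_opp. apply (continuous_comp (fun t => (x0 - r, t) : C) (fun z => Re (F z))); [|apply HC, B4].
      apply continuous_pairC; [apply continuous_const|apply continuous_id].
    - rewrite -> HRe by exact B4. rewrite <- Rdiv_opp_l. apply Rdiv_lt_0_compat; [|apply Hpos, B4]. subst z0; simpl; lra. }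
  assert (N2 : RInt (fun x => - Im (F (x, y0 + r))) (x0 - r) (x0 + r) = - RInt (fun x => Im (F (x, y0 + r))) (x0 - r) (x0 + r)).
  { apply: RInt_opp. apply: ex_RInt_continuous. intros x. rewrite -> Rmin_left, Rmax_right by lra. intros Hx.
    apply (continuous_comp (fun t => (t, y0 + r) : C) (fun z => Im (F z))); [|apply HC, B2, Hx].
    apply continuous_pairC; [apply continuous_id|apply continuous_const]. }
  assert (N4 : RInt (fun y => - Re (F (x0 - r, y))) (y0 - r) (y0 + r) = - RInt (fun y => Re (F (x0 - r, y))) (y0 - r) (y0 + r)).
  { apply: RInt_opp. apply: ex_RInt_continuous. intros x. rewrite -> Rmin_left, Rmax_right by lra. intros Hx.
    apply (continuous_comp (fun t => (x0 - r, t) : C) (fun z => Re (F z))); [|apply HC, B4, Hx].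
    apply continuous_pairC; [apply continuous_const|apply continuous_id]. }
  intros E. apply (f_equal Im) in E.
  unfold SI, RI, CI in E. rewrite -> N2 in I2. rewrite -> N4 in I4.
  clear - E I1 I2 I3 I4 Ez0. subst z0. cbn [Re Im fst snd] in *.
  unfold Ci in E. simpl in E. lra.
Qed.

Lemma cauchy_int_one_neq0 (z0 : C) (r : R) : 0 < r -> cauchy_int (fun _ => 1%C) 1 z0 r z0 <> 0%C.
Proof.
  intros Hr.
  assert (HC : forall z, bdsq z0 r z -> continuous (fun z => Im (1 / (z - z0) ^ 1)%C) z /\
                 continuous (fun z => Re (1 / (z - z0) ^ 1)%C) z).
  { intros z Hz. apply and_comm. apply continuous_ReIm. apply continuous_kernel; [apply continuous_const|].
    apply (bdsq_neq z0 r); [exact Hr| |exact Hz]. rewrite Cmod_minus_self. exact Hr. }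
  assert (Hpos : forall z, bdsq z0 r z -> 0 < Cmod (z - z0) ^ 2).
  { intros z Hz. pose proof (bdsq_dist _ _ _ Hr Hz). apply pow_lt. lra. }
  assert (HRe : forall z, bdsq z0 r z -> Re (1 / (z - z0) ^ 1)%C = (Re z - Re z0) / Cmod (z - z0) ^ 2).
  { intros z Hz. specialize (Hpos z Hz). rewrite -> Cmod_sqr in *. unfold Re, Im in *; simpl in *. field. nra. }
  assert (HIm : forall z, bdsq z0 r z -> Im (1 / (z - z0) ^ 1)%C = (Im z0 - Im z) / Cmod (z - z0) ^ 2).
  { intros z Hz. specialize (Hpos z Hz). rewrite -> Cmod_sqr in *. unfold Re, Im in *; simpl in *. field. nra. }
  unfold cauchy_int. apply SI_inv_neq0; assumption.
Qed.

(** The difference quotient (f z - f w) / (z - w) is holomorphic off w and bounded near w, so its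
    integral vanishes by [Goursat_punctured]. *)
Lemma cauchy_formula (f : C -> C) (z0 w : C) (r : R) :
  0 < r -> (forall z, sq z0 r z -> exists l, cdiff f z l) -> Cmod (w - z0) < r ->
  cauchy_int f 1 z0 r w = (f w * cauchy_int (fun _ => 1%C) 1 z0 r w)%C.
Proof.
  intros Hr Hf Hw.
  assert (Hc : forall z, sq z0 r z -> continuous f z).
  { intros z Hz. destruct (Hf z Hz) as [l Hl]. eapply cdiff_continuous, Hl. }
  assert (Hwsq : Re z0 - r < Re w < Re z0 + r /\ Im z0 - r < Im w < Im z0 + r).
  { pose proof (Re_le_Cmod (w - z0)) as H1. pose proof (Im_le_Cmod (w - z0)) as H2.
    pose proof (Rle_lt_trans _ _ _ H1 Hw) as H3. pose proof (Rle_lt_trans _ _ _ H2 Hw) as H4.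
    apply Rabs_def2 in H3. apply Rabs_def2 in H4. unfold Re, Im in *; simpl in *. lra. }
  assert (Hne : forall z, bdsq z0 r z -> (z - w)%C <> 0%C) by (intros z Hz; exact (bdsq_neq z0 r w z Hr Hw Hz)).
  assert (HG : SI (fun z => (f z - f w) / (z - w))%C z0 r = 0%C).
  { destruct (Hf w) as [l Hl]. { split; lra. }
    apply (Goursat_punctured _ _ _ _ _ (1 + Cmod l) w); try apply Hwsq.
    - intros z Hz Hzw. destruct (Hf z Hz) as [lz Hlz]. eexists. apply cdiff_div.
      + apply cdiff_minus; [exact Hlz|apply cdiff_const].
      + apply cdiff_minus; [apply cdiff_id|apply cdiff_const].
      + apply Cminus_eq_contra, Hzw.
    - destruct (proj1 (cdiff_eps f w l) Hl 1 ltac:(lra)) as [d [Hd Hn]].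
      exists d. split; [exact Hd|]. intros z Hz Hzw. specialize (Hn z Hz).
      assert (Hm : 0 < Cmod (z - w)) by (apply Cmod_gt_0, Cminus_eq_contra, Hzw).
      rewrite Cmod_div; [|apply Cminus_eq_contra, Hzw].
      apply (Rmult_le_reg_r (Cmod (z - w))); [exact Hm|].
      unfold Rdiv. rewrite -> Rmult_assoc, Rinv_l, Rmult_1_r by lra.
      pose proof (Cmod_triangle (f z - f w - l * (z - w)) (l * (z - w))) as H.
      replace (f z - f w - l * (z - w) + l * (z - w))%C with (f z - f w)%C in H by ring.
      rewrite (Cmod_mult l) in H. lra. }
  unfold cauchy_int.
  rewrite (SI_ext _ (fun z => (f z / (z - w) ^ 1 + (- f w) * (1 / (z - w) ^ 1)))%C) in HG; [|exact Hr|].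
  2:{ intros z Hz. field. apply Hne, Hz. }
  rewrite SI_plus in HG; [|exact Hr| |].
  - rewrite SI_scal in HG; [|exact Hr|].
    + apply Ceq_minus. rewrite <- HG. ring.
    + intros z Hz. apply continuous_kernel; [apply continuous_const|apply Hne, Hz].
  - intros z Hz. apply continuous_kernel; [apply Hc, Hz|apply Hne, Hz].
  - intros z Hz. apply continuous_Cmult; [apply continuous_const|].
    apply continuous_kernel; [apply continuous_const|apply Hne, Hz].
Qed.

(** Differentiating the kernel of order 1 gives the kernel of order 2, which can be differentiated
    once more; hence the two values of k in [cdiff_cauchy_int]. *)
Lemma cauchy_int_hol (phi : C -> C) (z0 : C) (r M : R) :
  0 < r ->
  (forall z, bdsq z0 r z -> continuous phi z) -> (forall z, bdsq z0 r z -> Cmod (phi z) <= M) ->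
  hol (cauchy_int phi 1 z0 r) z0 /\ hol (C_derive (cauchy_int phi 1 z0 r)) z0.
Proof.
  intros Hr Hc HM.
  assert (H1 : near z0 (fun w => cdiff (cauchy_int phi 1 z0 r) w (cauchy_int phi 2 z0 r w))).
  { exists r. split; [exact Hr|]. intros w Hw.
    replace (cauchy_int phi 2 z0 r w) with (SI (fun z => INR 1 * (phi z / (z - w) ^ 2))%C z0 r).
    - apply (cdiff_cauchy_int phi 1 z0 w r M); auto.
    - apply SI_ext; [exact Hr|]. intros z _. simpl INR. ring. }
  assert (H2 : hol (cauchy_int phi 2 z0 r) z0).
  { apply hol_intro. exists r. split; [exact Hr|]. intros w Hw. eexists.
    apply (cdiff_cauchy_int phi 2 z0 w r M); auto. }
  split.
  - apply hol_intro. revert H1. apply near_imp. intros w Hw. eexists. exact Hw.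
  - eapply hol_near_ext; [|exact H2]. revert H1. apply near_imp.
    intros w Hw. symmetry. apply cdiff_C_derive, Hw.
Qed.

(** * Derivatives and orders of zeros of holomorphic functions *)

Lemma hol_square (f : C -> C) (z0 : C) :
  hol f z0 -> exists r M, 0 < r /\ (forall z, sq z0 r z -> cdiff f z (C_derive f z)) /\
                (forall z, sq z0 r z -> Cmod (f z) <= M).
Proof.
  (* A square of half-side d / 3 lies in the closed disc of radius 2 d / 3. *)
  intros [d [Hd Hf]]. exists (d / 3).
  assert (H : forall z, sq z0 (d / 3) z -> cdiff f z (C_derive f z)).
  { intros z Hz. apply Hf. apply sq_dist in Hz. lra. }
  destruct (continuous_rect_max (fun z => Cmod (f z)) (Re z0 - d / 3) (Re z0 + d / 3) (Im z0 - d / 3) (Im z0 + d / 3))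
    as [zm [_ Hm]]; try lra.
  - intros z Hz. apply (continuous_comp f Cmod); [|apply continuous_Cmod].
    eapply cdiff_continuous, H, Hz.
  - exists (Cmod (f zm)). split; [lra|]. split; [exact H|exact Hm].
Qed.

(* Near z0, f is a quotient of two Cauchy integrals over a fixed square, which can
   be differentiated twice under the integral sign. *)
Lemma hol_C_derive (f : C -> C) (z0 : C) : hol f z0 -> hol (C_derive f) z0.
Proof.
  intros Hf. destruct (hol_square f z0 Hf) as (r & M & Hr & Hd & HM).
  assert (Hone : forall z, bdsq z0 r z -> Cmod 1 <= 1) by (intros; rewrite Cmod_1; lra).
  destruct (cauchy_int_hol f z0 r M Hr) as [N1 N2].
  { intros z Hz. eapply cdiff_continuous, Hd, bdsq_sq, Hz. }
  { intros z Hz. apply HM, bdsq_sq, Hz. }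
  destruct (cauchy_int_hol (fun _ => 1%C) z0 r 1 Hr) as [K1 K2].
  { intros z Hz. apply continuous_const. }
  { exact Hone. }
  assert (HK : cauchy_int (fun _ => 1%C) 1 z0 r z0 <> 0%C) by (apply cauchy_int_one_neq0, Hr).
  assert (HN : forall w, Cmod (w - z0) < r ->
            cauchy_int f 1 z0 r w = (f w * cauchy_int (fun _ => 1%C) 1 z0 r w)%C).
  { intros w Hw. apply cauchy_formula; [exact Hr| |exact Hw].
    intros z Hz. exists (C_derive f z). apply Hd, Hz. }
  revert N1 N2 K1 K2 HK HN.
  generalize (cauchy_int f 1 z0 r). generalize (cauchy_int (fun _ => 1%C) 1 z0 r).
  intros K N N1 N2 K1 K2 HK HN.
  assert (Hnear : near z0 (fun w => f w = N w / K w)%C).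
  { pose proof (near_neq0 K z0 (hol_continuous _ _ K1) HK) as HK0.
    assert (Hcr : near z0 (fun w => Cmod (w - z0) < r)) by (exists r; auto).
    generalize (near_and _ _ _ HK0 Hcr). apply near_imp. intros w [H1 H2].
    rewrite -> HN by exact H2. field. exact H1. }
  apply (hol_near_ext (fun w => (C_derive N w * K w - N w * C_derive K w) / (K w * K w))%C).
  - generalize (near_and _ _ _ (near_near _ _ Hnear) (near_and _ _ _ N1 (near_and _ _ _ K1
      (near_neq0 K z0 (hol_continuous _ _ K1) HK)))).
    apply near_imp. intros w (H1 & H2 & H3 & H4). symmetry. apply cdiff_C_derive.
    apply (cdiff_near_ext (fun w => N w / K w)%C).
    + revert H1. apply near_imp. auto.
    + apply cdiff_div; assumption.
  - apply hol_div.
    + apply hol_minus; apply hol_mult; assumption.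
    + apply hol_mult; assumption.
    + apply Cmult_neq_0; exact HK.
Qed.

(* Let N k be the Cauchy integral of f / (z - z0)^k.  As long as N 0, ..., N (k - 1)
   vanish at z0, N 0 = (z - z0)^k N k; if they all vanish, N 0 = O(2^-k) near z0. *)
Lemma hol_order (f : C -> C) (z0 : C) :
  hol f z0 ->
  near z0 (fun z => f z = 0%C) \/
  exists (k : nat) (u : C -> C), hol u z0 /\ u z0 <> 0%C /\ near z0 (fun z => f z = (z - z0) ^ k * u z)%C.
Proof.
  intros Hf. destruct (hol_square f z0 Hf) as (r & M & Hr & Hd & HM).
  assert (Hz00 : Cmod (z0 - z0) < r) by (rewrite Cmod_minus_self; exact Hr).
  assert (Hne : forall w z, Cmod (w - z0) < r -> bdsq z0 r z -> (z - w)%C <> 0%C).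
  { intros w z Hw Hz. exact (bdsq_neq z0 r w z Hr Hw Hz). }
  pose (phi := fun (k : nat) z => (f z / (z - z0) ^ k)%C).
  assert (Hphic : forall k z, bdsq z0 r z -> continuous (phi k) z).
  { intros k z Hz. apply continuous_kernel; [eapply cdiff_continuous, Hd, bdsq_sq, Hz|apply Hne; assumption]. }
  assert (HM0 : 0 <= M).
  { eapply Rle_trans; [apply Cmod_ge_0|apply (HM z0)]. split; lra. }
  assert (Hphib : forall k z, bdsq z0 r z -> Cmod (phi k z) <= M / r ^ k).
  { intros k z Hz. pose proof (Hne z0 z Hz00 Hz) as Hz0. unfold phi.
    rewrite -> Cmod_div, Cmod_pow by (apply Cpow_nz; exact Hz0).
    apply Rmult_le_compat; [apply Cmod_ge_0| |apply HM, bdsq_sq, Hz|].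
    - apply Rlt_le, Rinv_0_lt_compat, pow_lt, Cmod_gt_0, Hz0.
    - apply Rinv_le_contravar; [apply pow_lt, Hr|]. apply pow_incr. split; [lra|].
      apply bdsq_dist; assumption. }
  assert (Hphirec : forall k z, bdsq z0 r z -> phi k z = ((z - z0) * phi (S k) z)%C).
  { intros k z Hz. pose proof (Hne z0 z Hz00 Hz) as Hz0. unfold phi. simpl. field.
    split; [apply Cpow_nz, Hz0|exact Hz0]. }
  assert (Hphi0 : forall z, f z = phi 0%nat z).
  { intros z. unfold phi. simpl. field. }
  clearbody phi.
  (* Introducing N through an existential keeps only its defining equation and hides the integrals
     from later unification. *)
  destruct (ex_intro (fun N => forall k, N k = cauchy_int (phi k) 1 z0 r)
              (fun k => cauchy_int (phi k) 1 z0 r) (fun k => eq_refl)) as [N HNE].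
  assert (HK : cauchy_int (fun _ => 1%C) 1 z0 r z0 <> 0%C) by (apply cauchy_int_one_neq0, Hr).
  assert (HKh : hol (cauchy_int (fun _ => 1%C) 1 z0 r) z0).
  { apply (cauchy_int_hol (fun _ => 1%C) z0 r 1 Hr).
    - intros z Hz. apply continuous_const.
    - intros z _. rewrite Cmod_1. lra. }
  assert (HNh : forall k, hol (N k) z0) by (intros k; rewrite HNE; apply (cauchy_int_hol _ z0 r _ Hr (Hphic k) (Hphib k))).
  assert (Hrec : forall k w, Cmod (w - z0) < r ->
    N k w = (N k z0 + (w - z0) * N (S k) w)%C).
  { intros k w Hw. rewrite !HNE. unfold cauchy_int.
    rewrite <- SI_scal; [|exact Hr|].
    2:{ intros z Hz. apply continuous_kernel; [apply Hphic, Hz|apply Hne; assumption]. }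
    rewrite <- SI_plus; [|exact Hr| |].
    - apply SI_ext; [exact Hr|]. intros z Hz. rewrite (Hphirec k z Hz). simpl. field.
      split; apply Hne; assumption.
    - intros z Hz. apply continuous_kernel; [apply Hphic, Hz|apply Hne; assumption].
    - intros z Hz. apply continuous_Cmult; [apply continuous_const|].
      apply continuous_kernel; [apply Hphic, Hz|apply Hne; assumption]. }
  assert (Hbd : forall k w, Cmod (w - z0) < r / 2 ->
            Cmod (N k w) <= 16 * ((M / r ^ k) * (2 / r)) * r).
  { intros k w Hw. rewrite HNE. apply SI_bound; [exact Hr| |].
    - intros z Hz. apply continuous_kernel; [apply Hphic, Hz|]. apply Hne; [lra|exact Hz].
    - intros z Hz. assert (Hzw : (z - w)%C <> 0%C) by (apply Hne; [lra|exact Hz]).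
      rewrite -> Cmod_div, Cpow_1_r by (apply Cpow_nz, Hzw).
      apply Rmult_le_compat; [apply Cmod_ge_0| |apply Hphib, Hz|].
      + apply Rlt_le, Rinv_0_lt_compat, Cmod_gt_0, Hzw.
      + replace (2 / r) with (/ (r / 2)) by (field; lra).
        apply Rinv_le_contravar; [lra|].
        pose proof (bdsq_dist_w z0 r w z Hr Hz). lra. }
  assert (HN : forall w, Cmod (w - z0) < r ->
            N 0%nat w = (f w * cauchy_int (fun _ => 1%C) 1 z0 r w)%C).
  { intros w Hw. rewrite HNE. rewrite <- cauchy_formula; [|exact Hr| |exact Hw].
    - apply SI_ext; [exact Hr|]. intros z _. rewrite Hphi0. reflexivity.
    - intros z Hz. exists (C_derive f z). apply Hd, Hz. }
  revert HK HKh HN. generalize (cauchy_int (fun _ => 1%C) 1 z0 r). intros K HK HKh HN.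
  assert (Hform : near z0 (fun w => Cmod (w - z0) < r / 2 /\ K w <> 0%C /\ f w = N 0%nat w / K w)%C).
  { assert (Hcr : near z0 (fun w => Cmod (w - z0) < r / 2)) by (exists (r / 2); split; [lra|auto]).
    generalize (near_and _ _ _ Hcr (near_neq0 K z0 (hol_continuous _ _ HKh) HK)).
    apply near_imp. intros w [H1 H2]. split; [exact H1|]. split; [exact H2|].
    rewrite -> HN by lra. field. exact H2. }
  assert (Hpow : forall k, (forall j, (j < k)%nat -> N j z0 = 0%C) ->
             forall w, Cmod (w - z0) < r -> N 0%nat w = ((w - z0) ^ k * N k w)%C).
  { induction k as [|k IH]; intros Hz w Hw.
    - simpl. ring.
    - rewrite IH; [|intros j Hj; apply Hz; lia|exact Hw].
      rewrite -> (Hrec k w Hw), (Hz k) by lia. simpl. ring. }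
  destruct (classic (forall k, N k z0 = 0%C)) as [Hall|Hex].
  - left. revert Hform. apply near_imp. intros w (H1 & H2 & H3).
    assert (HN0 : N 0%nat w = 0%C).
    { apply Cmod_eq_0. apply Rle_antisym; [|apply Cmod_ge_0]. apply le_epsilon. intros e He. rewrite Rplus_0_l.
      destruct (pow_lt_1_zero (1 / 2)) with (y := e / (32 * M + 1)) as [k Hk].
      - rewrite Rabs_right; lra.
      - apply Rdiv_lt_0_compat; lra.
      - specialize (Hk k (le_n k)). rewrite -> Rabs_right in Hk by (apply Rle_ge, pow_le; lra).
        rewrite -> (Hpow k (fun j _ => Hall j) w) by lra.
        rewrite -> Cmod_mult, Cmod_pow.
        assert (Hwk : Cmod (w - z0) ^ k <= (r / 2) ^ k).
        { apply pow_incr. split; [apply Cmod_ge_0|lra]. }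
        apply Rle_trans with ((r / 2) ^ k * (16 * ((M / r ^ k) * (2 / r)) * r)).
        { apply Rmult_le_compat; [apply pow_le, Cmod_ge_0|apply Cmod_ge_0|exact Hwk|apply Hbd, H1]. }
        replace ((r / 2) ^ k * (16 * ((M / r ^ k) * (2 / r)) * r)) with (32 * M * (1 / 2) ^ k).
        2:{ unfold Rdiv. rewrite !Rpow_mult_distr. rewrite pow1. field. split; [lra|apply pow_nonzero; lra]. }
        apply Rmult_lt_compat_l with (r := 32 * M + 1) in Hk; [|lra].
        replace ((32 * M + 1) * (e / (32 * M + 1))) with e in Hk by (field; lra).
        assert (0 < (1 / 2) ^ k) by (apply pow_lt; lra). nra. }
    rewrite -> H3, HN0. unfold Cdiv. ring.
  - right. apply not_all_ex_not in Hex.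
    (* The order of f at z0 is the least k with N k z0 <> 0, and the cofactor is N k / K, where K is
       the Cauchy integral of 1. *)
    destruct (dec_inh_nat_subset_has_unique_least_element (fun k => N k z0 <> 0%C)) as [k [[Hk1 Hk2] _]].
    + intros n. apply classic.
    + exact Hex.
    + exists k, (fun w => N k w / K w)%C. split; [|split].
      * apply hol_div; [apply HNh|exact HKh|exact HK].
      * apply Cmult_neq_0; [exact Hk1|]. apply Cmod_gt_0. rewrite -> Cmod_inv by exact HK.
        apply Rinv_0_lt_compat, Cmod_gt_0, HK.
      * revert Hform. apply near_imp. intros w (H1 & H2 & H3).
        rewrite -> H3, (Hpow k); [field; exact H2| |lra].
        intros j Hj. apply NNPP. intros Hn. specialize (Hk2 j Hn). lia.
Qed.

(** * Laplacians and the Ahlfors lemma *)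

Ltac Rring := match goal with |- @eq _ ?a ?b => change (@eq R a b) end; ring.

(** The second derivative along the line through z0 in the direction e. Working on lines reduces
    Laplacians to functions of one real variable. *)
Definition dir2 (W : C -> R) (z0 e : C) (l : R) : Prop :=
  exists W1 : R -> R,
    locally 0 (fun t : R => is_derive (fun s : R => W (z0 + e * s)%C) t (W1 t)) /\ is_derive W1 0 l.

Definition is_lap (W : C -> R) (z0 : C) (l : R) : Prop :=
  exists lx ly, dir2 W z0 1 lx /\ dir2 W z0 Ci ly /\ l = lx + ly.

Lemma near_line (z0 e : C) (P : C -> Prop) :
  Cmod e = 1 -> near z0 P -> locally 0 (fun t : R => P (z0 + e * t)%C).
Proof.
  intros He [d [Hd H]]. exists (mkposreal d Hd). intros t Ht. apply H.
  replace (z0 + e * t - z0)%C with (e * t)%C by ring.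
  rewrite -> Cmod_mult, He, Cmod_R, Rmult_1_l.
  rewrite <- (Rminus_0_r t). exact Ht.
Qed.

Lemma dir2_plus (U V : C -> R) (z0 e : C) (l m : R) :
  dir2 U z0 e l -> dir2 V z0 e m -> dir2 (fun z => U z + V z) z0 e (l + m).
Proof.
  intros [U1 [HU HU1]] [V1 [HV HV1]]. exists (fun t => U1 t + V1 t). split.
  - generalize (filter_and _ _ HU HV). apply filter_imp. intros t [H1 H2].
    apply: is_derive_plus; assumption.
  - apply: is_derive_plus; assumption.
Qed.

Lemma dir2_scal (a : R) (U : C -> R) (z0 e : C) (l : R) :
  dir2 U z0 e l -> dir2 (fun z => a * U z) z0 e (a * l).
Proof.
  intros [U1 [HU HU1]]. exists (fun t => a * U1 t). split.
  - revert HU. apply filter_imp. intros t H1. apply is_derive_scal. assumption.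
  - apply is_derive_scal. assumption.
Qed.

Lemma dir2_near_ext (U V : C -> R) (z0 e : C) (l : R) :
  Cmod e = 1 -> near z0 (fun z => U z = V z) -> dir2 U z0 e l -> dir2 V z0 e l.
Proof.
  intros He H [U1 [HU HU1]]. exists U1. split; [|exact HU1].
  pose proof (near_line _ _ _ He H) as HL. apply locally_locally in HL.
  generalize (filter_and _ _ HL HU). apply filter_imp. intros t [H1 H2].
  eapply is_derive_ext_loc; [|exact H2]. exact H1.
Qed.

Lemma is_lap_plus (U V : C -> R) (z0 : C) (l m : R) :
  is_lap U z0 l -> is_lap V z0 m -> is_lap (fun z => U z + V z) z0 (l + m).
Proof.
  intros (lx & ly & H1 & H2 & ->) (mx & my & H3 & H4 & ->).
  exists (lx + mx), (ly + my). split; [|split]; [apply dir2_plus; assumption..|ring].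
Qed.

Lemma is_lap_scal (a : R) (U : C -> R) (z0 : C) (l : R) :
  is_lap U z0 l -> is_lap (fun z => a * U z) z0 (a * l).
Proof.
  intros (lx & ly & H1 & H2 & ->).
  exists (a * lx), (a * ly). split; [|split]; [apply dir2_scal; assumption..|ring].
Qed.

Lemma is_lap_near_ext (U V : C -> R) (z0 : C) (l : R) :
  near z0 (fun z => U z = V z) -> is_lap U z0 l -> is_lap V z0 l.
Proof.
  intros H (lx & ly & H1 & H2 & ->). exists lx, ly.
  split; [|split; [|reflexivity]]; eapply dir2_near_ext; eauto using Cmod_1, Cmod_Ci.
Qed.

(** At a maximum p1 0 = 0. If l were positive, p1 would be positive just to the right of 0, and the
    mean value theorem would make p exceed p 0 there. *)
Lemma second_derivative_max (p p1 : R -> R) (l : R) :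
  locally 0 (fun t => p t <= p 0) -> locally 0 (fun t => is_derive p t (p1 t)) ->
  is_derive p1 0 l -> l <= 0.
Proof.
  intros Hmax Hp Hp1. apply Rnot_lt_le. intros Hl.
  destruct (filter_and _ _ Hmax Hp) as [d Hd].
  assert (Hball : forall t, Rabs t < d -> p t <= p 0 /\ is_derive p t (p1 t)).
  { intros t Ht. apply Hd. rewrite <- (Rminus_0_r t) in Ht. exact Ht. }
  pose proof (cond_pos d) as Hdpos.
  assert (H0 : p1 0 = 0).
  { destruct (Hball 0) as [_ Hd0]. { rewrite Rabs_R0. exact Hdpos. }
    apply is_derive_Reals in Hd0.
    pose (pr := exist (derivable_pt_lim p 0) (p1 0) Hd0 : derivable_pt p 0).
    change (derive_pt p 0 pr = 0). apply (deriv_maximum p (- d) d); try lra.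
    intros x Hx1 Hx2. apply Hball. apply Rabs_def1; lra. }
  apply is_derive_Reals in Hp1. destruct (Hp1 l Hl) as [r Hr].
  pose proof (cond_pos r) as Hrpos.
  set (t := Rmin d r / 2).
  assert (Ht : 0 < t /\ t < d /\ t < r).
  { unfold t. pose proof (Rmin_l d r). pose proof (Rmin_r d r). pose proof (Rmin_pos d r Hdpos Hrpos). lra. }
  destruct (MVT_cor2 p p1 0 t) as [y [Hy1 Hy2]]; [lra| |].
  { intros y Hy. apply is_derive_Reals, Hball. rewrite Rabs_right; lra. }
  assert (Hle : p t <= p 0) by (apply Hball; rewrite Rabs_right; lra).
  specialize (Hr y ltac:(lra)). rewrite -> Rplus_0_l, H0, Rminus_0_r in Hr.
  assert (Hyr : Rabs y < r) by (rewrite Rabs_right; lra). specialize (Hr Hyr).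
  apply Rabs_def2 in Hr. assert (Hq : 0 < p1 y / y) by lra.
  apply (Rmult_lt_compat_r y) in Hq; [|lra]. unfold Rdiv in Hq.
  rewrite -> Rmult_assoc, Rinv_l in Hq by lra. nra.
Qed.

Lemma dir2_max (W : C -> R) (z0 e : C) (l : R) :
  Cmod e = 1 -> near z0 (fun z => W z <= W z0) -> dir2 W z0 e l -> l <= 0.
Proof.
  intros He Hmax [W1 [HW HW1]].
  apply (second_derivative_max (fun t => W (z0 + e * t)%C) W1); try assumption.
  replace (z0 + e * 0)%C with z0 by ring. apply (near_line z0 e (fun z => W z <= W z0)); assumption.
Qed.

Lemma is_lap_max (W : C -> R) (z0 : C) (l : R) :
  near z0 (fun z => W z <= W z0) -> is_lap W z0 l -> l <= 0.
Proof.
  intros H (lx & ly & H1 & H2 & ->).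
  apply (dir2_max W z0) in H1; try assumption; [|apply Cmod_1].
  apply (dir2_max W z0) in H2; try assumption; [|apply Cmod_Ci]. lra.
Qed.

Lemma is_derive_line (F : C -> C) (z0 e l : C) (t : R) :
  Cmod e = 1 -> cdiff F (z0 + e * t)%C l ->
  is_derive (fun s : R => Re (F (z0 + e * s)%C)) t (Re (e * l)%C) /\
  is_derive (fun s : R => Im (F (z0 + e * s)%C)) t (Im (e * l)%C).
Proof.
  intros He HF.
  assert (Hest : forall eps, 0 < eps -> exists d, 0 < d /\ forall h, h <> 0 -> Rabs h < d ->
            Cmod (F (z0 + e * (t + h)%R) - F (z0 + e * t) - (RtoC h) * (e * l))%C <= eps * Rabs h).
  { intros eps Heps. destruct (proj1 (cdiff_eps _ _ _) HF eps Heps) as [d [Hd Hn]].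
    exists d. split; [exact Hd|]. intros h Hh0 Hh.
    assert (Ew : (z0 + e * (t + h)%R - (z0 + e * t) = e * h)%C) by (rewrite RtoC_plus; ring).
    assert (Em : Cmod (z0 + e * (t + h)%R - (z0 + e * t))%C = Rabs h).
    { rewrite -> Ew, Cmod_mult, He, Cmod_R. ring. }
    specialize (Hn (z0 + e * (t + h)%R)%C). rewrite -> Em in Hn. specialize (Hn Hh).
    rewrite -> Ew in Hn. replace (h * (e * l))%C with (l * (e * h))%C by ring. exact Hn. }
  (* Re and Im are treated together as real-linear functionals bounded by the modulus. *)
  assert (Hgen : forall g : C -> R, (forall z, Rabs (g z) <= Cmod z) ->
            (forall a b h : C, g (a - b - h)%C = g a - g b - g h) ->
            (forall (h : R) (z : C), g (h * z)%C = h * g z) ->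
            is_derive (fun s : R => g (F (z0 + e * s)%C)) t (g (e * l)%C)).
  { intros g Hg1 Hg2 Hg3. apply is_derive_Reals. intros eps Heps.
    destruct (Hest (eps / 2) ltac:(lra)) as [d [Hd Hn]].
    exists (mkposreal d Hd). simpl. intros h Hh0 Hh. specialize (Hn h Hh0 Hh).
    pose proof (Rle_trans _ _ _ (Hg1 _) Hn) as H. rewrite -> Hg2, Hg3 in H.
    assert (Hhp : 0 < Rabs h) by (apply Rabs_pos_lt, Hh0).
    apply (Rmult_lt_reg_r (Rabs h)); [exact Hhp|].
    rewrite <- Rabs_mult.
    replace (((g (F (z0 + e * (t + h)%R)%C) - g (F (z0 + e * t)%C)) / h - g (e * l)%C) * h)
      with (g (F (z0 + e * (t + h)%R)%C) - g (F (z0 + e * t)%C) - h * g (e * l)%C) by (field; exact Hh0).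
    nra. }
  split; apply Hgen.
  - apply Re_le_Cmod.
  - intros a b h. unfold Re; simpl; ring.
  - intros h z. unfold Re; simpl; ring.
  - apply Im_le_Cmod.
  - intros a b h. unfold Im; simpl; ring.
  - intros h z. unfold Im; simpl; ring.
Qed.

Lemma dir2_comp (tau tau1 : R -> R) (t2 : R) (F G : C -> C) (z0 e m : C) :
  Cmod e = 1 -> near z0 (fun z => cdiff F z (G z)) -> cdiff G z0 m ->
  near z0 (fun z => is_derive tau (Cmod (F z) ^ 2) (tau1 (Cmod (F z) ^ 2))) ->
  is_derive tau1 (Cmod (F z0) ^ 2) t2 ->
  dir2 (fun z => tau (Cmod (F z) ^ 2)) z0 e
    (t2 * (2 * (Re (F z0) * Re (e * G z0)%C + Im (F z0) * Im (e * G z0)%C)) ^ 2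
     + tau1 (Cmod (F z0) ^ 2) *
       (2 * (Re (e * G z0)%C ^ 2 + Im (e * G z0)%C ^ 2
          + Re (F z0) * Re (e * (e * m))%C
          + Im (F z0) * Im (e * (e * m))%C))).
Proof.
  intros He HF HF1 Ht Ht1.
  pose (L := fun s : R => (z0 + e * s)%C).
  assert (HL0 : L 0 = z0) by (change ((z0 + e * 0)%C = z0); ring).
  pose (P1 := fun t => 2 * (Re (F (L t)) * Re (e * G (L t))%C + Im (F (L t)) * Im (e * G (L t))%C)).
  assert (HP : forall t, cdiff F (L t) (G (L t)) ->
            is_derive (fun s => Cmod (F (L s)) ^ 2) t (P1 t)).
  { intros t H. destruct (is_derive_line F z0 e _ t He H) as [H1 H2].
    apply (is_derive_ext (fun s => Re (F (L s)) * Re (F (L s)) + Im (F (L s)) * Im (F (L s)))).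
    - intros s. rewrite Cmod_sqr. Rring.
    - evar_last.
      + apply: is_derive_plus; apply: is_derive_mult; try eassumption; intros; apply Rmult_comm.
      + unfold P1, L, plus, mult; simpl. Rring. }
  exists (fun t => tau1 (Cmod (F (L t)) ^ 2) * P1 t). split.
  - generalize (near_line z0 e _ He (near_and _ _ _ Ht HF)). apply filter_imp.
    intros t [H1 H2]. evar_last.
    + apply (is_derive_comp tau (fun s => Cmod (F (L s)) ^ 2)); [exact H1|apply HP, H2].
    + unfold scal; simpl; unfold mult; simpl. unfold L. Rring.
  - pose proof (near_self _ _ HF) as C0. simpl in C0. pose proof HF1 as C1.
    rewrite <- HL0 in C0, C1. rewrite <- HL0 in Ht1 at 1.
    destruct (is_derive_line F z0 e _ 0 He C0) as [H1 H2].
    destruct (is_derive_line (fun z => e * G z)%C z0 e _ 0 He (cdiff_scal e _ _ _ C1)) as [H3 H4].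
    pose proof (HP 0 C0) as HP0.
    assert (HP1 : is_derive P1 0 (2 * (Re (e * G z0)%C ^ 2 + Im (e * G z0)%C ^ 2
          + Re (F z0) * Re (e * (e * m))%C
          + Im (F z0) * Im (e * (e * m))%C))).
    { unfold P1. apply is_derive_scal. evar_last.
      - apply: is_derive_plus; apply: is_derive_mult; try eassumption; intros; apply Rmult_comm.
      - change (z0 + e * 0)%C with (L 0). rewrite HL0. unfold plus, mult. simpl. rewrite !HL0. Rring. }
    evar_last.
    + apply: is_derive_mult; [|exact HP1|intros; apply Rmult_comm].
      apply (is_derive_comp tau1 (fun s => Cmod (F (L s)) ^ 2)); [exact Ht1|exact HP0].
    + unfold P1. rewrite HL0. unfold scal, plus, mult; simpl. unfold mult; simpl. Rring.
Qed.

(** Terms with F'' carry the factor e^2, so those from the directions 1 and i cancel. For w =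
    conj(F) F' the terms with tau'' combine through Re(w)^2 + Re(i w)^2 = |F|^2 |F'|^2. *)
Lemma is_lap_comp (tau tau1 : R -> R) (t2 : R) (F : C -> C) (z0 : C) :
  hol F z0 -> hol (C_derive F) z0 ->
  near z0 (fun z => is_derive tau (Cmod (F z) ^ 2) (tau1 (Cmod (F z) ^ 2))) ->
  is_derive tau1 (Cmod (F z0) ^ 2) t2 ->
  is_lap (fun z => tau (Cmod (F z) ^ 2)) z0
    (4 * Cmod (C_derive F z0) ^ 2 * (tau1 (Cmod (F z0) ^ 2) + Cmod (F z0) ^ 2 * t2)).
Proof.
  intros HF HF1 Ht Ht1. eexists. eexists. split; [|split].
  - apply (dir2_comp tau tau1 t2 F (C_derive F) z0 _ (C_derive (C_derive F) z0)); eauto using Cmod_1, hol_cdiff.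
  - apply (dir2_comp tau tau1 t2 F (C_derive F) z0 _ (C_derive (C_derive F) z0)); eauto using Cmod_Ci, hol_cdiff.
  - generalize (tau1 (Cmod (F z0) ^ 2)). intros t1. rewrite !Cmod_sqr. unfold Ci, Re, Im. simpl. ring.
Qed.

(* At a maximum of u(z) (R^2 - |z - z1|^2) the Laplacian of its logarithm is
   nonpositive, which bounds u(z1) by 2 / (R sqrt c). *)
Lemma ahlfors (u : C -> R) (c : R) :
  0 < c -> (forall z, continuous u z) ->
  (forall z, 0 < u z -> exists l, is_lap (fun w => ln (u w)) z l /\ c * u z ^ 2 <= l) ->
  forall z, u z <= 0.
Proof.
  intros Hc Hu Hlap z1. apply Rnot_lt_le. intros Hz1.
  (* The maximum principle will give c u(z1)^2 R^2 <= 4; the 5 makes this a contradiction. *)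
  pose (R := sqrt (5 / (c * u z1 ^ 2))).
  assert (Hcu : 0 < c * u z1 ^ 2) by (apply Rmult_lt_0_compat; [exact Hc|apply pow_lt, Hz1]).
  assert (H5 : 0 < 5 / (c * u z1 ^ 2)) by (apply Rdiv_lt_0_compat; lra).
  assert (HR : 0 < R) by (apply sqrt_lt_R0, H5).
  assert (HR2 : R ^ 2 = 5 / (c * u z1 ^ 2)) by (unfold R; rewrite pow2_sqrt; lra).
  clearbody R.
  pose (p := fun z => R ^ 2 - Cmod (z - z1) ^ 2).
  assert (Hp : forall z, continuous p z).
  { intros z. unfold p. apply: continuous_minus; [apply continuous_const|].
    apply (continuous_comp (fun z => Cmod (z - z1)) (fun x => x ^ 2)).
    - apply (continuous_comp (fun z => z - z1)%C Cmod); [|apply continuous_Cmod].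
      apply continuous_Cminus; [apply continuous_id|apply continuous_const].
    - apply: ex_derive_continuous. auto_derive. exact I. }
  (* Taking the positive part of p allows maximising over a square: the product is positive at z1,
     so its maximum is attained where p > 0. *)
  destruct (continuous_rect_max (fun z => u z * Rmax 0 (p z)) (Re z1 - R) (Re z1 + R) (Im z1 - R) (Im z1 + R))
    as [zm [Hzm Hm]]; try lra.
  { intros z _. apply: continuous_mult; [apply Hu|].
    apply (continuous_comp p (fun x => Rmax 0 x)); [apply Hp|].
    apply continuous_ext with (fun x => (x + Rabs x) / 2).
    - intros x. unfold Rmax, Rabs. destruct (Rle_dec 0 x), (Rcase_abs x); lra.
    - apply: continuous_mult; [|apply continuous_const].
      apply: continuous_plus; [apply continuous_id|]. apply continuous_Rabs. }
  assert (Hp1 : p z1 = R ^ 2) by (unfold p; rewrite Cmod_minus_self; ring).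
  assert (HR2p : 0 < R ^ 2) by (apply pow_lt, HR).
  assert (Hvm : u z1 * R ^ 2 <= u zm * Rmax 0 (p zm)).
  { eapply Rle_trans; [|apply (Hm z1)]; [|split; lra]. rewrite -> Hp1, Rmax_right by lra. lra. }
  assert (Hv0 : 0 < u z1 * R ^ 2) by (apply Rmult_lt_0_compat; assumption).
  assert (Hpm : 0 < p zm).
  { apply Rnot_le_lt. intros Hle. rewrite -> Rmax_left in Hvm by exact Hle. lra. }
  rewrite -> Rmax_right in Hvm by lra.
  assert (Hum : 0 < u zm).
  { apply Rnot_le_lt. intros Hle. assert (u zm * p zm <= 0) by nra. lra. }
  assert (Hnu : near zm (fun z => 0 < u z)).
  { generalize (proj1 (continuous_R_eps u zm) (Hu zm) _ Hum). apply near_imp.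
    intros w Hw. apply Rabs_def2 in Hw. lra. }
  assert (Hnp : near zm (fun z => 0 < p z)).
  { generalize (proj1 (continuous_R_eps p zm) (Hp zm) _ Hpm). apply near_imp.
    intros w Hw. apply Rabs_def2 in Hw. lra. }
  destruct (Hlap zm Hum) as [l [Hl Hcl]].
  assert (Hh : forall w, hol (fun z => z - z1)%C w) by (intros w; apply hol_minus; [apply hol_id|apply hol_const]).
  assert (Hd : forall w, C_derive (fun z => z - z1)%C w = 1%C).
  { intros w. apply cdiff_C_derive.
    pose proof (cdiff_minus _ _ w _ _ (cdiff_id w) (cdiff_const z1 w)) as H.
    replace (1 - 0)%C with (RtoC 1) in H by ring. exact H. }
  assert (Hlp : is_lap (fun z => ln (p z)) zm
     (4 * Cmod (C_derive (fun z => z - z1)%C zm) ^ 2 * (- / p zm + Cmod (zm - z1) ^ 2 * (- / p zm ^ 2)))).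
  { apply (is_lap_comp (fun x => ln (R ^ 2 - x)) (fun x => - / (R ^ 2 - x)) (- / p zm ^ 2) (fun z => z - z1)%C).
    - apply Hh.
    - apply (hol_near_ext (fun _ => 1%C)); [|apply hol_const].
      exists 1. split; [lra|]. intros w _. symmetry. apply Hd.
    - revert Hnp. apply near_imp. intros z Hz. unfold p in Hz. auto_derive; [lra|field; lra].
    - unfold p in *. auto_derive; [lra|]. field. lra. }
  rewrite -> Hd, Cmod_1 in Hlp.
  assert (Hmax : l + 4 * 1 ^ 2 * (- / p zm + Cmod (zm - z1) ^ 2 * (- / p zm ^ 2)) <= 0).
  { apply (is_lap_max (fun z => ln (u z) + ln (p z)) zm); [|apply is_lap_plus; assumption].
    generalize (near_and _ _ _ Hnu Hnp). apply near_imp. intros z [H1 H2].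
    rewrite <- !ln_mult by assumption. apply ln_le; [apply Rmult_lt_0_compat; assumption|].
    assert (Hin : in_rect (Re z1 - R) (Re z1 + R) (Im z1 - R) (Im z1 + R) z).
    { assert (Hdz : Cmod (z - z1) <= R).
      { apply Rnot_lt_le. intros Hlt. unfold p in H2. nra. }
      pose proof (Rle_trans _ _ _ (Re_le_Cmod _) Hdz) as K1. pose proof (Rle_trans _ _ _ (Im_le_Cmod _) Hdz) as K2.
      apply Rabs_le_between in K1. apply Rabs_le_between in K2. unfold in_rect, Re, Im in *. simpl in *. lra. }
    specialize (Hm z Hin). rewrite -> !Rmax_right in Hm by lra. exact Hm. }
  assert (Hq : Cmod (zm - z1) ^ 2 = R ^ 2 - p zm) by (unfold p; ring).
  rewrite Hq in Hmax.
  (* That is, Delta ln p = - 4 R^2 / p^2 at zm, because |zm - z1|^2 = R^2 - p. *)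
  replace (4 * 1 ^ 2 * (- / p zm + (R ^ 2 - p zm) * - / p zm ^ 2)) with (- (4 * R ^ 2) / p zm ^ 2) in Hmax by (field; lra).
  assert (Hfin : c * (u zm * p zm) ^ 2 <= 4 * R ^ 2).
  { assert (Hle : c * u zm ^ 2 <= 4 * R ^ 2 / p zm ^ 2).
    { replace (4 * R ^ 2 / p zm ^ 2) with (- (- (4 * R ^ 2) / p zm ^ 2)) by (field; lra). lra. }
    apply (Rmult_le_compat_r (p zm ^ 2)) in Hle; [|apply pow_le; lra].
    replace (4 * R ^ 2 / p zm ^ 2 * p zm ^ 2) with (4 * R ^ 2) in Hle by (field; lra).
    replace (c * (u zm * p zm) ^ 2) with (c * u zm ^ 2 * p zm ^ 2) by ring. exact Hle. }
  assert (Hsq : (u z1 * R ^ 2) ^ 2 <= (u zm * p zm) ^ 2) by (apply pow_incr; lra).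
  assert (Hfin2 : c * u z1 ^ 2 * R ^ 2 * R ^ 2 <= 4 * R ^ 2) by nra.
  apply Rmult_le_reg_r in Hfin2; [|exact HR2p].
  rewrite HR2 in Hfin2.
  replace (c * u z1 ^ 2 * (5 / (c * u z1 ^ 2))) with 5 in Hfin2 by (field; split; lra). lra.
Qed.

(** * Local form of solutions of the Fermat equation *)

Lemma near_exists_neq (z0 : C) (P : C -> Prop) : near z0 P -> exists z, z <> z0 /\ P z.
Proof.
  intros [d [Hd H]]. exists (z0 + RtoC (d / 2))%C. split.
  - intros E. apply (f_equal Re) in E. unfold Re in E. simpl in E. lra.
  - apply H. replace (z0 + RtoC (d / 2) - z0)%C with (RtoC (d / 2)) by ring.
    rewrite -> Cmod_R, Rabs_right by lra. lra.
Qed.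

Lemma continuous_eq0_of_punctured (f : C -> C) (z0 : C) :
  continuous f z0 -> near z0 (fun z => z <> z0 -> f z = 0%C) -> f z0 = 0%C.
Proof.
  intros Hf H. apply NNPP. intros H0.
  destruct (near_exists_neq _ _ (near_and _ _ _ H (near_neq0 _ _ Hf H0))) as [z [Hz [H1 H2]]].
  apply H2, H1, Hz.
Qed.

Lemma near_Cmod_le (f : C -> C) (z0 : C) :
  continuous f z0 -> near z0 (fun z => Cmod (f z) <= Cmod (f z0) + 1).
Proof.
  intros Hf. generalize (proj1 (continuous_C_eps f z0) Hf 1 ltac:(lra)). apply near_imp.
  intros z Hz. pose proof (Cmod_minus_le (f z) (f z0)). lra.
Qed.

Lemma near_Cmod_ge (f : C -> C) (z0 : C) :
  continuous f z0 -> f z0 <> 0%C -> near z0 (fun z => Cmod (f z0) / 2 <= Cmod (f z)).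
Proof.
  intros Hf H0. apply Cmod_gt_0 in H0.
  generalize (proj1 (continuous_C_eps f z0) Hf (Cmod (f z0) / 2) ltac:(lra)). apply near_imp.
  intros z Hz. pose proof (Cmod_minus_le (f z0) (f z)) as H. rewrite Cmod_minus_sym in H. lra.
Qed.

Lemma INR_C_neq0 (k : nat) : (1 <= k)%nat -> RtoC (INR k) <> 0%C.
Proof.
  intros Hk E. apply (f_equal Re) in E. unfold Re in E. simpl in E.
  apply INR_eq with (n := k) (m := 0%nat) in E. lia.
Qed.

Lemma finite_part_eq (f : C -> option C) (z a : C) : f z = Some a -> finite_part f z = a.
Proof. unfold finite_part. intros ->. reflexivity. Qed.

Lemma regular_finite_part (f : C -> option C) (z0 a : C) :
  meromorphic f -> f z0 = Some a ->
  hol (finite_part f) z0 /\ near z0 (fun z => f z = Some (finite_part f z)).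
Proof.
  intros Hf Ha. destruct (Hf z0) as [[h [Hh Hn]]|[Hp _]]; [|congruence].
  apply holomorphic_at_hol in Hh. apply near_locally in Hn.
  assert (Hn' : near z0 (fun z => h z = finite_part f z)).
  { revert Hn. apply near_imp. intros z Hz. unfold finite_part. rewrite Hz. reflexivity. }
  split; [eapply hol_near_ext; eassumption|].
  generalize (near_and _ _ _ Hn Hn'). apply near_imp. intros z [H1 H2]. congruence.
Qed.

Lemma pole_local_form (f : C -> option C) (z0 : C) :
  meromorphic f -> f z0 = None ->
  exists (k : nat) (h : C -> C), (1 <= k)%nat /\ hol h z0 /\ h z0 <> 0%C /\
    near z0 (fun z => z <> z0 -> f z = Some (h z / (z - z0) ^ k)%C).
Proof.
  intros Hf H0. destruct (Hf z0) as [[h [Hh Hn]]|[_ (k & h & Hk & Hh & Hh0 & Hn)]].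
  - apply near_locally in Hn. pose proof (near_self _ _ Hn) as E. simpl in E. congruence.
  - exists k, h. split; [exact Hk|]. split; [apply holomorphic_at_hol, Hh|]. split; [exact Hh0|].
    apply near_locally, Hn.
Qed.

(** If m j > n k, multiplying the equation by (z - z0)^(m j) and letting z tend to z0 leaves p(z0)^m
    = 0. Taking k = 0 covers a function g that is regular at z0. *)
Lemma fermat_order_le (m n : nat) (f g : C -> option C) (z0 : C) (j k : nat) (p q : C -> C) :
  fermat_eq m n f g -> continuous p z0 -> continuous q z0 -> p z0 <> 0%C ->
  near z0 (fun z => z <> z0 -> f z = Some (p z / (z - z0) ^ j)%C) ->
  near z0 (fun z => z <> z0 -> g z = Some (q z / (z - z0) ^ k)%C) ->
  (m * j <= n * k)%nat.
Proof.
  intros hfg Hp Hq Hp0 Hf Hg. apply Nat.le_ngt. intros Hlt.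
  assert (E : (p z0 ^ m + q z0 ^ n * (z0 - z0) ^ (m * j - n * k) - (z0 - z0) ^ (m * j))%C = 0%C).
  { apply (continuous_eq0_of_punctured
      (fun z => (p z ^ m + q z ^ n * (z - z0) ^ (m * j - n * k) - (z - z0) ^ (m * j))%C) z0).
    - assert (Hd : continuous (fun z => z - z0)%C z0).
      { apply continuous_Cminus; [apply continuous_id|apply continuous_const]. }
      apply continuous_Cminus; [|apply continuous_Cpow, Hd].
      apply continuous_Cplus; [apply continuous_Cpow, Hp|].
      apply continuous_Cmult; [apply continuous_Cpow, Hq|apply continuous_Cpow, Hd].
    - generalize (near_and _ _ _ Hf Hg). apply near_imp. intros z [H1 H2] Hz.
      assert (Hd : (z - z0)%C <> 0%C) by (apply Cminus_eq_contra, Hz).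
      pose proof (hfg z _ _ (H1 Hz) (H2 Hz)) as H3.
      set (d := (z - z0)%C) in *.
      assert (Edj : (d ^ (m * j))%C = ((d ^ j) ^ m)%C) by (rewrite <- Cpow_mult_r; f_equal; lia).
      assert (Edk : (d ^ (m * j))%C = (d ^ (m * j - n * k) * (d ^ k) ^ n)%C).
      { rewrite <- Cpow_mult_r, <- Cpow_add_r. f_equal. lia. }
      assert (Hpow : forall (x y : C) (i : nat), y <> 0%C -> (x ^ i = (x / y) ^ i * y ^ i)%C).
      { intros x y i Hy. rewrite <- Cpow_mult_l. f_equal. field. exact Hy. }
      rewrite -> (Hpow (p z) (d ^ j)%C m), (Hpow (q z) (d ^ k)%C n) by (apply Cpow_nz, Hd).
      rewrite <- Edj.
      replace ((p z / d ^ j) ^ m * d ^ (m * j) + (q z / d ^ k) ^ n * (d ^ k) ^ n * d ^ (m * j - n * k) - d ^ (m * j))%C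
        with ((p z / d ^ j) ^ m * d ^ (m * j) + (q z / d ^ k) ^ n * (d ^ (m * j - n * k) * (d ^ k) ^ n) - d ^ (m * j))%C by ring.
      rewrite <- Edk.
      replace ((p z / d ^ j) ^ m * d ^ (m * j) + (q z / d ^ k) ^ n * d ^ (m * j) - d ^ (m * j))%C
        with (((p z / d ^ j) ^ m + (q z / d ^ k) ^ n) * d ^ (m * j) - d ^ (m * j))%C by ring.
      rewrite H3. ring. }
  destruct (m * j - n * k)%nat as [|i] eqn:Ei; [lia|].
  destruct (m * j)%nat as [|l]; [lia|]. simpl in E.
  replace (z0 - z0)%C with (RtoC 0) in E by ring.
  apply (Cpow_nz (p z0) m Hp0). rewrite <- E. ring.
Qed.

(** Comparing orders in both directions shows that every pole of f is a pole of g, with orders tied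
    by m j = n k. *)
Lemma fermat_poles (m n : nat) (f g : C -> option C) (z0 : C) :
  (2 <= m)%nat -> (2 <= n)%nat -> meromorphic f -> meromorphic g -> fermat_eq m n f g ->
  f z0 = None ->
  exists (j k : nat) (p q : C -> C), (1 <= j)%nat /\ (1 <= k)%nat /\ (m * j = n * k)%nat /\
    hol p z0 /\ hol q z0 /\ p z0 <> 0%C /\ q z0 <> 0%C /\ g z0 = None /\
    near z0 (fun z => z <> z0 -> f z = Some (p z / (z - z0) ^ j)%C) /\
    near z0 (fun z => z <> z0 -> g z = Some (q z / (z - z0) ^ k)%C).
Proof.
  intros hm hn hf hg hfg H0.
  destruct (pole_local_form f z0 hf H0) as (j & p & Hj & Hp & Hp0 & Hfp).
  destruct (g z0) as [b|] eqn:Eg.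
  - destruct (regular_finite_part g z0 b hg Eg) as [Hh Hn].
    assert (m * j <= n * 0)%nat; [|nia].
    apply (fermat_order_le m n f g z0 j 0 p (finite_part g)); auto using hol_continuous.
    revert Hn. apply near_imp. intros z -> _. f_equal. simpl. field.
  - destruct (pole_local_form g z0 hg Eg) as (k & q & Hk & Hq & Hq0 & Hgq).
    exists j, k, p, q. repeat (split; [assumption|]).
    split.
    + apply Nat.le_antisymm.
      * apply (fermat_order_le m n f g z0 j k p q); auto using hol_continuous.
      * apply (fermat_order_le n m g f z0 k j q p); auto using hol_continuous.
        intros z a b Ha Hb. rewrite Cplus_comm. eapply hfg; eassumption.
    + repeat (split; [assumption || reflexivity|]). assumption.
Qed.

Lemma fermat_eq_sym (m n : nat) (f g : C -> option C) : fermat_eq m n f g -> fermat_eq n m g f.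
Proof. intros H z a b Ha Hb. rewrite Cplus_comm. eapply H; eassumption. Qed.

Lemma fermat_finite (m n : nat) (f g : C -> option C) (z0 a : C) :
  (2 <= m)%nat -> (2 <= n)%nat -> meromorphic f -> meromorphic g -> fermat_eq m n f g ->
  f z0 = Some a -> exists b, g z0 = Some b.
Proof.
  intros hm hn hf hg hfg Ha. destruct (g z0) as [b|] eqn:E; [eauto|].
  destruct (fermat_poles n m g f z0 hn hm hg hf (fermat_eq_sym _ _ _ _ hfg) E) as (j & k & p & q & H).
  destruct H as (_ & _ & _ & _ & _ & _ & _ & H & _). congruence.
Qed.

Lemma fermat_derive (m n : nat) (f g : C -> option C) (z0 a b : C) :
  meromorphic f -> meromorphic g -> fermat_eq m n f g -> f z0 = Some a -> g z0 = Some b ->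
  (INR m * a ^ (m - 1) * C_derive (finite_part f) z0
   + INR n * b ^ (n - 1) * C_derive (finite_part g) z0)%C = 0%C.
Proof.
  intros hf hg hfg Ha Hb.
  destruct (regular_finite_part f z0 a hf Ha) as [HF HFn].
  destruct (regular_finite_part g z0 b hg Hb) as [HG HGn].
  assert (Ea : finite_part f z0 = a) by (unfold finite_part; rewrite Ha; reflexivity).
  assert (Eb : finite_part g z0 = b) by (unfold finite_part; rewrite Hb; reflexivity).
  eapply cdiff_unique.
  - rewrite <- Ea at 1. rewrite <- Eb at 1.
    apply (cdiff_plus (fun z => finite_part f z ^ m)%C (fun z => finite_part g z ^ n)%C);
      apply cdiff_pow, hol_cdiff; assumption.
  - apply (cdiff_near_ext (fun _ => RtoC 1)); [|apply cdiff_const].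
    generalize (near_and _ _ _ HFn HGn). apply near_imp. intros z [H1 H2]. symmetry.
    eapply hfg; eassumption.
Qed.

(** At such a point a^m = 1, and the differentiated equation m f^(m-1) f' + n g^(n-1) g' = 0 loses
    its second term because n >= 2. *)
Lemma fermat_zero (m n : nat) (f g : C -> option C) (z0 a : C) :
  (2 <= m)%nat -> (2 <= n)%nat ->
  meromorphic f -> meromorphic g -> fermat_eq m n f g -> f z0 = Some a -> g z0 = Some (RtoC 0) ->
  a <> 0%C /\ C_derive (finite_part f) z0 = 0%C.
Proof.
  intros hm hn hf hg hfg Ha Hg0.
  pose proof (fermat_derive m n f g z0 _ _ hf hg hfg Ha Hg0) as E.
  pose proof (hfg z0 _ _ Ha Hg0) as E1.
  destruct n as [|[|n]]; [lia|lia|]. replace (S (S n) - 1)%nat with (S n) in E by lia. simpl Cpow in E, E1.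
  assert (Ha0 : a <> 0%C).
  { intros ->. destruct m as [|m]; [lia|]. simpl in E1. apply (f_equal Re) in E1. unfold Re in E1. simpl in E1. lra. }
  split; [exact Ha0|].
  apply NNPP. intros HF. apply (Cmult_neq_0 (INR m * a ^ (m - 1)) (C_derive (finite_part f) z0)); [|exact HF|].
  - apply Cmult_neq_0; [apply INR_C_neq0; lia|apply Cpow_nz, Ha0].
  - rewrite <- E. ring.
Qed.

Lemma zero_of_order_intro (h : C -> option C) (z0 : C) (k : nat) (u : C -> C) :
  (1 <= k)%nat -> hol u z0 -> u z0 <> 0%C ->
  near z0 (fun z => h z = Some ((z - z0) ^ k * u z)%C) -> zero_of_order h z0 k.
Proof.
  intros Hk Hu Hu0 Hn. split; [exact Hk|]. exists u.
  split; [apply holomorphic_at_hol, Hu|]. split; [exact Hu0|]. apply near_locally, Hn.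
Qed.

Lemma zero_local_form (f : C -> option C) (z0 : C) :
  meromorphic f -> f z0 = Some (RtoC 0) ->
  near z0 (fun z => f z = Some (RtoC 0)) \/
  exists (k : nat) (u : C -> C), (1 <= k)%nat /\ hol u z0 /\ u z0 <> 0%C /\
    near z0 (fun z => f z = Some ((z - z0) ^ k * u z)%C) /\ zero_of_order f z0 k.
Proof.
  intros Hf H0. destruct (regular_finite_part f z0 _ Hf H0) as [HF Hn].
  destruct (hol_order _ z0 HF) as [Hz|(k & u & Hu & Hu0 & Hku)].
  - left. generalize (near_and _ _ _ Hn Hz). apply near_imp. intros z [-> ->]. reflexivity.
  - right. exists k, u.
    assert (Hk : (1 <= k)%nat).
    { destruct k as [|k]; [|lia]. exfalso. apply Hu0.
      pose proof (near_self _ _ Hku) as E. simpl in E. unfold finite_part in E. rewrite H0 in E.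
      rewrite E. ring. }
    assert (Hfu : near z0 (fun z => f z = Some ((z - z0) ^ k * u z)%C)).
    { generalize (near_and _ _ _ Hn Hku). apply near_imp. intros z [H1 H2]. congruence. }
    repeat (split; [assumption|]). eapply zero_of_order_intro; eassumption.
Qed.

(** The estimate is asked only off z0 because [Rpower 0 e] is 1, not 0. *)
Lemma continuous_power_bound (u : C -> R) (z0 : C) (K e : R) :
  0 < e -> u z0 = 0 -> (forall z, 0 <= u z) ->
  near z0 (fun z => z <> z0 -> u z <= K * Rpower (Cmod (z - z0)) e) -> continuous u z0.
Proof.
  intros He H0 Hu Hn. apply continuous_R_eps. intros eps Heps. rewrite H0.
  pose proof (Rabs_pos K) as HK.
  set (x := eps / (Rabs K + 1)).
  assert (Hx : 0 < x) by (apply Rdiv_lt_0_compat; lra).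
  assert (Hr : near z0 (fun z => Cmod (z - z0) < Rpower x (/ e))).
  { exists (Rpower x (/ e)). split; [apply exp_pos|auto]. }
  generalize (near_and _ _ _ Hn Hr). apply near_imp. intros z [H1 H2].
  rewrite -> Rminus_0_r, Rabs_right by (apply Rle_ge, Hu).
  destruct (Ceq_dec z z0) as [->|Hz]; [rewrite H0; exact Heps|].
  specialize (H1 Hz).
  assert (Hd : 0 < Cmod (z - z0)) by (apply Cmod_gt_0, Cminus_eq_contra, Hz).
  assert (H3 : Rpower (Cmod (z - z0)) e < x).
  { replace x with (Rpower (Rpower x (/ e)) e).
    - apply Rlt_Rpower_l; [exact He|]. split; assumption.
    - rewrite -> Rpower_mult, Rinv_l by lra. apply Rpower_1, Hx. }
  assert (Hp : 0 < Rpower (Cmod (z - z0)) e) by apply exp_pos.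
  assert (H4 : x * (Rabs K + 1) = eps) by (unfold x; field; lra).
  pose proof (Rle_abs K). nra.
Qed.

Lemma Rpower_nat_neg (x : R) (k : nat) : 0 < x -> / x ^ k = Rpower x (- INR k).
Proof. intros Hx. rewrite -> Rpower_Ropp, Rpower_pow by exact Hx. reflexivity. Qed.

Lemma Rpower_le_neg (x y e : R) : 0 < x -> x <= y -> 0 <= e -> Rpower y (- e) <= Rpower x (- e).
Proof.
  intros Hx Hxy He. rewrite !Rpower_Ropp. apply Rinv_le_contravar; [apply exp_pos|].
  apply Rle_Rpower_l; [exact He|]. split; assumption.
Qed.

(** Where g = (z - z0)^k v one has g' = (z - z0)^(k-1) [zero_num], and where f = p / (z - z0)^j one
    has f' = [pole_num] / (z - z0)^(j+1). For k, j >= 1 and v, p nonzero at z0 both factors are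
    nonzero there, which exhibits the exact order of the derivative. *)
Definition zero_num (k : nat) (v : C -> C) (z0 z : C) : C := (INR k * v z + (z - z0) * C_derive v z)%C.

Definition pole_num (j : nat) (p : C -> C) (z0 z : C) : C := (C_derive p z * (z - z0) - INR j * p z)%C.

Lemma hol_zero_num (k : nat) (v : C -> C) (z0 : C) : hol v z0 -> hol (zero_num k v z0) z0.
Proof.
  intros Hv. apply (hol_plus (fun z => INR k * v z)%C (fun z => (z - z0) * C_derive v z)%C).
  - apply hol_mult; [apply hol_const|exact Hv].
  - apply hol_mult; [|apply hol_C_derive, Hv].
    apply hol_minus; [apply hol_id|apply hol_const].
Qed.

Lemma continuous_pole_num (j : nat) (p : C -> C) (z0 : C) : hol p z0 -> continuous (pole_num j p z0) z0.
Proof.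
  intros Hp. apply continuous_Cminus.
  - apply continuous_Cmult; [apply hol_continuous, hol_C_derive, Hp|].
    apply continuous_Cminus; [apply continuous_id|apply continuous_const].
  - apply continuous_Cmult; [apply continuous_const|apply hol_continuous, Hp].
Qed.

Lemma zero_num_neq0 (k : nat) (v : C -> C) (z0 : C) :
  (1 <= k)%nat -> v z0 <> 0%C -> zero_num k v z0 z0 <> 0%C.
Proof.
  intros Hk Hv. unfold zero_num.
  replace (INR k * v z0 + (z0 - z0) * C_derive v z0)%C with (INR k * v z0)%C by ring.
  apply Cmult_neq_0; [apply INR_C_neq0, Hk|exact Hv].
Qed.

Lemma pole_num_neq0 (j : nat) (p : C -> C) (z0 : C) :
  (1 <= j)%nat -> p z0 <> 0%C -> pole_num j p z0 z0 <> 0%C.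
Proof.
  intros Hj Hp. unfold pole_num.
  replace (C_derive p z0 * (z0 - z0) - INR j * p z0)%C with (- INR j * p z0)%C by ring.
  apply Cmult_neq_0; [|exact Hp]. intros E. apply (INR_C_neq0 j Hj).
  replace (RtoC (INR j)) with (- - INR j)%C by ring. rewrite E. ring.
Qed.

Lemma zero_derive (g : C -> option C) (z0 : C) (k : nat) (v : C -> C) :
  (1 <= k)%nat -> hol v z0 -> near z0 (fun z => g z = Some ((z - z0) ^ k * v z)%C) ->
  near z0 (fun z => C_derive (finite_part g) z = ((z - z0) ^ (k - 1) * zero_num k v z0 z)%C).
Proof.
  intros Hk Hv Hg. generalize (near_and _ _ _ (near_near _ _ Hg) Hv). apply near_imp. intros z [H1 H2].
  apply cdiff_C_derive. apply (cdiff_near_ext (fun w => (w - z0) ^ k * v w)%C).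
  - revert H1. apply near_imp. intros w Hw. symmetry. apply finite_part_eq, Hw.
  - replace ((z - z0) ^ (k - 1) * zero_num k v z0 z)%C
      with (INR k * (z - z0) ^ (k - 1) * (1 - 0) * v z + (z - z0) ^ k * C_derive v z)%C.
    + apply cdiff_mult; [|exact H2]. apply (cdiff_pow (fun w => w - z0)%C).
      apply cdiff_minus; [apply cdiff_id|apply cdiff_const].
    + unfold zero_num. destruct k as [|k']; [lia|]. replace (S k' - 1)%nat with k' by lia. simpl. ring.
Qed.

Lemma pole_derive (f : C -> option C) (z0 : C) (j : nat) (p : C -> C) :
  (1 <= j)%nat -> hol p z0 -> near z0 (fun z => z <> z0 -> f z = Some (p z / (z - z0) ^ j)%C) ->
  near z0 (fun z => z <> z0 -> C_derive (finite_part f) z = (pole_num j p z0 z / (z - z0) ^ S j)%C).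
Proof.
  intros Hj Hp Hf. generalize (near_and _ _ _ (near_near _ _ Hf) Hp). apply near_imp. intros z [H1 H6] Hz.
  assert (Hd : (z - z0)%C <> 0%C) by (apply Cminus_eq_contra, Hz).
  apply cdiff_C_derive. apply (cdiff_near_ext (fun w => p w / (w - z0) ^ j)%C).
  - assert (Hw0 : near z (fun w => (w - z0)%C <> 0%C)).
    { apply (near_neq0 (fun w => w - z0)%C); [|exact Hd].
      apply continuous_Cminus; [apply continuous_id|apply continuous_const]. }
    generalize (near_and _ _ _ Hw0 H1). apply near_imp. intros w [K1 K2].
    symmetry. apply finite_part_eq, K2. intros E. apply K1. rewrite E. ring.
  - replace (pole_num j p z0 z / (z - z0) ^ S j)%C
      with ((C_derive p z * (z - z0) ^ j - p z * (INR j * (z - z0) ^ (j - 1) * (1 - 0)))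
             / ((z - z0) ^ j * (z - z0) ^ j))%C.
    + apply cdiff_div; [exact H6| |apply Cpow_nz, Hd].
      apply (cdiff_pow (fun w => w - z0)%C).
      apply cdiff_minus; [apply cdiff_id|apply cdiff_const].
    + unfold pole_num. destruct j as [|j]; [lia|]. replace (S j - 1)%nat with j by lia.
      simpl Cpow. field. split; [apply Cpow_nz, Hd|exact Hd].
Qed.

(** * The pulled-back metric *)

(** Written as the exponential of functions of the squared moduli: the logarithm is a sum whose
    terms have the shape handled by [is_lap_comp]. *)
Definition weight (A B : R -> R) (a b : C) : R := exp (A (Cmod a ^ 2) + B (Cmod b ^ 2)).

(* The metric is cut off to 0 at the zeros of g, and also at those of f if [za]
   holds.  The cut-off matters only when the factor has no zero of finite order,
   or when the metric tends to 0 there anyway. *)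
Definition metric (za : Prop) (A B : R -> R) (f g : C -> option C) (z : C) : R :=
  match f z, g z with
  | Some a, Some b =>
      if excluded_middle_informative (b = RtoC 0 \/ (za /\ a = RtoC 0)) then 0
      else Cmod (C_derive (finite_part f) z) * weight A B a b
  | _, _ => 0
  end.

Lemma metric_ge0 (za : Prop) (A B : R -> R) (f g : C -> option C) (z : C) : 0 <= metric za A B f g z.
Proof.
  unfold metric. destruct (f z); [|lra]. destruct (g z); [|lra].
  destruct excluded_middle_informative; [lra|].
  apply Rmult_le_pos; [apply Cmod_ge_0|]. apply Rlt_le, exp_pos.
Qed.

Lemma metric_eq (za : Prop) (A B : R -> R) (f g : C -> option C) (z a b : C) :
  f z = Some a -> g z = Some b -> b <> 0%C -> (za -> a <> 0%C) ->
  metric za A B f g z = Cmod (C_derive (finite_part f) z) * weight A B a b.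
Proof.
  intros Ha Hb Hb0 Ha0. unfold metric. rewrite -> Ha, Hb.
  destruct excluded_middle_informative as [H|H]; [tauto|reflexivity].
Qed.

Lemma metric_eq0 (za : Prop) (A B : R -> R) (f g : C -> option C) (z a b : C) :
  f z = Some a -> g z = Some b -> b = 0%C \/ (za /\ a = 0%C) -> metric za A B f g z = 0.
Proof.
  intros Ha Hb H. unfold metric. rewrite -> Ha, Hb.
  destruct excluded_middle_informative; [reflexivity|tauto].
Qed.

Lemma metric_le (za : Prop) (A B : R -> R) (f g : C -> option C) (z a b : C) (X : R) :
  f z = Some a -> g z = Some b -> 0 <= X -> 
  (b <> 0%C -> (za -> a <> 0%C) -> Cmod (C_derive (finite_part f) z) * weight A B a b <= X) ->
  metric za A B f g z <= X.
Proof.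
  intros Ha Hb HX H. unfold metric. rewrite -> Ha, Hb.
  destruct excluded_middle_informative as [H0|H0]; [exact HX|]. apply H; tauto.
Qed.

(** With r = |z - z0|, f' is O(r^-(j+1)) and |g| is at least a constant times r^-k, so the metric is
    O(r^(eta k - j - 1)), a positive power of r. *)
Lemma metric_continuous_pole (m n : nat) (f g : C -> option C) (za : Prop) (A B : R -> R) (K eta : R) (z0 : C) :
  (2 <= m)%nat -> (2 <= n)%nat -> meromorphic f -> meromorphic g -> fermat_eq m n f g ->
  (forall a b, (a ^ m + b ^ n)%C = 1%C -> 2 <= Cmod b -> (za -> a <> 0%C) ->
     weight A B a b <= K * Rpower (Cmod b) (- eta)) ->
  (forall j k, (1 <= j)%nat -> (1 <= k)%nat -> (m * j = n * k)%nat -> INR j + 1 < eta * INR k) ->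
  f z0 = None -> continuous (metric za A B f g) z0.
Proof.
  intros hm hn hf hg hfg Hw Heta H0.
  destruct (fermat_poles m n f g z0 hm hn hf hg hfg H0)
    as (j & k & p & q & Hj & Hk & Hjk & Hp & Hq & Hp0 & Hq0 & Hg0 & Hfp & Hgq).
  specialize (Heta j k Hj Hk Hjk).
  assert (HJ : 1 <= INR j) by (change 1 with (INR 1); apply le_INR, Hj).
  assert (HKk : 1 <= INR k) by (change 1 with (INR 1); apply le_INR, Hk).
  assert (Heta0 : 0 < eta) by nra.
  pose proof (continuous_pole_num j p z0 Hp) as Hnum.
  set (num := pole_num j p z0) in *.
  set (M := Cmod (num z0) + 1). set (Q := Cmod (q z0) / 2).
  assert (HM0 : 0 < M) by (unfold M; pose proof (Cmod_ge_0 (num z0)); lra).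
  assert (HQ0 : 0 < Q) by (unfold Q; apply Cmod_gt_0 in Hq0; lra).
  apply (continuous_power_bound _ z0 (M * (Rabs K * Rpower Q (- eta))) (eta * INR k - (INR j + 1))).
  - lra.
  - unfold metric. rewrite H0. reflexivity.
  - apply metric_ge0.
  (* The radius Q / 2 ensures |g| >= Q / r >= 2, the range in which the bound on the weight is
     available. *)
  - assert (Hsmall : near z0 (fun z => Cmod (z - z0) < Rmin 1 (Q / 2))).
    { exists (Rmin 1 (Q / 2)). split; [apply Rmin_glb_lt; lra|auto]. }
    generalize (near_and _ _ _ (near_and _ _ _ Hfp Hgq)
      (near_and _ _ _ Hsmall (near_and _ _ _ (near_Cmod_le _ _ Hnum)
         (near_and _ _ _ (near_Cmod_ge _ _ (hol_continuous _ _ Hq) Hq0)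
            (pole_derive f z0 j p Hj Hp Hfp))))).
    apply near_imp. intros z ((Hfz & H2) & H3 & H4 & H5 & HF) Hz.
    assert (Hd : (z - z0)%C <> 0%C) by (apply Cminus_eq_contra, Hz).
    set (r := Cmod (z - z0)) in *. assert (Hr : 0 < r) by (apply Cmod_gt_0, Hd).
    assert (Hr1 : r < 1) by (eapply Rlt_le_trans; [exact H3|apply Rmin_l]).
    assert (Hr2 : r < Q / 2) by (eapply Rlt_le_trans; [exact H3|apply Rmin_r]).
    specialize (H2 Hz). specialize (Hfz Hz). fold num in HF.
    specialize (HF Hz).
    assert (Hgb : Q * Rpower r (- INR k) <= Cmod (q z / (z - z0) ^ k)%C).
    { rewrite -> Cmod_div, Cmod_pow by apply Cpow_nz, Hd. fold r.
      unfold Rdiv. rewrite -> Rpower_nat_neg by exact Hr.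
      apply Rmult_le_compat_r; [apply Rlt_le, exp_pos|exact H5]. }
    assert (Hrk : / r <= Rpower r (- INR k)).
    { rewrite <- Rpower_nat_neg by exact Hr. apply Rinv_le_contravar; [apply pow_lt, Hr|].
      destruct k as [|k]; [lia|]. simpl. assert (r ^ k <= 1 ^ k) by (apply pow_incr; lra).
      rewrite pow1 in H. nra. }
    assert (Hg2 : 2 <= Cmod (q z / (z - z0) ^ k)%C).
    { eapply Rle_trans; [|exact Hgb]. apply Rle_trans with (Q * / r); [|apply Rmult_le_compat_l; lra].
      apply (Rmult_le_reg_r r); [exact Hr|]. rewrite -> Rmult_assoc, Rinv_l by lra. lra. }
    apply (metric_le za A B f g z _ _ _ Hfz H2).
    { repeat apply Rmult_le_pos; try lra; try apply Rabs_pos; apply Rlt_le, exp_pos. }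
    intros _ Ha0. rewrite HF.
    assert (HW : weight A B (p z / (z - z0) ^ j)%C (q z / (z - z0) ^ k)%C
               <= Rabs K * (Rpower Q (- eta) * Rpower r (eta * INR k))).
    { eapply Rle_trans; [apply Hw; [eapply hfg; eassumption|exact Hg2|exact Ha0]|].
      eapply Rle_trans; [apply Rmult_le_compat_r; [apply Rlt_le, exp_pos|apply Rle_abs]|].
      apply Rmult_le_compat_l; [apply Rabs_pos|].
      eapply Rle_trans; [apply (Rpower_le_neg (Q * Rpower r (- INR k))); [|exact Hgb|lra]|].
      - apply Rmult_lt_0_compat; [exact HQ0|apply exp_pos].
      - rewrite <- Rpower_mult_distr; [|exact HQ0|apply exp_pos].
        rewrite Rpower_mult. replace (- INR k * - eta) with (eta * INR k) by ring. lra. }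
    assert (HD : Cmod (num z / (z - z0) ^ S j)%C <= M * Rpower r (- (INR j + 1))).
    { rewrite -> Cmod_div, Cmod_pow by apply Cpow_nz, Hd. fold r.
      unfold Rdiv. rewrite -> Rpower_nat_neg, S_INR by exact Hr.
      apply Rmult_le_compat_r; [apply Rlt_le, exp_pos|exact H4]. }
    eapply Rle_trans; [apply Rmult_le_compat; [apply Cmod_ge_0|apply Rlt_le, exp_pos|exact HD|exact HW]|].
    apply Req_le. unfold Rminus. rewrite Rpower_plus. ring.
Qed.

(** In f' the equation produces the factor g^(n-1) g'. The weight cancels |g|^(n-1) and leaves
    |g|^(-1/4), so with r = |z - z0| the metric is O(r^(k - 1 - k/4)); the exponent 3 k / 4 - 1 is
    positive exactly when k >= 2. *)
Lemma metric_continuous_zero (m n : nat) (f g : C -> option C) (za : Prop) (A B : R -> R) (K : R) (z0 : C)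
    (k : nat) (v : C -> C) (a0 : C) :
  (2 <= m)%nat -> (2 <= n)%nat -> meromorphic f -> meromorphic g -> fermat_eq m n f g ->
  (forall a b, (a ^ m + b ^ n)%C = 1%C -> b <> 0%C -> Cmod b <= 1 ->
     weight A B a b <= K * Rpower (Cmod b) (- (INR (n - 1) + 1 / 4))) ->
  f z0 = Some a0 -> g z0 = Some (RtoC 0) -> (2 <= k)%nat -> hol v z0 -> v z0 <> 0%C ->
  near z0 (fun z => g z = Some ((z - z0) ^ k * v z)%C) ->
  continuous (metric za A B f g) z0.
Proof.
  intros hm hn hf hg hfg Hw Hf0 Hg0 Hk Hv Hv0 Hgv.
  destruct (regular_finite_part f z0 _ hf Hf0) as [HF HFn].
  destruct (regular_finite_part g z0 _ hg Hg0) as [HG HGn].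
  set (F := finite_part f) in *. set (G := finite_part g) in *.
  assert (HF0 : F z0 <> 0%C).
  { unfold F. rewrite (finite_part_eq _ _ _ Hf0). eapply (fermat_zero m n f g); eassumption. }
  (* [f' = - (n g^(n-1) g') / (m f^(m-1))] and [g' = (z - z0)^(k-1) num] near the zero of [g] *)
  assert (Hk1 : (1 <= k)%nat) by lia.
  pose proof (hol_continuous _ _ (hol_zero_num k v z0 Hv)) as Hnum.
  pose proof (zero_derive g z0 k v Hk1 Hv Hgv) as HGd0.
  set (num := zero_num k v z0) in *.
  set (quo := fun z => (INR n * num z / (INR m * F z ^ (m - 1)))%C).
  assert (Hm0 : RtoC (INR m) <> 0%C) by (apply INR_C_neq0; lia).
  assert (Hquo : continuous quo z0).
  { apply continuous_Cmult; [apply continuous_Cmult; [apply continuous_const|exact Hnum]|].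
    apply continuous_Cinv.
    - apply continuous_Cmult; [apply continuous_const|]. apply continuous_Cpow, hol_continuous, HF.
    - apply Cmult_neq_0; [exact Hm0|apply Cpow_nz, HF0]. }
  set (M := Cmod (quo z0) + 1). set (Q := Cmod (v z0) / 2).
  assert (HM0 : 0 < M) by (unfold M; pose proof (Cmod_ge_0 (quo z0)); lra).
  assert (HQ0 : 0 < Q) by (unfold Q; apply Cmod_gt_0 in Hv0; lra).
  assert (HK2 : 2 <= INR k) by (change 2 with (INR 2); apply le_INR, Hk).
  apply (continuous_power_bound _ z0 (M * (Rabs K * Rpower Q (- (1 / 4)))) (3 / 4 * INR k - 1)).
  - lra.
  - apply (metric_eq0 _ _ _ _ _ _ _ _ Hf0 Hg0). left. reflexivity.
  - apply metric_ge0.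
  - assert (Hsmall : near z0 (fun z => Cmod (G z) <= 1)).
    { generalize (proj1 (continuous_C_eps G z0) (hol_continuous _ _ HG) 1 ltac:(lra)). apply near_imp.
      intros z Hz. unfold G in Hz at 2. rewrite (finite_part_eq _ _ _ Hg0) in Hz.
      replace (G z - 0)%C with (G z) in Hz by ring. lra. }
    generalize (near_and _ _ _ (near_and _ _ _ HFn (near_and _ _ _ HGn Hgv))
      (near_and _ _ _ Hsmall (near_and _ _ _ (near_Cmod_le _ _ Hquo)
         (near_and _ _ _ (near_Cmod_ge _ _ (hol_continuous _ _ Hv) Hv0)
           (near_and _ _ _ HGd0 (near_neq0 _ _ (hol_continuous _ _ HF) HF0)))))).
    apply near_imp. intros z ((H1 & Hgz & Hgz') & H3 & H4 & H5 & HGd & H7) Hz. fold G num in HGd.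
    assert (Hd : (z - z0)%C <> 0%C) by (apply Cminus_eq_contra, Hz).
    set (r := Cmod (z - z0)) in *. assert (Hr : 0 < r) by (apply Cmod_gt_0, Hd).
    assert (HGz : G z = ((z - z0) ^ k * v z)%C) by congruence.
    pose proof (fermat_derive m n f g z _ _ hf hg hfg H1 Hgz) as Hder. fold F G in Hder.
    assert (HFd : C_derive F z = (- (quo z * (z - z0) ^ (k - 1) * G z ^ (n - 1)))%C).
    { unfold quo. rewrite HGd in Hder.
      assert (Hmm : (INR m * F z ^ (m - 1))%C <> 0%C) by (apply Cmult_neq_0; [exact Hm0|apply Cpow_nz, H7]).
      assert (E : (INR m * F z ^ (m - 1) * C_derive F z)%C
                  = (- (INR n * G z ^ (n - 1) * ((z - z0) ^ (k - 1) * num z)))%C).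
      { apply Ceq_minus. rewrite <- Hder. ring. }
      replace (C_derive F z) with ((INR m * F z ^ (m - 1) * C_derive F z) / (INR m * F z ^ (m - 1)))%C.
      2:{ field. split; [apply Cpow_nz, H7|exact Hm0]. }
      rewrite E. field. split; [apply Cpow_nz, H7|exact Hm0]. }
    apply (metric_le za A B f g z _ _ _ H1 Hgz).
    { repeat apply Rmult_le_pos; try lra; try apply Rabs_pos; apply Rlt_le, exp_pos. }
    intros Hb0 _. fold F. rewrite HFd. fold G in Hb0. fold G.
    assert (HGp : 0 < Cmod (G z)) by (apply Cmod_gt_0, Hb0).
    assert (HGge : Q * r ^ k <= Cmod (G z)).
    { rewrite -> HGz, Cmod_mult, Cmod_pow. fold r. rewrite Rmult_comm.
      apply Rmult_le_compat_l; [apply pow_le; lra|exact H5]. }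
    specialize (Hw (F z) (G z) (hfg z _ _ H1 Hgz) Hb0 H3).
    rewrite -> Cmod_opp, !Cmod_mult, !Cmod_pow. fold r.
    rewrite -> Ropp_plus_distr, Rpower_plus, <- Rpower_nat_neg in Hw by exact HGp.
    assert (HGk : Rpower (Cmod (G z)) (- (1 / 4)) <= Rpower Q (- (1 / 4)) * Rpower r (- (INR k / 4))).
    { eapply Rle_trans; [apply (Rpower_le_neg (Q * r ^ k)); [|exact HGge|lra]|].
      - apply Rmult_lt_0_compat; [exact HQ0|apply pow_lt, Hr].
      - rewrite <- Rpower_mult_distr; [|exact HQ0|apply pow_lt, Hr].
        rewrite <- Rpower_pow by exact Hr. rewrite Rpower_mult.
        replace (INR k * - (1 / 4)) with (- (INR k / 4)) by field. lra. }
    assert (Hgn : 0 < Cmod (G z) ^ (n - 1)) by (apply pow_lt, HGp).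
    assert (HW : Cmod (G z) ^ (n - 1) * weight A B (F z) (G z)
                 <= Rabs K * (Rpower Q (- (1 / 4)) * Rpower r (- (INR k / 4)))).
    { apply Rle_trans with (Rabs K * Rpower (Cmod (G z)) (- (1 / 4))).
      - apply (Rmult_le_compat_l (Cmod (G z) ^ (n - 1))) in Hw; [|lra].
        eapply Rle_trans; [exact Hw|].
        replace (Cmod (G z) ^ (n - 1) * (K * (/ Cmod (G z) ^ (n - 1) * Rpower (Cmod (G z)) (- (1 / 4)))))
          with (K * Rpower (Cmod (G z)) (- (1 / 4))).
        2:{ generalize (Rpower (Cmod (G z)) (- (1 / 4))). intros X. field. lra. }
        apply Rmult_le_compat_r; [apply Rlt_le, exp_pos|apply Rle_abs].
      - apply Rmult_le_compat_l; [apply Rabs_pos|exact HGk]. }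
    assert (Hrk : r ^ (k - 1) = Rpower r (INR k - 1)).
    { rewrite <- Rpower_pow by exact Hr. f_equal. rewrite minus_INR; [reflexivity|lia]. }
    apply Rle_trans with (M * Rpower r (INR k - 1) * (Rabs K * (Rpower Q (- (1 / 4)) * Rpower r (- (INR k / 4))))).
    + rewrite -> Rmult_assoc. apply Rmult_le_compat.
      * apply Rmult_le_pos; [apply Cmod_ge_0|apply pow_le; lra].
      * apply Rmult_le_pos; [lra|apply Rlt_le, exp_pos].
      * rewrite Hrk. apply Rmult_le_compat_r; [apply Rlt_le, exp_pos|exact H4].
      * exact HW.
    + apply Req_le. replace (3 / 4 * INR k - 1) with ((INR k - 1) + (- (INR k / 4))) by field.
      rewrite Rpower_plus. ring.
Qed.

Lemma near_prop_imp (z0 : C) (X : Prop) (P : C -> Prop) :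
  (X -> near z0 P) -> near z0 (fun z => X -> P z).
Proof.
  intros H. destruct (classic X) as [HX|HX].
  - generalize (H HX). apply near_imp. auto.
  - exists 1. split; [lra|]. tauto.
Qed.

Lemma near_C_derive_eq0 (f : C -> C) (z0 a : C) :
  near z0 (fun z => f z = a) -> C_derive f z0 = 0%C.
Proof.
  intros H. apply cdiff_C_derive. apply (cdiff_near_ext (fun _ => a)); [|apply cdiff_const].
  revert H. apply near_imp. auto.
Qed.

(** For tau = ln, tau'(p) + p tau''(p) = 1 / p - p / p^2 = 0. *)
Lemma is_lap_ln_Cmod (F : C -> C) (z0 : C) :
  hol F z0 -> F z0 <> 0%C -> is_lap (fun z => ln (Cmod (F z) ^ 2)) z0 0.
Proof.
  intros HF H0.
  assert (Hp : 0 < Cmod (F z0) ^ 2) by (apply pow_lt, Cmod_gt_0, H0).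
  replace 0 with (4 * Cmod (C_derive F z0) ^ 2 *
    (/ Cmod (F z0) ^ 2 + Cmod (F z0) ^ 2 * (- / (Cmod (F z0) ^ 2) ^ 2))).
  - apply (is_lap_comp ln Rinv); [exact HF|apply hol_C_derive, HF| |].
    + generalize (near_neq0 _ _ (hol_continuous _ _ HF) H0). apply near_imp. intros z Hz.
      assert (0 < Cmod (F z) ^ 2) by (apply pow_lt, Cmod_gt_0, Hz).
      apply is_derive_Reals, derivable_pt_lim_ln. assumption.
    + revert Hp. generalize (Cmod (F z0) ^ 2). intros p Hp. auto_derive; [lra|]. field. lra.
  - field. apply Rgt_not_eq, Cmod_gt_0, H0.
Qed.

(** Expresses |g'|^2 through |f'|^2, so that the Laplacians of the two parts of the weight share the
    factor |f'|^2. *)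
Lemma fermat_derive_Cmod (m n : nat) (f g : C -> option C) (z0 a b : C) :
  (1 <= m)%nat -> (1 <= n)%nat ->
  meromorphic f -> meromorphic g -> fermat_eq m n f g -> f z0 = Some a -> g z0 = Some b -> b <> 0%C ->
  Cmod (C_derive (finite_part g) z0) ^ 2
  = Cmod (C_derive (finite_part f) z0) ^ 2
    * ((INR m / INR n) ^ 2 * (Cmod a ^ 2) ^ (m - 1) / (Cmod b ^ 2) ^ (n - 1)).
Proof.
  intros hm hn hf hg hfg Ha Hb Hb0.
  pose proof (fermat_derive m n f g z0 a b hf hg hfg Ha Hb) as E.
  set (F1 := C_derive (finite_part f) z0) in *. set (G1 := C_derive (finite_part g) z0) in *.
  assert (Hn0 : 0 < INR n) by (apply lt_0_INR; lia).
  assert (Hm0 : 0 < INR m) by (apply lt_0_INR; lia).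
  assert (Hbp : 0 < Cmod b ^ (n - 1)) by (apply pow_lt, Cmod_gt_0, Hb0).
  assert (E2 : INR n * Cmod b ^ (n - 1) * Cmod G1 = INR m * Cmod a ^ (m - 1) * Cmod F1).
  { rewrite <- (Rabs_right (INR n)), <- (Rabs_right (INR m)) by lra.
    rewrite <- !Cmod_R, <- !Cmod_pow, <- !Cmod_mult. rewrite <- (Cmod_opp (_ * F1)).
    f_equal. apply Ceq_minus. rewrite <- E. ring. }
  rewrite <- !pow_mult, (Nat.mul_comm 2 (m - 1)), (Nat.mul_comm 2 (n - 1)), !pow_mult.
  replace (Cmod G1) with (INR m * Cmod a ^ (m - 1) * Cmod F1 / (INR n * Cmod b ^ (n - 1))).
  - generalize dependent (Cmod b ^ (n - 1)). intros y Hy _. generalize (Cmod a ^ (m - 1)). intros x. field. lra.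
  - rewrite <- E2. field. lra.
Qed.

(** Besides continuity it provides the formula free of case distinctions near z0, from which the
    Laplacian is computed. *)
Lemma metric_continuous_regular (f g : C -> option C) (za : Prop) (A A1 B B1 : R -> R) (z0 a b : C) :
  meromorphic f -> meromorphic g ->
  (forall p, 0 <= p -> (za -> 0 < p) -> is_derive A p (A1 p)) ->
  (forall q, 0 < q -> is_derive B q (B1 q)) ->
  f z0 = Some a -> g z0 = Some b -> b <> 0%C -> (za -> a <> 0%C) ->
  near z0 (fun z => metric za A B f g z
    = Cmod (C_derive (finite_part f) z) * weight A B (finite_part f z) (finite_part g z)) /\
  continuous (metric za A B f g) z0.
Proof.
  intros hf hg HA HB Ha Hb Hb0 Ha0.
  destruct (regular_finite_part f z0 _ hf Ha) as [HF HFn].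
  destruct (regular_finite_part g z0 _ hg Hb) as [HG HGn].
  assert (Ea := finite_part_eq _ _ _ Ha). assert (Eb := finite_part_eq _ _ _ Hb).
  assert (Hn : near z0 (fun z => metric za A B f g z
    = Cmod (C_derive (finite_part f) z) * weight A B (finite_part f z) (finite_part g z))).
  { assert (N1 : near z0 (fun z => finite_part g z <> 0%C)).
    { apply near_neq0; [apply hol_continuous, HG|]. congruence. }
    assert (N2 : near z0 (fun z => za -> finite_part f z <> 0%C)).
    { apply near_prop_imp. intros Hza. apply near_neq0; [apply hol_continuous, HF|]. rewrite Ea. auto. }
    generalize (near_and _ _ _ (near_and _ _ _ HFn HGn) (near_and _ _ _ N1 N2)). apply near_imp.
    intros z ((H1 & H2) & H3 & H4). apply metric_eq; assumption. }
  split; [exact Hn|].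
  eapply continuous_near_ext; [eapply near_imp; [|exact Hn]; simpl; intros z Hz; symmetry; exact Hz|].
  assert (Hsq : forall (h : C -> C), hol h z0 -> continuous (fun z => Cmod (h z) ^ 2) z0).
  { intros h Hh. apply (continuous_comp (fun z => Cmod (h z)) (fun x => x ^ 2)).
    - apply (continuous_comp h Cmod); [apply hol_continuous, Hh|apply continuous_Cmod].
    - apply: ex_derive_continuous. auto_derive. exact I. }
  apply: continuous_mult.
  - apply (continuous_comp (C_derive (finite_part f)) Cmod); [|apply continuous_Cmod].
    apply hol_continuous, hol_C_derive, HF.
  - unfold weight. apply (continuous_comp (fun z => A (Cmod (finite_part f z) ^ 2) + B (Cmod (finite_part g z) ^ 2)) exp).
    + apply: continuous_plus.
      * apply (continuous_comp (fun z => Cmod (finite_part f z) ^ 2) A); [apply Hsq, HF|].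
        apply: ex_derive_continuous. eexists. apply HA; rewrite Ea.
        -- apply pow_le, Cmod_ge_0.
        -- intros Hza. apply pow_lt, Cmod_gt_0, Ha0, Hza.
      * apply (continuous_comp (fun z => Cmod (finite_part g z) ^ 2) B); [apply Hsq, HG|].
        apply: ex_derive_continuous. eexists. apply HB; rewrite Eb. apply pow_lt, Cmod_gt_0, Hb0.
    + apply continuous_exp.
Qed.

(* The inequalities ask, in this order, that the metric weight^2 |da|^2 have
   curvature bounded above by a negative constant on the affine curve
   a^m + b^n = 1, and that the pulled-back metric tend to 0 at poles of f of
   order j (where g has a pole of order k = m j / n) and at zeros of g. *)
Lemma fermat_derive_eq0 (m n : nat) (f g : C -> option C) (za : Prop)
    (A A1 A2 B B1 B2 : R -> R) (c K eta : R) :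
  (2 <= m)%nat -> (2 <= n)%nat -> meromorphic f -> meromorphic g -> fermat_eq m n f g -> 0 < c ->
  (forall p, 0 <= p -> (za -> 0 < p) -> is_derive A p (A1 p) /\ is_derive A1 p (A2 p)) ->
  (forall q, 0 < q -> is_derive B q (B1 q) /\ is_derive B1 q (B2 q)) ->
  (forall a b : C, (a ^ m + b ^ n)%C = 1%C -> b <> 0%C -> (za -> a <> 0%C) ->
     c * weight A B a b ^ 2 <=
       (A1 (Cmod a ^ 2) + Cmod a ^ 2 * A2 (Cmod a ^ 2))
       + (INR m / INR n) ^ 2 * (Cmod a ^ 2) ^ (m - 1) / (Cmod b ^ 2) ^ (n - 1)
         * (B1 (Cmod b ^ 2) + Cmod b ^ 2 * B2 (Cmod b ^ 2))) ->
  (forall a b : C, (a ^ m + b ^ n)%C = 1%C -> 2 <= Cmod b -> (za -> a <> 0%C) ->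
     weight A B a b <= K * Rpower (Cmod b) (- eta)) ->
  (forall j k, (1 <= j)%nat -> (1 <= k)%nat -> (m * j = n * k)%nat -> INR j + 1 < eta * INR k) ->
  (za -> forall z k, ~ zero_of_order f z k) ->
  (forall z k, zero_of_order g z k ->
     (2 <= k)%nat /\
     (forall a b : C, (a ^ m + b ^ n)%C = 1%C -> b <> 0%C -> Cmod b <= 1 ->
        weight A B a b <= K * Rpower (Cmod b) (- (INR (n - 1) + 1 / 4)))) ->
  forall z a, f z = Some a -> C_derive (finite_part f) z = 0%C.
Proof.
  intros hm hn hf hg hfg Hc HA HB Hcurv Hpole Heta Hzf Hzg.
  assert (Hcont : forall z, continuous (metric za A B f g) z).
  { intros z0. destruct (f z0) as [a|] eqn:Ha.
    2:{ exact (metric_continuous_pole m n f g za A B K eta z0 hm hn hf hg hfg Hpole Heta Ha). }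
    destruct (fermat_finite m n f g z0 a hm hn hf hg hfg Ha) as [b Hb].
    destruct (Ceq_dec b 0) as [->|Hb0].
    (* Where g vanishes identically near z0 there is no order to use, but the cut-off makes the
       metric 0 nearby. *)
    { destruct (zero_local_form g z0 hg Hb) as [H|(k & v & Hk & Hv & Hv0 & Hn & Ho)].
      - apply (continuous_near_ext _ (fun _ => 0)); [|apply continuous_const].
        destruct (regular_finite_part f z0 _ hf Ha) as [_ HFn].
        generalize (near_and _ _ _ H HFn). apply near_imp. intros z [H1 H2]. symmetry.
        apply (metric_eq0 _ _ _ _ _ _ _ _ H2 H1). left. reflexivity.
      - destruct (Hzg z0 k Ho) as [Hk2 Hw].
        eapply (metric_continuous_zero m n); eassumption. }
    destruct (classic (za /\ a = 0%C)) as [[Hza ->]|Hna].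
    { destruct (zero_local_form f z0 hf Ha) as [H|(k & v & Hk & Hv & Hv0 & Hn & Ho)].
      - apply (continuous_near_ext _ (fun _ => 0)); [|apply continuous_const].
        destruct (regular_finite_part g z0 _ hg Hb) as [_ HGn].
        generalize (near_and _ _ _ H HGn). apply near_imp. intros z [H1 H2]. symmetry.
        apply (metric_eq0 _ _ _ _ _ _ _ _ H1 H2). right. split; [exact Hza|reflexivity].
      - exfalso. exact (Hzf Hza z0 k Ho). }
    eapply (metric_continuous_regular f g za A A1 B B1 z0 a b); try eassumption.
    - intros p Hp1 Hp2. apply HA; assumption.
    - intros q Hq. apply HB; assumption.
    - tauto. }
  assert (Hle : forall z, metric za A B f g z <= 0).
  (* The 4 comes from [is_lap_comp], whose Laplacians carry the factor 4 |F'|^2. *)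
  { apply (ahlfors _ (4 * c)); [lra|exact Hcont|].
    intros z0 Hpos.
    assert (Hex : exists a b, f z0 = Some a /\ g z0 = Some b /\ b <> 0%C /\ (za -> a <> 0%C)).
    { unfold metric in Hpos. destruct (f z0) as [a|]; [|lra]. destruct (g z0) as [b|]; [|lra].
      destruct excluded_middle_informative as [H|H]; [lra|]. exists a, b. tauto. }
    destruct Hex as (a & b & Ha & Hb & Hb0 & Ha0).
    destruct (regular_finite_part f z0 _ hf Ha) as [HF HFn].
    destruct (regular_finite_part g z0 _ hg Hb) as [HG HGn].
    assert (Ea := finite_part_eq _ _ _ Ha). assert (Eb := finite_part_eq _ _ _ Hb).
    destruct (metric_continuous_regular f g za A A1 B B1 z0 a b) as [Hn _]; try assumption.
    { intros p Hp1 Hp2. apply HA; assumption. }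
    { intros q Hq. apply HB; assumption. }
    pose proof (near_self _ _ Hn) as Hn0. simpl in Hn0. rewrite -> Ea, Eb in Hn0.
    assert (HF1 : C_derive (finite_part f) z0 <> 0%C).
    { intros E. rewrite -> Hn0, E, Cmod_0, Rmult_0_l in Hpos. lra. }
    pose proof (hol_C_derive _ _ HF) as HFd. pose proof (hol_C_derive _ _ HG) as HGd.
    assert (Hbp : 0 < Cmod b ^ 2) by (apply pow_lt, Cmod_gt_0, Hb0).
    assert (Hap : 0 <= Cmod a ^ 2) by (apply pow_le, Cmod_ge_0).
    assert (Hapz : za -> 0 < Cmod a ^ 2) by (intros Hza; apply pow_lt, Cmod_gt_0, Ha0, Hza).
    assert (LA : is_lap (fun z => A (Cmod (finite_part f z) ^ 2)) z0
      (4 * Cmod (C_derive (finite_part f) z0) ^ 2 * (A1 (Cmod a ^ 2) + Cmod a ^ 2 * A2 (Cmod a ^ 2)))).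
    { rewrite <- Ea. apply is_lap_comp; try assumption.
      - assert (N2 : near z0 (fun z => za -> finite_part f z <> 0%C)).
        { apply near_prop_imp. intros Hza. apply near_neq0; [apply hol_continuous, HF|]. rewrite Ea. auto. }
        revert N2. apply near_imp. intros z Hz. apply HA; [apply pow_le, Cmod_ge_0|].
        intros Hza. apply pow_lt, Cmod_gt_0, Hz, Hza.
      - rewrite Ea. apply HA; assumption. }
    assert (LB : is_lap (fun z => B (Cmod (finite_part g z) ^ 2)) z0
      (4 * Cmod (C_derive (finite_part g) z0) ^ 2 * (B1 (Cmod b ^ 2) + Cmod b ^ 2 * B2 (Cmod b ^ 2)))).
    { rewrite <- Eb. apply is_lap_comp; try assumption.
      - assert (N1 : near z0 (fun z => finite_part g z <> 0%C)).
        { apply near_neq0; [apply hol_continuous, HG|]. congruence. }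
        revert N1. apply near_imp. intros z Hz. apply HB. apply pow_lt, Cmod_gt_0, Hz.
      - rewrite Eb. apply HB; assumption. }
    (* Half of ln |f'|^2 is ln |f'|, harmonic where f' <> 0; the curvature comes from A and B
       alone. *)
    pose proof (is_lap_scal (1 / 2) _ _ _ (is_lap_ln_Cmod _ _ HFd HF1)) as LF.
    pose proof (is_lap_plus _ _ _ _ _ LF (is_lap_plus _ _ _ _ _ LA LB)) as L.
    eexists. split.
    - eapply is_lap_near_ext; [|exact L].
      generalize (near_and _ _ _ Hn (near_neq0 _ _ (hol_continuous _ _ HFd) HF1)). apply near_imp.
      intros z [H1 H2]. rewrite H1.
      assert (Hd : 0 < Cmod (C_derive (finite_part f) z)) by (apply Cmod_gt_0, H2).
      unfold weight. rewrite -> ln_mult, ln_exp by (exact Hd || apply exp_pos).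
      rewrite -> ln_pow by exact Hd. simpl INR. field.
    - rewrite Hn0. rewrite (fermat_derive_Cmod m n f g z0 a b); try assumption; try lia.
      specialize (Hcurv a b (hfg z0 a b Ha Hb) Hb0 Ha0).
      set (D := Cmod (C_derive (finite_part f) z0) ^ 2).
      assert (HD : 0 <= 4 * D) by (unfold D; apply Rmult_le_pos; [lra|apply pow_le, Cmod_ge_0]).
      apply (Rmult_le_compat_l (4 * D)) in Hcurv; [|exact HD].
      rewrite Rpow_mult_distr. fold D.
      match goal with |- ?x <= ?y => replace x with (4 * D * (c * weight A B a b ^ 2)) by ring end.
      eapply Rle_trans; [exact Hcurv|]. apply Req_le. unfold Rdiv. ring. }
  (* Off the cut-off the weight is positive, so a vanishing metric means f' = 0. At zeros of g the
     equation gives f' = 0 directly, and at a zero of f that is cut off, f vanishes identically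
     nearby. *)
  intros z a Ha. destruct (fermat_finite m n f g z a hm hn hf hg hfg Ha) as [b Hb].
  destruct (Ceq_dec b 0) as [->|Hb0].
  { eapply (fermat_zero m n f g); eassumption. }
  destruct (classic (za /\ a = 0%C)) as [[Hza ->]|Hna].
  { destruct (zero_local_form f z hf Ha) as [H|(k & v & Hk & Hv & Hv0 & Hn & Ho)].
    - apply (near_C_derive_eq0 _ _ 0). revert H. apply near_imp. intros w Hw. apply finite_part_eq, Hw.
    - exfalso. exact (Hzf Hza z k Ho). }
  specialize (Hle z). rewrite (metric_eq za A B f g z a b Ha Hb Hb0) in Hle; [|tauto].
  apply Cmod_eq_0. pose proof (Cmod_ge_0 (C_derive (finite_part f) z)).
  assert (0 < weight A B a b) by apply exp_pos. nra.
Qed.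

(** * Constancy from a vanishing derivative *)

Lemma cdiff0_constant (F : C -> C) : (forall z, cdiff F z 0) -> forall z, F z = F 0%C.
Proof.
  intros HF z. destruct (Ceq_dec z 0) as [->|Hz]; [reflexivity|].
  assert (Hm : 0 < Cmod z) by (apply Cmod_gt_0, Hz).
  set (r := Cmod z) in *. set (e := (z / r)%C).
  assert (Hr0 : RtoC r <> 0%C) by (intros E; apply (f_equal Re) in E; unfold Re in E; simpl in E; lra).
  assert (He : Cmod e = 1).
  { unfold e. rewrite -> Cmod_div, Cmod_R, Rabs_right by (lra || exact Hr0). fold r. field. lra. }
  assert (Hc : forall g : C -> R, (forall t : R, is_derive (fun s : R => g (F (0 + e * s)%C)) t 0) ->
            g (F z) = g (F 0%C)).
  { intros g Hg. symmetry.
    replace z with (0 + e * r)%C by (unfold e; field; exact Hr0).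
    replace (F 0%C) with (F (0 + e * 0)%C) by (f_equal; ring).
    apply (eq_is_derive (fun s : R => g (F (0 + e * s)%C)) 0 r); [|exact Hm]. intros t _. apply Hg. }
  apply injective_projections.
  - apply (Hc Re). intros t. destruct (is_derive_line F 0 e 0 t He (HF _)) as [H _].
    replace (Re (e * 0)) with 0 in H by (unfold Re; simpl; ring). exact H.
  - apply (Hc Im). intros t. destruct (is_derive_line F 0 e 0 t He (HF _)) as [_ H].
    replace (Im (e * 0)) with 0 in H by (unfold Im; simpl; ring). exact H.
Qed.

(** At a pole of order j, f' = [pole_num] / (z - z0)^(j+1), and [pole_num] has the nonzero value - j
    p(z0) at z0. So f' = 0 rules out poles, and f is entire with derivative 0. *)
Lemma meromorphic_derive0_constant (f : C -> option C) :
  meromorphic f -> (forall z a, f z = Some a -> C_derive (finite_part f) z = 0%C) -> is_constant f.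
Proof.
  intros hf H.
  assert (Hfin : forall z, f z = Some (finite_part f z)).
  { intros z0. unfold finite_part. destruct (f z0) as [a|] eqn:E; [reflexivity|]. exfalso.
    destruct (pole_local_form f z0 hf E) as (j & p & Hj & Hp & Hp0 & Hn).
    apply (pole_num_neq0 j p z0 Hj Hp0).
    apply continuous_eq0_of_punctured; [apply continuous_pole_num, Hp|].
    generalize (near_and _ _ _ Hn (pole_derive f z0 j p Hj Hp Hn)). apply near_imp. intros z [H1 H2] Hz.
    assert (Hd : ((z - z0) ^ S j)%C <> 0%C) by apply Cpow_nz, Cminus_eq_contra, Hz.
    specialize (H2 Hz). rewrite (H z _ (H1 Hz)) in H2.
    replace (pole_num j p z0 z) with (pole_num j p z0 z / (z - z0) ^ S j * (z - z0) ^ S j)%C by (field; exact Hd).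
    rewrite <- H2. ring. }
  exists (finite_part f 0%C). intros z. rewrite Hfin. f_equal. apply cdiff0_constant.
  intros w. rewrite <- (H w _ (Hfin w)). apply hol_cdiff. eapply regular_finite_part; eauto.
Qed.

Lemma fermat_constant (m n : nat) (f g : C -> option C) :
  (2 <= m)%nat -> (2 <= n)%nat -> meromorphic f -> meromorphic g -> fermat_eq m n f g ->
  (forall z a, f z = Some a -> C_derive (finite_part f) z = 0%C) -> is_constant f /\ is_constant g.
Proof.
  intros hm hn hf hg hfg H.
  assert (Hf : is_constant f) by (apply meromorphic_derive0_constant; assumption).
  split; [exact Hf|]. destruct Hf as [c Hc].
  apply meromorphic_derive0_constant; [exact hg|]. intros z b Hb.
  destruct (Ceq_dec b 0) as [->|Hb0].
  (* One zero of g forces c^m = 1, hence g^n = 0 wherever g is finite. *)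
  - apply (near_C_derive_eq0 _ _ 0). destruct (regular_finite_part g z _ hg Hb) as [_ Hn].
    revert Hn. apply near_imp. intros w Hw. apply NNPP. intros Hw0.
    apply (Cpow_nz (finite_part g w) n Hw0).
    pose proof (hfg w _ _ (Hc w) Hw) as E1. pose proof (hfg z _ _ (Hc z) Hb) as E2.
    rewrite <- E1 in E2. destruct n as [|n]; [lia|].
    replace (finite_part g w ^ S n)%C with (c ^ m + finite_part g w ^ S n - c ^ m)%C by ring.
    rewrite <- E2. simpl. ring.
  - pose proof (fermat_derive m n f g z _ _ hf hg hfg (Hc z) Hb) as E. rewrite (H z _ (Hc z)) in E.
    apply NNPP. intros HG. apply (Cmult_neq_0 (INR n * b ^ (n - 1)) (C_derive (finite_part g) z)); [|exact HG|].
    + apply Cmult_neq_0; [apply INR_C_neq0; lia|apply Cpow_nz, Hb0].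
    + rewrite <- E. ring.
Qed.

(** * Logarithms of the weights and moduli on the Fermat curve *)

(* p^al is written exp (al ln p). *)
Definition logw (k b al p : R) : R := - k * ln p + b * ln (1 + exp (al * ln p)).

Definition logw1 (k b al p : R) : R := (- k + b * al * (1 - / (1 + exp (al * ln p)))) / p.

Definition logw2 (k b al p : R) : R :=
  (b * al ^ 2 * exp (al * ln p) / (1 + exp (al * ln p)) ^ 2 / p - logw1 k b al p) / p.

Lemma is_derive_logw (k b al p : R) : 0 < p ->
  is_derive (logw k b al) p (logw1 k b al p) /\ is_derive (logw1 k b al) p (logw2 k b al p).
Proof.
  intros Hp. pose proof (exp_pos (al * ln p)) as He. split.
  - unfold logw, logw1. auto_derive.
    + repeat split; try lra.
    + field. lra.
  - unfold logw2, logw1. auto_derive.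
    + repeat split; lra.
    + field. lra.
Qed.

(** The power p^(-k) contributes nothing, its logarithm being harmonic in the sense of
    [is_lap_comp]; the remaining term is positive as soon as b > 0 and al <> 0. *)
Lemma logw_lap (k b al p : R) : 0 < p ->
  logw1 k b al p + p * logw2 k b al p = b * al ^ 2 * exp (al * ln p) / (1 + exp (al * ln p)) ^ 2 / p.
Proof.
  intros Hp. pose proof (exp_pos (al * ln p)) as He. unfold logw2. field. lra.
Qed.

Lemma fermat_moduli (m n : nat) (a b : C) : (a ^ m + b ^ n)%C = 1%C ->
  Cmod b ^ n <= 1 + Cmod a ^ m /\ Cmod a ^ m <= 1 + Cmod b ^ n /\ 1 <= Cmod a ^ m + Cmod b ^ n.
Proof.
  intros E. rewrite <- !Cmod_pow. pose proof (Cmod_triangle (a ^ m) (b ^ n)) as H1.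
  rewrite -> E, Cmod_1 in H1.
  pose proof (Cmod_triangle 1 (- (a ^ m))) as H2. pose proof (Cmod_triangle 1 (- (b ^ n))) as H3.
  rewrite -> Cmod_opp, Cmod_1 in H2, H3.
  replace (1 + - a ^ m)%C with (b ^ n)%C in H2 by (rewrite <- E; ring).
  replace (1 + - b ^ n)%C with (a ^ m)%C in H3 by (rewrite <- E; ring). lra.
Qed.

(** * The case of multiple zeros *)

Lemma exp_le (x y : R) : x <= y -> exp x <= exp y.
Proof.
  intros [H| ->]; [apply Rlt_le, exp_increasing, H|apply Rle_refl].
Qed.

Lemma pow_le_self (x : R) (k : nat) : 0 <= x <= 1 -> (1 <= k)%nat -> x ^ k <= x.
Proof.
  intros Hx Hk. destruct k as [|k]; [lia|]. simpl.
  assert (x ^ k <= 1 ^ k) by (apply pow_incr; lra). rewrite pow1 in H. nra.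
Qed.

Lemma one_plus_pow_le (y : R) (n : nat) : 0 <= y -> (1 <= n)%nat -> 1 + y ^ n <= (1 + y) ^ n.
Proof.
  intros Hy. induction n as [|n IH]; [lia|]. intros _. destruct n as [|n]; [simpl; lra|].
  specialize (IH ltac:(lia)). assert (0 <= y ^ S n) by (apply pow_le, Hy).
  change (y ^ S (S n)) with (y * y ^ S n). change ((1 + y) ^ S (S n)) with ((1 + y) * (1 + y) ^ S n). nra.
Qed.

(** From x^m <= 1 + y^n one gets 1 + x^2 <= 2 (1 + y)^n. This bounds the factor (1 + |a|^2) (1 +
    |b|) of the weight by 2 (1 + |b|)^(n+1), a function of |b| alone. *)
Lemma ln_one_plus_sqr_le (m n : nat) (x y : R) :
  (2 <= m)%nat -> (2 <= n)%nat -> 0 <= x -> 0 < y -> x ^ m <= 1 + y ^ n ->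
  ln (1 + x ^ 2) + ln (1 + y) <= ln 2 + (INR n + 1) * ln (1 + y).
Proof.
  intros hm hn Hx Hy H.
  assert (Hpn : 1 + y ^ n <= (1 + y) ^ n) by (apply one_plus_pow_le; [lra|lia]).
  assert (H1 : 1 <= (1 + y) ^ n) by (apply pow_R1_Rle; lra).
  assert (H2 : 1 + x ^ 2 <= 2 * (1 + y) ^ n).
  { destruct (Rle_dec x 1) as [Hx1|Hx1]; [nra|].
    assert (x ^ 2 <= x ^ m) by (apply Rle_pow; [lra|exact hm]). lra. }
  assert (H3 : ln (1 + x ^ 2) <= ln 2 + INR n * ln (1 + y)).
  { rewrite <- ln_pow by lra. rewrite <- ln_mult by lra. apply ln_le; [nra|exact H2]. }
  lra.
Qed.

Lemma pow_exp_ln (y : R) (k : nat) : 0 < y -> y ^ k = exp (INR k * ln y).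
Proof. intros Hy. symmetry. apply (Rpower_pow k y Hy). Qed.

(** Here x^m >= y^n / 2, so x^(2(m-1)) is at least y^(2n(m-1)/m) / 4, and 4 m <= 3 n (m - 1) says
    that this exponent is at least 8/3. Among m, n >= 2 that condition excludes only (2, 2), and
    equality occurs at (3, 2). *)
Lemma curvature_bound_large (m n : nat) (x y : R) :
  (2 <= m)%nat -> (4 * m <= 3 * n * (m - 1))%nat -> (1 <= n)%nat -> 0 <= x -> 2 <= y -> y ^ n <= 1 + x ^ m ->
  exp (8 / 3 * ln y) / 4 <= (x ^ 2) ^ (m - 1).
Proof.
  intros hm hmn hn Hx Hy H.
  assert (Hyn : y <= y ^ n).
  { replace y with (y ^ 1) at 1 by ring. apply Rle_pow; [lra|exact hn]. }
  assert (Hxm : y ^ n / 2 <= x ^ m) by lra.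
  assert (Hx0 : 0 < x).
  { destruct (Rle_lt_or_eq_dec 0 x Hx) as [|E]; [assumption|]. subst x.
    rewrite -> pow_i in Hxm by lia. lra. }
  assert (HL : INR n * ln y - ln 2 <= INR m * ln x).
  { rewrite <- !ln_pow by lra. rewrite <- ln_div by (try apply pow_lt; lra).
    apply ln_le; [|exact Hxm]. apply Rdiv_lt_0_compat; [apply pow_lt; lra|lra]. }
  replace (exp (8 / 3 * ln y) / 4) with (exp (8 / 3 * ln y - 2 * ln 2)).
  2:{ unfold Rminus. rewrite -> exp_plus, exp_Ropp. replace (2 * ln 2) with (ln 2 + ln 2) by ring.
      rewrite -> exp_plus, exp_ln by lra. field. }
  rewrite <- pow_mult, pow_exp_ln by exact Hx0. apply exp_le.
  replace (INR (2 * (m - 1))) with (2 * INR m - 2).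
  2:{ rewrite -> mult_INR, minus_INR by lia. simpl. ring. }
  assert (Hm : 2 <= INR m) by (change 2 with (INR 2); apply le_INR, hm).
  assert (Hmn : 4 * INR m <= 3 * INR n * (INR m - 1)).
  { apply le_INR in hmn. rewrite -> !mult_INR, minus_INR in hmn by lia. simpl in hmn. lra. }
  assert (Hln2 : 0 < ln 2) by (rewrite <- ln_1; apply ln_increasing; lra).
  assert (HLy : 0 < ln y) by (rewrite <- ln_1; apply ln_increasing; lra).
  apply (Rmult_le_reg_l (INR m)); [lra|].
  apply Rle_trans with ((2 * INR m - 2) * (INR n * ln y - ln 2)).
  - assert (4 * INR m * ln y <= 3 * INR n * (INR m - 1) * ln y) by (apply Rmult_le_compat_r; lra).
    nra.
  - replace (INR m * ((2 * INR m - 2) * ln x)) with ((2 * INR m - 2) * (INR m * ln x)) by ring.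
    apply Rmult_le_compat_l; lra.
Qed.

(** The curvature inequality multiplied by s y^(2(n-1)), with x = |a|, y = |b|, s = |b|^(1/2), once
    the weight has been bounded. The three constants in the minimum belong, in order, to y >= 2, to
    y < 2 with x^m >= 1/2, and to y < 2 with x^m < 1/2, where y^n >= 1/2. *)
Lemma curvature_bound (m n : nat) (be ka x y s : R) :
  (2 <= m)%nat -> (2 <= n)%nat -> (4 * m <= 3 * n * (m - 1))%nat -> 0 < be -> 0 < ka ->
  0 <= x -> 0 < y -> 0 < s -> s ^ 2 = y ->
  y ^ n <= 1 + x ^ m -> 1 <= x ^ m + y ^ n ->
  Rmin (ka / 36) (Rmin (ka * (1 / 4) ^ (m - 1) / 108) (be * (1 / 4) ^ (n - 1) / 48))
    * (2 * exp (1 / 8 * ln (1 + y)))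
  <= s * (y ^ 2) ^ (n - 1) * (be / (1 + x ^ 2) ^ 2) + ka * (x ^ 2) ^ (m - 1) / (s * (1 + y) ^ 2).
Proof.
  intros hm hn hmn Hbe Hka Hx Hy Hs Hsy H1 H2.
  set (c2 := ka * (1 / 4) ^ (m - 1) / 108). set (c3 := be * (1 / 4) ^ (n - 1) / 48).
  assert (Hc1 : Rmin (ka / 36) (Rmin c2 c3) <= ka / 36) by apply Rmin_l.
  assert (Hc2 : Rmin (ka / 36) (Rmin c2 c3) <= c2) by (eapply Rle_trans; [apply Rmin_r|apply Rmin_l]).
  assert (Hc3 : Rmin (ka / 36) (Rmin c2 c3) <= c3) by (eapply Rle_trans; [apply Rmin_r|apply Rmin_r]).
  set (c := Rmin (ka / 36) (Rmin c2 c3)) in *. clearbody c.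
  set (E := exp (1 / 8 * ln (1 + y))). assert (HE : 0 < E) by apply exp_pos.
  assert (HX0 : 0 <= (x ^ 2) ^ (m - 1)) by (apply pow_le, pow_le, Hx).
  assert (HY0 : 0 < (y ^ 2) ^ (n - 1)) by (apply pow_lt, pow_lt, Hy).
  assert (Hx2 : 1 <= (1 + x ^ 2) ^ 2) by (pose proof (pow2_ge_0 x); nra).
  assert (Hd2 : 0 < s * (1 + y) ^ 2) by (apply Rmult_lt_0_compat; [lra|apply pow_lt; lra]).
  assert (T1 : 0 <= s * (y ^ 2) ^ (n - 1) * (be / (1 + x ^ 2) ^ 2)).
  { apply Rmult_le_pos; [apply Rmult_le_pos; lra|]. apply Rdiv_le_0_compat; lra. }
  assert (T2 : 0 <= ka * (x ^ 2) ^ (m - 1) / (s * (1 + y) ^ 2)).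
  { apply Rdiv_le_0_compat; [apply Rmult_le_pos; lra|lra]. }
  destruct (Rle_dec 2 y) as [Hy2|Hy2].
  - assert (HXl : exp (8 / 3 * ln y) / 4 <= (x ^ 2) ^ (m - 1)) by (eapply curvature_bound_large; eauto; lia).
    apply Rle_trans with (ka * (x ^ 2) ^ (m - 1) / (s * (1 + y) ^ 2)); [|lra].
    assert (HLy : 0 < ln y) by (rewrite <- ln_1; apply ln_increasing; lra).
    assert (Hse : s = exp (1 / 2 * ln y)).
    { rewrite <- Hsy. rewrite -> ln_pow by exact Hs. simpl INR. replace (1 / 2 * ((1 + 1) * ln s)) with (ln s) by field.
      symmetry. apply exp_ln, Hs. }
    assert (HEl : E <= 2 * exp (1 / 8 * ln y)).
    { apply Rle_trans with (exp (1 / 8 * (ln y + ln 2))).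
      - apply exp_le. apply Rmult_le_compat_l; [lra|]. rewrite <- ln_mult by lra. apply ln_le; lra.
      - rewrite -> Rmult_plus_distr_l, exp_plus, Rmult_comm. apply Rmult_le_compat_r; [apply Rlt_le, exp_pos|].
        rewrite <- (exp_ln 2) at 2 by lra. apply exp_le.
        assert (0 < ln 2) by (rewrite <- ln_1; apply ln_increasing; lra). lra. }
    apply Rle_trans with (ka / 9 * exp (1 / 8 * ln y)).
    { pose proof (exp_pos (1 / 8 * ln y)). nra. }
    apply Rle_trans with (ka * (exp (8 / 3 * ln y) / 4) / (s * (9 / 4 * y ^ 2))).
    (* As 8/3 = 1/6 + 1/2 + 2, dividing by s y^2 leaves y^(1/6), which beats the y^(1/8) on the
       left-hand side. *)
    + assert (E1 : exp (8 / 3 * ln y) = exp (1 / 6 * ln y) * (s * y ^ 2)).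
      { rewrite Hse. rewrite -> (pow_exp_ln y 2) by exact Hy. rewrite <- !exp_plus. f_equal. simpl. field. }
      rewrite E1. replace (ka * (exp (1 / 6 * ln y) * (s * y ^ 2) / 4) / (s * (9 / 4 * y ^ 2)))
        with (ka / 9 * exp (1 / 6 * ln y)) by (field; lra).
      apply Rmult_le_compat_l; [lra|]. apply exp_le. lra.
    + apply Rmult_le_compat.
      * apply Rmult_le_pos; [lra|]. apply Rdiv_le_0_compat; [apply Rlt_le, exp_pos|lra].
      * apply Rlt_le, Rinv_0_lt_compat. apply Rmult_lt_0_compat; [lra|]. nra.
      * apply Rmult_le_compat_l; lra.
      * apply Rinv_le_contravar; [exact Hd2|]. apply Rmult_le_compat_l; [lra|]. nra.
  - assert (HE3 : E <= 3).
    { rewrite <- (exp_ln 3) by lra. apply exp_le.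
      assert (0 < ln (1 + y)) by (rewrite <- ln_1; apply ln_increasing; lra).
      assert (ln (1 + y) <= ln 3) by (apply ln_le; lra). lra. }
    assert (Hs2 : s <= 2) by nra.
    destruct (Rle_dec (1 / 2) (x ^ m)) as [Hxm|Hxm].
    + assert (Hx12 : 1 / 2 <= x).
      { apply Rnot_lt_le. intros Hlt. assert (x ^ m <= x) by (apply pow_le_self; [lra|lia]). lra. }
      assert (HXm : (1 / 4) ^ (m - 1) <= (x ^ 2) ^ (m - 1)) by (apply pow_incr; nra).
      assert (H4 : 0 < (1 / 4) ^ (m - 1)) by (apply pow_lt; lra).
      apply Rle_trans with (ka * (x ^ 2) ^ (m - 1) / (s * (1 + y) ^ 2)); [|lra].
      apply Rle_trans with (ka * (1 / 4) ^ (m - 1) / 18).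
      * unfold c2 in Hc2. assert (0 < ka * (1 / 4) ^ (m - 1)) by (apply Rmult_lt_0_compat; lra). nra.
      * apply Rmult_le_compat; try lra.
        -- apply Rmult_le_pos; lra.
        -- apply Rmult_le_compat_l; lra.
        -- apply Rinv_le_contravar; [exact Hd2|].
           replace 18 with (2 * 9) by ring. apply Rmult_le_compat; try lra; [apply pow_le; lra|]. nra.
    + assert (Hy12 : 1 / 2 <= y).
      { apply Rnot_lt_le. intros Hlt. assert (y ^ n <= y) by (apply pow_le_self; [lra|lia]). lra. }
      assert (Hx1 : x <= 1).
      { apply Rnot_lt_le. intros Hlt. assert (1 <= x ^ m) by (apply pow_R1_Rle; lra). lra. }
      assert (HYn : (1 / 4) ^ (n - 1) <= (y ^ 2) ^ (n - 1)) by (apply pow_incr; nra).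
      assert (H4 : 0 < (1 / 4) ^ (n - 1)) by (apply pow_lt; lra).
      assert (Hs12 : 1 / 2 <= s) by nra.
      apply Rle_trans with (s * (y ^ 2) ^ (n - 1) * (be / (1 + x ^ 2) ^ 2)); [|lra].
      apply Rle_trans with (1 / 2 * (1 / 4) ^ (n - 1) * (be / 4)).
      * unfold c3 in Hc3. assert (0 < be * (1 / 4) ^ (n - 1)) by (apply Rmult_lt_0_compat; lra). nra.
      * apply Rmult_le_compat; try lra.
        -- apply Rmult_le_compat; lra.
        -- apply Rmult_le_compat_l; [lra|]. apply Rinv_le_contravar; [lra|]. assert (x ^ 2 <= 1) by nra. pose proof (pow2_ge_0 x). nra.
Qed.

(* The weight is |b|^-(n - 1 + 1/4) ((1 + |a|^2) (1 + |b|))^be; the bound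
   be (n + 1) = 1/16 makes the last factor O(|b|^(1/16)) at the poles. *)
Lemma fermat_derive_eq0_multiple (m n : nat) (f g : C -> option C) :
  (2 <= m)%nat -> (2 <= n)%nat -> (m, n) <> (2%nat, 2%nat) ->
  meromorphic f -> meromorphic g -> fermat_eq m n f g ->
  (forall z k, zero_of_order g z k -> (2 <= k)%nat) ->
  forall z a, f z = Some a -> C_derive (finite_part f) z = 0%C.
Proof.
  intros hm hn hne hf hg hfg Hz.
  assert (hmn : (4 * m <= 3 * n * (m - 1))%nat).
  { assert (m <> 2 \/ n <> 2)%nat.
    { destruct (Nat.eq_dec m 2) as [->|]; [|tauto]. right. intros ->. apply hne. reflexivity. }
    destruct (Nat.eq_dec m 2) as [->|]; [lia|]. nia. }
  set (be := / (16 * (INR n + 1))).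
  assert (Hn0 : 0 < INR n) by (apply lt_0_INR; lia).
  assert (Hm0 : 0 < INR m) by (apply lt_0_INR; lia).
  assert (Hbe : 0 < be) by (apply Rinv_0_lt_compat; lra).
  assert (Hben : be * (INR n + 1) = 1 / 16) by (unfold be; field; lra).
  assert (Hbe1 : be < 1) by nra.
  set (ga := INR (n - 1) + 1 / 4).
  (* The 1/4 is al^2 for al = 1/2 in the part of the weight that depends on b; (m / n)^2 comes from
     expressing |g'|^2 through |f'|^2. *)
  set (ka := (INR m / INR n) ^ 2 * be / 4).
  assert (Hka : 0 < ka).
  { unfold ka. assert (0 < (INR m / INR n) ^ 2) by (apply pow_lt, Rdiv_lt_0_compat; lra). nra. }
  (* Smooth at p = 0, so that [za] can be [False] and the zeros of f are not cut off. *)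
  set (A := fun p => be * ln (1 + p)).
  assert (Hweight : forall a b : C, b <> 0%C ->
            weight A (logw (ga / 2) be (1 / 2)) a b
            = exp (be * (ln (1 + Cmod a ^ 2) + ln (1 + Cmod b)) - ga * ln (Cmod b))).
  { intros a b Hb. apply Cmod_gt_0 in Hb. unfold weight, A, logw. f_equal.
    rewrite -> ln_pow by exact Hb. simpl INR.
    replace (1 / 2 * ((1 + 1) * ln (Cmod b))) with (ln (Cmod b)) by field.
    rewrite -> exp_ln by exact Hb. field. }
  assert (Hln2 : 0 < ln 2 < 1).
  { split; [rewrite <- ln_1; apply ln_increasing; lra|]. 
    apply exp_lt_inv. rewrite -> exp_ln by lra. pose proof (exp_ineq1 1). lra. }
  assert (HPle : forall a b : C, (a ^ m + b ^ n)%C = 1%C -> b <> 0%C ->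
            be * (ln (1 + Cmod a ^ 2) + ln (1 + Cmod b)) <= be * ln 2 + 1 / 16 * ln (1 + Cmod b)).
  { intros a b E Hb. apply Cmod_gt_0 in Hb. destruct (fermat_moduli m n a b E) as (_ & H2 & _).
    pose proof (ln_one_plus_sqr_le m n _ _ hm hn (Cmod_ge_0 a) Hb H2) as H.
    apply (Rmult_le_compat_l be) in H; [|lra]. rewrite <- Hben. lra. }
  pose (c := Rmin (ka / 36) (Rmin (ka * (1 / 4) ^ (m - 1) / 108) (be * (1 / 4) ^ (n - 1) / 48))).
  assert (Hc : 0 < c).
  { assert (0 < (1 / 4) ^ (m - 1)) by (apply pow_lt; lra). assert (0 < (1 / 4) ^ (n - 1)) by (apply pow_lt; lra).
    assert (0 < ka * (1 / 4) ^ (m - 1)) by (apply Rmult_lt_0_compat; assumption).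
    assert (0 < be * (1 / 4) ^ (n - 1)) by (apply Rmult_lt_0_compat; assumption).
    unfold c. repeat apply Rmin_glb_lt; lra. }
  (* For |b| >= 2 the weight is at most 4 |b|^(1/16 - ga), which is the origin of K = exp (2 ln 2)
     and of eta. *)
  apply (fermat_derive_eq0 m n f g False A (fun p => be / (1 + p)) (fun p => - be / (1 + p) ^ 2)
    (logw (ga / 2) be (1 / 2)) (logw1 (ga / 2) be (1 / 2)) (logw2 (ga / 2) be (1 / 2)) c (exp (2 * ln 2)) (ga - 1 / 16));
    try assumption.
  - intros p Hp _. unfold A. split; auto_derive; try lra; field; lra.
  - intros q Hq. apply is_derive_logw, Hq.
  - intros a b E Hb _. rewrite -> Hweight by exact Hb.
    destruct (fermat_moduli m n a b E) as (H1 & _ & H3). specialize (HPle a b E Hb).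
    assert (Hy : 0 < Cmod b) by (apply Cmod_gt_0, Hb).
    pose proof (Cmod_ge_0 a) as Hx.
    rewrite -> logw_lap by (apply pow_lt, Hy).
    set (x := Cmod a) in *. set (y := Cmod b) in *.
    replace (exp (1 / 2 * ln (y ^ 2))) with y.
    2:{ rewrite -> ln_pow by exact Hy. simpl INR. replace (1 / 2 * ((1 + 1) * ln y)) with (ln y) by field.
        symmetry. apply exp_ln, Hy. }
    set (s := exp (1 / 2 * ln y)).
    assert (Hs : 0 < s) by apply exp_pos.
    assert (Hsy : s ^ 2 = y).
    { unfold s. simpl. rewrite -> Rmult_1_r, <- exp_plus. rewrite <- (exp_ln y) at 3 by exact Hy. f_equal. field. }
    pose proof (curvature_bound m n be ka x y s hm hn hmn Hbe Hka Hx Hy Hs Hsy H1 H3) as HB. fold c in HB.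
    assert (HY0 : 0 < (y ^ 2) ^ (n - 1)) by (apply pow_lt, pow_lt, Hy).
    assert (HW : exp (be * (ln (1 + x ^ 2) + ln (1 + y)) - ga * ln y) ^ 2
                 <= 2 * exp (1 / 8 * ln (1 + y)) / (s * (y ^ 2) ^ (n - 1))).
    { rewrite -> pow_exp_ln, ln_exp by apply exp_pos. simpl INR.
      replace ((1 + 1) * (be * (ln (1 + x ^ 2) + ln (1 + y)) - ga * ln y))
        with (2 * (be * (ln (1 + x ^ 2) + ln (1 + y))) + - (2 * ga * ln y)) by ring.
      rewrite -> exp_plus, exp_Ropp.
      replace (exp (2 * ga * ln y)) with (s * (y ^ 2) ^ (n - 1)).
      2:{ rewrite <- pow_mult, pow_exp_ln by exact Hy. unfold s. rewrite <- exp_plus. f_equal.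
          rewrite mult_INR. simpl (INR 2). unfold ga. field. }
      apply Rmult_le_compat_r; [apply Rlt_le, Rinv_0_lt_compat, Rmult_lt_0_compat; assumption|].
      rewrite <- (exp_ln 2) by lra. rewrite <- exp_plus. apply exp_le.
      rewrite -> exp_ln by lra. nra. }
    apply (Rmult_le_compat_l c) in HW; [|lra].
    eapply Rle_trans; [exact HW|].
    apply (Rmult_le_reg_r (s * (y ^ 2) ^ (n - 1))); [apply Rmult_lt_0_compat; assumption|].
    replace (c * (2 * exp (1 / 8 * ln (1 + y)) / (s * (y ^ 2) ^ (n - 1))) * (s * (y ^ 2) ^ (n - 1)))
      with (c * (2 * exp (1 / 8 * ln (1 + y)))) by (field; lra).
    eapply Rle_trans; [exact HB|]. apply Req_le.
    unfold ka. pose proof (pow2_ge_0 x) as Hx2.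
    revert HY0. generalize ((y ^ 2) ^ (n - 1)). intros Y HY0. generalize ((x ^ 2) ^ (m - 1)). intros X.
    rewrite <- Hsy. pose proof (pow_lt s 2 Hs) as Hs2. field. repeat split; try lra; nra.
  - intros a b E Hb2 _. assert (Hb : b <> 0%C) by (apply Cmod_gt_0; lra).
    rewrite -> Hweight by exact Hb. specialize (HPle a b E Hb).
    unfold Rpower. rewrite <- exp_plus. apply exp_le.
    assert (ln (1 + Cmod b) <= ln 2 + ln (Cmod b)).
    { rewrite <- ln_mult by lra. apply ln_le; lra. }
    assert (be * ln 2 <= ln 2) by nra. lra.
  - intros j k Hj Hk Hjk.
    (* For m = n = 2 a simple common pole would violate this. Since eta = n - 1 + 3/16, the
       non-strict inequality suffices. *)
    assert (Hjk2 : (j + 1 <= (n - 1) * k)%nat).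
    { destruct n as [|n']; [lia|]. replace (S n' - 1)%nat with n' by lia.
      destruct m as [|m']; [lia|].
      assert (m' <> 1 \/ n' <> 1)%nat.
      { destruct (Nat.eq_dec m' 1) as [->|]; [|tauto]. right. intros ->. apply hne. reflexivity. }
      destruct (Nat.lt_ge_cases j k) as [Hlt|Hge]; [nia|].
      destruct (Nat.eq_dec m' 1) as [->|]; nia. }
    apply le_INR in Hjk2. rewrite -> plus_INR, mult_INR in Hjk2. simpl in Hjk2.
    assert (0 < INR k) by (apply lt_0_INR; lia). unfold ga. nra.
  - intros [].
  - intros z k Hzk. split; [eapply Hz, Hzk|]. intros a b E Hb Hb1.
    rewrite -> Hweight by exact Hb. specialize (HPle a b E Hb).
    apply Cmod_gt_0 in Hb.
    unfold Rpower. rewrite <- exp_plus. apply exp_le. fold ga.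
    assert (ln (1 + Cmod b) <= ln 2) by (apply ln_le; lra).
    assert (be * ln 2 <= ln 2) by nra. lra.
Qed.

(** * The case m = n = 2 *)

(* xi = |a|^(1/2) and ze = |b|^(1/2). *)
Lemma curvature_bound_22_le (xi ze : R) :
  0 < xi -> xi <= ze -> 1 <= xi ^ 4 + ze ^ 4 ->
  (1 + xi) * (1 + ze) / 648 <= ze ^ 7 / (1 + xi) ^ 2 + xi ^ 7 / (1 + ze) ^ 2.
Proof.
  intros Hx Hxz H1.
  assert (Hz : 1 / 2 <= ze).
  { apply Rnot_lt_le. intros Hlt.
    assert (xi ^ 4 <= (1 / 2) ^ 4) by (apply pow_incr; lra).
    assert (ze ^ 4 <= (1 / 2) ^ 4) by (apply pow_incr; lra). lra. }
  assert (H0 : 0 <= xi ^ 7 / (1 + ze) ^ 2) by (apply Rdiv_le_0_compat; [apply pow_le; lra|apply pow_lt; lra]).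
  apply Rle_trans with (ze ^ 7 / (1 + xi) ^ 2); [|lra].
  apply (Rmult_le_reg_r ((1 + xi) ^ 2)); [apply pow_lt; lra|].
  replace (ze ^ 7 / (1 + xi) ^ 2 * (1 + xi) ^ 2) with (ze ^ 7) by (field; lra).
  (* Since ze >= 1/2 and xi <= ze, both 1 + xi and 1 + ze are at most 3 ze. The constant is 648 =
     3^4 * 2^3, where 2^3 comes from ze^3 >= 1/8. *)
  apply Rle_trans with ((3 * ze) ^ 4 / 648).
  - replace ((1 + xi) * (1 + ze) / 648 * (1 + xi) ^ 2) with ((1 + xi) ^ 3 * (1 + ze) / 648) by field.
    replace ((3 * ze) ^ 4) with ((3 * ze) ^ 3 * (3 * ze)) by ring.
    apply Rmult_le_compat_r; [lra|]. apply Rmult_le_compat; try lra; [apply pow_le; lra|].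
    apply pow_incr. lra.
  - assert (Hz3 : (1 / 2) ^ 3 <= ze ^ 3) by (apply pow_incr; lra).
    replace ((3 * ze) ^ 4 / 648) with ((1 / 2) ^ 3 * ze ^ 4) by field.
    replace (ze ^ 7) with (ze ^ 3 * ze ^ 4) by ring.
    apply Rmult_le_compat_r; [apply pow_le; lra|exact Hz3].
Qed.

Lemma curvature_bound_22 (xi ze : R) :
  0 < xi -> 0 < ze -> 1 <= xi ^ 4 + ze ^ 4 ->
  (1 + xi) * (1 + ze) / 648 <= ze ^ 7 / (1 + xi) ^ 2 + xi ^ 7 / (1 + ze) ^ 2.
Proof.
  intros Hx Hz H1. destruct (Rle_dec xi ze) as [H|H].
  - apply curvature_bound_22_le; assumption.
  - pose proof (curvature_bound_22_le ze xi Hz ltac:(lra) ltac:(lra)) as H2.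
    rewrite (Rmult_comm (1 + ze)) in H2. lra.
Qed.

(* The weight is |a|^(-3/4) |b|^(-7/4) ((1 + |a|^(1/2)) (1 + |b|^(1/2)))^(1/4). *)
Lemma fermat_derive_eq0_22 (f g : C -> option C) :
  meromorphic f -> meromorphic g -> fermat_eq 2 2 f g ->
  (forall z k, ~ zero_of_order f z k) -> (forall z k, ~ zero_of_order g z k) ->
  forall z a, f z = Some a -> C_derive (finite_part f) z = 0%C.
Proof.
  intros hf hg hfg Hzf Hzg.
  assert (Hln : forall x : R, 0 < x -> ln (x ^ 2) = 4 * ln (exp (1 / 4 * ln (x ^ 2)))).
  { intros x Hx. rewrite ln_exp. field. }
  assert (Hpow : forall x : R, 0 < x -> x ^ 2 = exp (1 / 4 * ln (x ^ 2)) ^ 4).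
  { intros x Hx. rewrite -> (pow_exp_ln (exp _)), ln_exp by apply exp_pos.
    rewrite <- (exp_ln (x ^ 2)) at 1 by (apply pow_lt, Hx). f_equal. simpl INR. field. }
  (* The metric is |da / b| |a b|^(-3/4) times a factor symmetric in a and b, and da / b = - db / a
     on the curve; hence 3/8 against 7/8. The 64 is the inverse of (1/4) (1/4)^2, the coefficient in
     [logw_lap]. At poles |a| and |b| are comparable, so the weight has size |b|^(-3/4 - 7/4 + 1/4)
     = |b|^(-9/4). *)
  apply (fermat_derive_eq0 2 2 f g True
    (logw (3 / 8) (1 / 4) (1 / 4)) (logw1 (3 / 8) (1 / 4) (1 / 4)) (logw2 (3 / 8) (1 / 4) (1 / 4))
    (logw (7 / 8) (1 / 4) (1 / 4)) (logw1 (7 / 8) (1 / 4) (1 / 4)) (logw2 (7 / 8) (1 / 4) (1 / 4))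
    (1 / (64 * 648)) (exp (2 * ln 2 + ln 3)) (9 / 4)); try assumption; try lia; try lra.
  - intros p _ Hp. apply is_derive_logw, Hp, I.
  - intros q Hq. apply is_derive_logw, Hq.
  - intros a b E Hb Ha. specialize (Ha I).
    destruct (fermat_moduli 2 2 a b E) as (_ & _ & H3).
    apply Cmod_gt_0 in Ha. apply Cmod_gt_0 in Hb.
    rewrite -> !logw_lap by (apply pow_lt; assumption). unfold weight, logw.
    pose proof (Hpow _ Ha) as Pa. pose proof (Hpow _ Hb) as Pb.
    pose proof (Hln _ Ha) as La. pose proof (Hln _ Hb) as Lb.
    set (xi := exp (1 / 4 * ln (Cmod a ^ 2))) in *. set (ze := exp (1 / 4 * ln (Cmod b ^ 2))) in *.
    assert (Hxi : 0 < xi) by apply exp_pos. assert (Hze : 0 < ze) by apply exp_pos.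
    clearbody xi ze. rewrite -> La, Lb. rewrite -> Pa, Pb in *.
    pose proof (curvature_bound_22 xi ze Hxi Hze H3) as HB.
    (* The squared weight contains the square root of (1 + xi) (1 + ze), bounded here by the product
       itself. *)
    assert (HW : exp (- (3 / 8) * (4 * ln xi) + 1 / 4 * ln (1 + xi)
                      + (- (7 / 8) * (4 * ln ze) + 1 / 4 * ln (1 + ze))) ^ 2
                 <= (1 + xi) * (1 + ze) / (xi ^ 3 * ze ^ 7)).
    { rewrite -> pow_exp_ln, ln_exp by apply exp_pos.
      replace ((1 + xi) * (1 + ze) / (xi ^ 3 * ze ^ 7)) with
        (exp (ln (1 + xi) + ln (1 + ze) - (3 * ln xi + 7 * ln ze))).
      - apply exp_le. simpl INR.
        assert (0 < ln (1 + xi)) by (rewrite <- ln_1; apply ln_increasing; lra).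
        assert (0 < ln (1 + ze)) by (rewrite <- ln_1; apply ln_increasing; lra). lra.
      - unfold Rminus. rewrite -> exp_plus, exp_Ropp, !exp_plus, !exp_ln by lra.
        rewrite -> (pow_exp_ln xi), (pow_exp_ln ze) by assumption. simpl INR. unfold Rdiv. do 4 f_equal; f_equal; ring. }
    apply (Rmult_le_compat_l (1 / (64 * 648))) in HW; [|lra].
    eapply Rle_trans; [exact HW|].
    apply (Rmult_le_reg_r (64 * (xi ^ 3 * ze ^ 7))).
    { apply Rmult_lt_0_compat; [lra|]. apply Rmult_lt_0_compat; apply pow_lt; assumption. }
    replace (1 / (64 * 648) * ((1 + xi) * (1 + ze) / (xi ^ 3 * ze ^ 7)) * (64 * (xi ^ 3 * ze ^ 7)))
      with ((1 + xi) * (1 + ze) / 648) by (field; lra).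
    eapply Rle_trans; [exact HB|]. apply Req_le. simpl (2 - 1)%nat. simpl (INR 2). field. lra.
  - intros a b E Hb2 Ha. specialize (Ha I).
    destruct (fermat_moduli 2 2 a b E) as (H1 & H2 & _).
    apply Cmod_gt_0 in Ha. assert (Hb : 0 < Cmod b) by lra.
    unfold weight, logw, Rpower.
    assert (Lb2 : ln (Cmod b) = 2 * ln (exp (1 / 4 * ln (Cmod b ^ 2)))).
    { rewrite -> ln_exp, ln_pow by exact Hb. simpl INR. field. }
    assert (Hb4 : 4 <= Cmod b ^ 2) by nra.
    pose proof (Hpow _ Ha) as Pa. pose proof (Hpow _ Hb) as Pb.
    pose proof (Hln _ Ha) as La. pose proof (Hln _ Hb) as Lb.
    set (xi := exp (1 / 4 * ln (Cmod a ^ 2))) in *. set (ze := exp (1 / 4 * ln (Cmod b ^ 2))) in *.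
    assert (Hxi : 0 < xi) by apply exp_pos. assert (Hze : 0 < ze) by apply exp_pos.
    clearbody xi ze. rewrite -> La, Lb, Lb2. rewrite -> Pa, Pb in *.
    assert (Hze1 : 1 <= ze).
    { apply Rnot_lt_le. intros Hlt. assert (ze ^ 4 <= 1 ^ 4) by (apply pow_incr; lra). rewrite pow1 in H. lra. }
    (* As xi^4 = |a|^2 and ze^4 = |b|^2 differ by at most 1 while ze^4 >= 4, xi and ze agree up to a
       factor 2. *)
    assert (Hxl : ze / 2 <= xi).
    { apply Rnot_lt_le. intros Hlt. assert (xi ^ 4 <= (ze / 2) ^ 4) by (apply pow_incr; lra).
      replace ((ze / 2) ^ 4) with (ze ^ 4 / 16) in H by field. lra. }
    assert (Hxu : xi <= 2 * ze).
    { apply Rnot_lt_le. intros Hlt. assert ((2 * ze) ^ 4 <= xi ^ 4) by (apply pow_incr; lra).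
      replace ((2 * ze) ^ 4) with (16 * ze ^ 4) in H by ring. lra. }
    rewrite <- exp_plus. apply exp_le.
    assert (L1 : ln ze - ln 2 <= ln xi) by (rewrite <- ln_div by lra; apply ln_le; lra).
    assert (L2 : ln (1 + xi) <= ln 3 + ln ze) by (rewrite <- ln_mult by lra; apply ln_le; lra).
    assert (L3 : ln (1 + ze) <= ln 2 + ln ze) by (rewrite <- ln_mult by lra; apply ln_le; lra).
    assert (0 < ln 2) by (rewrite <- ln_1; apply ln_increasing; lra).
    assert (0 < ln 3) by (rewrite <- ln_1; apply ln_increasing; lra). lra.
  - intros j k Hj Hk Hjk. assert (j = k) by lia. subst j.
    assert (1 <= INR k) by (change 1 with (INR 1); apply le_INR, Hk). lra.
  - intros _. exact Hzf.
  - intros z k Hzk. exfalso. exact (Hzg z k Hzk).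
Qed.

(** * Zeros of the derivatives and the conclusion *)

Lemma mderive_eq (f : C -> option C) (z a : C) :
  f z = Some a -> mderive f z = Some (C_derive (finite_part f) z).
Proof. unfold mderive. intros ->. reflexivity. Qed.

Lemma zero_set_mderive (f : C -> option C) (z a : C) :
  f z = Some a -> zero_set (mderive f) z <-> C_derive (finite_part f) z = 0%C.
Proof.
  intros Ha. unfold zero_set. rewrite (mderive_eq _ _ _ Ha).
  generalize (C_derive (finite_part f) z). intros l. split; congruence.
Qed.

Lemma zero_of_order_local (g : C -> option C) (z0 : C) (k : nat) :
  zero_of_order g z0 k -> (1 <= k)%nat /\ exists v : C -> C, hol v z0 /\ v z0 <> 0%C /\
    near z0 (fun z => g z = Some ((z - z0) ^ k * v z)%C) /\ g z0 = Some (RtoC 0).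
Proof.
  intros [Hk [v [Hv [Hv0 Hn]]]]. apply near_locally in Hn.
  split; [exact Hk|]. exists v. split; [apply holomorphic_at_hol, Hv|]. split; [exact Hv0|]. split; [exact Hn|].
  pose proof (near_self _ _ Hn) as E. simpl in E. rewrite E. f_equal.
  destruct k as [|k]; [lia|]. simpl. ring.
Qed.

(* At a zero of [g] the equation forces [f' = 0], as [n >= 2]. *)
Lemma zeros_subset_multiple (m n : nat) (f g : C -> option C) :
  (2 <= m)%nat -> (2 <= n)%nat -> meromorphic f -> meromorphic g -> fermat_eq m n f g ->
  zeros_subset (mderive f) (mderive g) -> forall z k, zero_of_order g z k -> (2 <= k)%nat.
Proof.
  intros hm hn hf hg hfg Hsub z0 k Hk.
  destruct (zero_of_order_local _ _ _ Hk) as (Hk1 & v & Hv & Hv0 & Hn & Hg0).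
  destruct (fermat_finite n m g f z0 _ hn hm hg hf (fermat_eq_sym _ _ _ _ hfg) Hg0) as [a Ha].
  destruct (fermat_zero m n f g z0 a hm hn hf hg hfg Ha Hg0) as [_ HF].
  apply (zero_set_mderive _ _ _ Ha) in HF. apply Hsub in HF. apply (zero_set_mderive _ _ _ Hg0) in HF.
  pose proof (near_self _ _ (zero_derive g z0 k v Hk1 Hv Hn)) as E2. simpl in E2. rewrite HF in E2.
  apply NNPP. intros Hk2. assert (k = 1%nat) by lia. subst k. simpl in E2.
  apply (zero_num_neq0 1 v z0 Hk1 Hv0). rewrite -> Cmult_1_l in E2. symmetry. exact E2.
Qed.

(* At a zero of [f] of order [k], [f'] has order [k - 1] while [g' = - f f' / g] has larger order. *)
Lemma same_zeros_no_zero (f g : C -> option C) :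
  meromorphic f -> meromorphic g -> fermat_eq 2 2 f g ->
  same_zeros_mult (mderive f) (mderive g) -> forall z k, ~ zero_of_order f z k.
Proof.
  intros hf hg hfg [Hset Hord] z0 k Hk.
  destruct (zero_of_order_local _ _ _ Hk) as (Hk1 & v & Hv & Hv0 & Hn & Hf0).
  destruct (fermat_finite 2 2 f g z0 _ ltac:(lia) ltac:(lia) hf hg hfg Hf0) as [b Hb].
  destruct (regular_finite_part f z0 _ hf Hf0) as [HF HFn].
  destruct (regular_finite_part g z0 _ hg Hb) as [HG HGn].
  assert (Eb := finite_part_eq _ _ _ Hb). assert (Ea := finite_part_eq _ _ _ Hf0).
  assert (Hb0 : finite_part g z0 <> 0%C).
  { rewrite Eb. intros ->. pose proof (hfg z0 _ _ Hf0 Hb) as E. simpl in E.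
    apply (f_equal Re) in E. unfold Re in E. simpl in E. lra. }
  pose proof (zero_derive f z0 k v Hk1 Hv Hn) as HFd.
  pose proof (hol_continuous _ _ (hol_zero_num k v z0 Hv)) as Hnum.
  pose proof (zero_num_neq0 k v z0 Hk1 Hv0) as Hnum0.
  assert (HGd : near z0 (fun z => C_derive (finite_part g) z
            = (- (finite_part f z / finite_part g z) * C_derive (finite_part f) z)%C)).
  { generalize (near_and _ _ _ (near_neq0 _ _ (hol_continuous _ _ HG) Hb0) (near_and _ _ _ HFn HGn)).
    apply near_imp. intros z (H1 & H2 & H3).
    pose proof (fermat_derive 2 2 f g z _ _ hf hg hfg H2 H3) as E. simpl (2 - 1)%nat in E.
    rewrite -> !Cpow_1_r in E. simpl INR in E.
    assert (H4 : RtoC (1 + 1) <> 0%C) by (intros E4; apply (f_equal Re) in E4; unfold Re in E4; simpl in E4; lra).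
    assert (E' : (finite_part f z * C_derive (finite_part f) z + finite_part g z * C_derive (finite_part g) z)%C = 0%C).
    { apply NNPP. intros H5. apply (Cmult_neq_0 _ _ H4 H5). rewrite <- E. ring. }
    replace (C_derive (finite_part g) z)
      with ((finite_part g z * C_derive (finite_part g) z) / finite_part g z)%C by (field; exact H1).
    replace (finite_part g z * C_derive (finite_part g) z)%C
      with (- (finite_part f z * C_derive (finite_part f) z))%C; [field; exact H1|].
    apply Ceq_minus. apply (f_equal Copp) in E'.
    replace (- (finite_part f z * C_derive (finite_part f) z) - finite_part g z * C_derive (finite_part g) z)%C
      with (- (finite_part f z * C_derive (finite_part f) z + finite_part g z * C_derive (finite_part g) z))%C by ring.
    rewrite E'. ring. }
  (* For k = 1 the order k - 1 is 0, which [zero_of_order] does not record; there the zero sets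
     themselves differ, since g' vanishes at z0 and f' does not. *)
  destruct (Nat.eq_dec k 1) as [->|Hk2].
  - pose proof (near_self _ _ HGd) as E. simpl in E. rewrite Ea in E.
    assert (E0 : C_derive (finite_part g) z0 = 0%C) by (rewrite E; unfold Cdiv; ring).
    apply (zero_set_mderive _ _ _ Hb) in E0. apply Hset in E0. apply (zero_set_mderive _ _ _ Hf0) in E0.
    pose proof (near_self _ _ HFd) as E1. simpl in E1. rewrite E0 in E1.
    apply Hnum0. rewrite -> Cmult_1_l in E1. symmetry. exact E1.
  - assert (Some_inj : forall x y : C, Some x = Some y -> x = y) by congruence.
    assert (Hof : zero_of_order (mderive f) z0 (k - 1)).
    { apply (zero_of_order_intro _ _ _ (zero_num k v z0)); [lia| |exact Hnum0|].
      - apply hol_zero_num, Hv.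
      - generalize (near_and _ _ _ HFn HFd). apply near_imp. intros z [H1 H2].
        rewrite (mderive_eq _ _ _ H1) H2. reflexivity. }
    apply Hord in Hof. destruct (zero_of_order_local _ _ _ Hof) as (_ & w & Hw & Hw0 & Hwn & _).
    apply Hw0.
    (* Divide g' = - (f / g) f' by (z - z0)^(k-1) and let z tend to z0: the right-hand side vanishes
       together with f, against w(z0) <> 0. *)
    assert (E : (w z0 + finite_part f z0 / finite_part g z0 * zero_num k v z0 z0)%C = 0%C).
    { apply (continuous_eq0_of_punctured (fun z => (w z + finite_part f z / finite_part g z * zero_num k v z0 z)%C)).
      - apply continuous_Cplus; [apply hol_continuous, Hw|]. apply continuous_Cmult; [|exact Hnum].
        apply continuous_Cmult; [apply hol_continuous, HF|].
        apply continuous_Cinv; [apply hol_continuous, HG|exact Hb0].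
      - generalize (near_and _ _ _ (near_and _ _ _ HGn Hwn) (near_and _ _ _ HGd HFd)).
        apply near_imp. intros z ((H1 & H2) & H3 & H4) Hz.
        rewrite (mderive_eq _ _ _ H1) in H2. apply Some_inj in H2. rewrite -> H3, H4 in H2.
        assert (Hd : ((z - z0) ^ (k - 1))%C <> 0%C) by apply Cpow_nz, Cminus_eq_contra, Hz.
        apply NNPP. intros H5. apply (Cmult_neq_0 _ _ Hd H5).
        rewrite -> Cmult_plus_distr_l, <- H2. ring. }
    rewrite Ea in E. rewrite <- E. unfold Cdiv. ring.
Qed.

Lemma is_constant_mderive (f : C -> option C) : is_constant f -> forall z, mderive f z = Some (RtoC 0).
Proof.
  intros [c Hc] z. rewrite (mderive_eq _ _ _ (Hc z)). f_equal.
  apply (near_C_derive_eq0 _ _ c). exists 1. split; [lra|]. intros w _. apply finite_part_eq, Hc.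
Qed.

Lemma same_zeros_mult_ext (h1 h2 : C -> option C) : (forall z, h1 z = h2 z) -> same_zeros_mult h1 h2.
Proof.
  intros H. split.
  - intros z. unfold zero_set. rewrite H. tauto.
  - intros z k. split; intros (Hk & u & Hu & Hu0 & Hn); split; try exact Hk; exists u;
      (split; [exact Hu|]); (split; [exact Hu0|]); revert Hn; apply filter_imp; intros w Hw; congruence.
Qed.

Theorem theorem4 (m n : nat) (hm : (2 <= m)%nat) (hn : (2 <= n)%nat)
    (f g : C -> option C) (hf : meromorphic f) (hg : meromorphic g)
    (hfg : fermat_eq m n f g) :
  (m = 2%nat /\ n = 2%nat ->
     (is_constant f /\ is_constant g <-> same_zeros_mult (mderive f) (mderive g)))
  /\
  ((m, n) <> (2%nat, 2%nat) ->
     (is_constant f /\ is_constant g <->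
        zeros_subset (mderive f) (mderive g) \/
        zeros_subset (mderive g) (mderive f))).
Proof.
  split.
  - intros [-> ->]. split.
    + intros [Hf Hg]. apply same_zeros_mult_ext. intros z.
      rewrite !is_constant_mderive; auto.
    + intros H. apply (fermat_constant 2 2); try assumption.
      apply (fermat_derive_eq0_22 f g); try assumption.
      * apply (same_zeros_no_zero f g); assumption.
      * apply (same_zeros_no_zero g f); try assumption; [apply fermat_eq_sym, hfg|].
        destruct H as [H1 H2]. split; intros; symmetry; auto.
  - intros Hne. split.
    + intros [_ Hg]. left. intros z _. apply is_constant_mderive, Hg.
    + intros [H|H].
      * apply (fermat_constant m n); try assumption.
        apply (fermat_derive_eq0_multiple m n f g); try assumption.
        apply (zeros_subset_multiple m n f g); assumption.
      * apply and_comm. apply (fermat_constant n m); try assumption; [apply fermat_eq_sym, hfg|].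
        apply (fermat_derive_eq0_multiple n m g f); try assumption; [congruence|apply fermat_eq_sym, hfg|].
        apply (zeros_subset_multiple n m g f); try assumption. apply fermat_eq_sym, hfg.
Qed.
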